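(* Let $M$ be in $\mathsf{D}^{\mathrm{c}}(R)$. Let $P$ be locally finite in $\mathsf{D}(R^{\mathrm{o}})$ and suppose $\operatorname{amp} P < \infty$. Then $$\operatorname{amp}(P \otimes^{\mathrm{L}}_R M) = \operatorname{amp} P + \operatorname{pcd} M - \inf M.$$
   Context: $k$ is a field and $R$ is a cochain Differential Graded (DG) algebra over $k$ (cohomologically graded) of the form $\cdots \to 0 \to k \to 0 \to R^2 \to R^3 \to \cdots$, i.e. $R^j = 0$ for $j<0$, $R^0 = k$, $R^1 = 0$, with $\dim_k \mathrm{H}^j(R) < \infty$ for each $j$. $\mathsf{D}(R)$ and $\mathsf{D}(R^{\mathrm{o}})$ are the derived categories of DG left-$R$-modules and DG right-$R$-modules, and $\otimes^{\mathrm{L}}_R$ is the left derived tensor product. $k$ is viewed as a DG bi-$R$-module concentrated in degree $0$. A DG left-$R$-module is in $\mathsf{D}^{\mathrm{c}}(R)$ (compact) precisely if it is finitely built from $R$ in $\mathsf{D}(R)$ using distinguished triangles, (de)suspensions, finite direct sums and direct summands. A DG $R$-module $N$ is locally finite if $\dim_k \mathrm{H}^j(N) < \infty$ for each $j$. For a DG module (or complex) $N$: $\inf N = \inf\{ j \mid \mathrm{H}^j(N) \neq 0\}$, $\sup N = \sup\{ j \mid \mathrm{H}^j(N)\neq 0\}$, $\operatorname{amp} N = \sup N - \inf N$, with the conventions $\inf \varnothing = \infty$, $\sup\varnothing = -\infty$, so $\operatorname{amp} 0 = -\infty$. The projective codimension of a DG left-$R$-module $M$ is $\operatorname{pcd}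 M = \sup(k \otimes^{\mathrm{L}}_R M)$. *)

(* Defs.v *)
From HB Require Import structures.
From mathcomp Require Import all_boot all_order all_algebra.
From mathcomp Require Import mathcomp_extra boolp classical_sets constructive_ereal.
From mathcomp.multinomials Require Import freeg.
From mathcomp Require Import zify ring_quotient generic_quotient.

Set Implicit Arguments.
Unset Strict Implicit.
Unset Printing Implicit Defensive.

Import Order.TTheory GRing.Theory Num.Theory.
Local Open Scope ring_scope.

Definition ksign (V : zmodType) (i : int) (x : V) : V :=
  if odd (absz i) then - x else x.

(* A Z-grading of V together with a differential of degree +1. The grading
   V = \bigoplus_j V^j is internal and given by the projections
   [gpart j : V -> V] onto V^j, so that no transport between the V^j along
   equalities of degrees is needed. *)
Record dgstr (V : zmodType) := DGStr {
  gpart : int -> V -> V;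
  diff : V -> V;
  gpart_additive : forall j, {morph gpart j : x y / x + y};
  gpart_gpart : forall i j x, gpart i (gpart j x) = if i == j then gpart j x else 0;
  gpart_fin : forall x, exists2 s : seq int, uniq s & x = \sum_(j <- s) gpart j x;
  diff_additive : {morph diff : x y / x + y};
  diff_gpart : forall j x, diff (gpart j x) = gpart (j + 1) (diff x);
  diff_diff : forall x, diff (diff x) = 0
}.

Definition homog (V : zmodType) (S : dgstr V) (j : int) (x : V) := gpart S j x = x.

(* Cochain complexes, with underlying additive group only: the notions inf, sup
   and amp of a DG module do not depend on more. *)
Record complex := Complex {
  cx_sort :> zmodType;
  cx_str :> dgstr cx_sort
}.

Record dga (k : fieldType) := DGA {
  dga_sort :> algType k;
  dga_str : dgstr dga_sort;
  dga_gpartZ : forall j (c : k) a, gpart dga_str j (c *: a) = c *: gpart dga_str j a;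
  dga_diffZ : forall (c : k) a, diff dga_str (c *: a) = c *: diff dga_str a;
  dga_homog1 : homog dga_str 0 1;
  dga_homogM : forall i j a b,
    homog dga_str i a -> homog dga_str j b -> homog dga_str (i + j) (a * b);
  dga_leibniz : forall i a b, homog dga_str i a ->
    diff dga_str (a * b) = diff dga_str a * b + ksign i (a * diff dga_str b)
}.

(* DG left-modules. That the homogeneous parts are k-subspaces and that the
   differential is k-linear follows from the axioms applied to the
   scalars c%:A, which are cocycles of degree 0. *)
Record dglmod (k : fieldType) (A : dga k) := DGLmod {
  dgl_sort :> lmodType A;
  dgl_str : dgstr dgl_sort;
  dgl_homogZ : forall i j (a : A) x,
    homog (dga_str A) i a -> homog dgl_str j x -> homog dgl_str (i + j) (a *: x);
  dgl_leibniz : forall i (a : A) x, homog (dga_str A) i a ->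
    diff dgl_str (a *: x) = diff (dga_str A) a *: x + ksign i (a *: diff dgl_str x)
}.

(* DG right-modules: modules over the converse ring, i.e. (a : A^c) *: x is x a. *)
Record dgrmod (k : fieldType) (A : dga k) := DGRmod {
  dgr_sort :> lmodType A^c;
  dgr_str : dgstr dgr_sort;
  dgr_homogZ : forall i j (a : A) x,
    homog dgr_str i x -> homog (dga_str A) j a -> homog dgr_str (i + j) ((a : A^c) *: x);
  dgr_leibniz : forall i (a : A) x, homog dgr_str i x ->
    diff dgr_str ((a : A^c) *: x) =
    (a : A^c) *: diff dgr_str x + ksign i ((diff (dga_str A) a : A^c) *: x)
}.

Coercion dgl_complex (k : fieldType) (A : dga k) (X : dglmod A) : complex :=
  Complex (dgl_str X).
Coercion dgr_complex (k : fieldType) (A : dga k) (X : dgrmod A) : complex :=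
  Complex (dgr_str X).

Definition cocycle (C : complex) (j : int) (x : C) := homog C j x /\ diff C x = 0.

Definition coboundary (C : complex) (j : int) (x : C) :=
  exists2 y : C, homog C (j - 1) y & diff C y = x.

Definition coh_neq0 (C : complex) (j : int) :=
  exists2 x : C, cocycle j x & ~ coboundary j x.

Definition coh_inf (C : complex) : \bar int :=
  infimum +oo%E [set j%:E | j in [set j | coh_neq0 C j]]%classic.

Definition coh_sup (C : complex) : \bar int :=
  supremum -oo%E [set j%:E | j in [set j | coh_neq0 C j]]%classic.

(* In \bar int one has -oo - +oo = -oo, so amp 0 = -oo. *)
Definition amp (C : complex) : \bar int := (coh_sup C - coh_inf C)%E.

(* H^j(C) is spanned by finitely many classes over k, which acts by sc *)
Definition coh_fin (k : fieldType) (C : complex) (sc : k -> C -> C) (j : int) :=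
  exists2 s : seq C, (forall x, x \in s -> cocycle j x) &
    forall x : C, cocycle j x -> exists c : nat -> k,
      coboundary j (x - \sum_(i < size s) sc (c i) s`_i).

Definition dga_coh_fin (k : fieldType) (A : dga k) :=
  forall j, @coh_fin k (Complex (dga_str A)) (fun c a => c *: (a : A)) j.

Definition locally_finite (k : fieldType) (A : dga k) (P : dgrmod A) :=
  forall j, @coh_fin k P (fun c x => (c%:A : A^c) *: (x : P)) j.

(* ... -> 0 -> k -> 0 -> R^2 -> R^3 -> ... *)
Record simply_connected (k : fieldType) (R : dga k) : Prop := SimplyConnected {
  sc_neg : forall j (r : R), j < 0 -> homog (dga_str R) j r -> r = 0;
  sc_zero : forall r : R, homog (dga_str R) 0 r -> exists c : k, r = c%:A;
  sc_one : forall r : R, homog (dga_str R) 1 r -> r = 0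
}.

Record dghom (k : fieldType) (A : dga k) (X Y : dglmod A) := DGHom {
  dgh_fun :> {linear X -> Y};
  dgh_gpart : forall j x, dgh_fun (gpart (dgl_str X) j x) = gpart (dgl_str Y) j (dgh_fun x);
  dgh_diff : forall x, dgh_fun (diff (dgl_str X) x) = diff (dgl_str Y) (dgh_fun x)
}.

Definition quasi_iso (k : fieldType) (A : dga k) (X Y : dglmod A) (f : dghom X Y) :=
  forall j,
  (forall x : X, @cocycle X j x -> @coboundary Y j (f x) -> @coboundary X j x) /\
  (forall y : Y, @cocycle Y j y ->
     exists2 x : X, @cocycle X j x & @coboundary Y j (y - f x)).

(* X and Y are isomorphic in D(A): they are linked by a zigzag of
   quasi-isomorphisms. *)
Inductive derived_iso (k : fieldType) (A : dga k) : dglmod A -> dglmod A -> Prop :=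
| derived_iso_qis X Y (f : dghom X Y) : quasi_iso f -> derived_iso X Y
| derived_iso_sym X Y : derived_iso X Y -> derived_iso Y X
| derived_iso_trans X Y Z : derived_iso X Y -> derived_iso Y Z -> derived_iso X Z.

Lemma ksignD (W : zmodType) i : {morph @ksign W i : x y / x + y}.
Proof. by move=> x y; rewrite /ksign; case: ifP; rewrite // opprD. Qed.

Lemma ksign_sub (W : zmodType) i : zmod_morphism (@ksign W i).
Proof. by move=> x y; rewrite ksignD; congr (_ + _); rewrite /ksign; case: ifP. Qed.

HB.instance Definition _ (W : zmodType) i :=
  GRing.isZmodMorphism.Build W W (@ksign W i) (@ksign_sub W i).

Lemma ksignK (W : zmodType) i j (x : W) : ksign i (ksign j x) = ksign (i + j) x.
Proof.
rewrite /ksign; have -> : odd (absz (i + j)) = odd (absz i) (+) odd (absz j) by lia.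
by do 2!case: odd; rewrite /= ?opprK.
Qed.

Lemma ksign_odd (W : zmodType) i j (x : W) :
  odd (absz i) = odd (absz j) -> ksign i x = ksign j x.
Proof. by rewrite /ksign => ->. Qed.

Lemma ksignZ (R : pzRingType) (W : lmodType R) i (a : R) (x : W) :
  a *: ksign i x = ksign i (a *: x).
Proof. by rewrite /ksign; case: ifP; rewrite // scalerN. Qed.

Lemma ksignZl (R : pzRingType) (W : lmodType R) i (a : R) (x : W) :
  ksign i a *: x = ksign i (a *: x).
Proof. by rewrite /ksign; case: ifP; rewrite // scaleNr. Qed.

Lemma ksign_mor (U W : zmodType) (f : U -> W) i x :
  {morph f : x y / x + y} -> f (ksign i x) = ksign i (f x).
Proof.
move=> fD; rewrite /ksign; case: ifP => // _; apply/eqP.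
rewrite -addr_eq0 -fD addNr; apply/eqP/(addrI (f 0)).
by rewrite -fD !addr0.
Qed.

Lemma morphD_sub (U W : zmodType) (f : U -> W) :
  {morph f : x y / x + y} -> zmod_morphism f.
Proof.
by move=> fD x y; rewrite fD; congr (_ + _); exact: (ksign_mor 1 y fD).
Qed.

Section Finite.
Variables (V : zmodType) (g : int -> V -> V).
Hypothesis gD : forall j, {morph g j : x y / x + y}.
Hypothesis gg : forall i j x, g i (g j x) = if i == j then g j x else 0.

Definition gfin x := exists2 s : seq int, uniq s & x = \sum_(j <- s) g j x.

Lemma gfin0 : gfin 0.
Proof. by exists [::]; rewrite ?big_nil. Qed.

Lemma gfin_homog j x : g j x = x -> gfin x.
Proof. by move=> xE; exists [:: j]; rewrite ?big_seq1. Qed.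

Lemma gfin_out x s i : x = \sum_(j <- s) g j x -> i \notin s -> g i x = 0.
Proof.
move=> xE i_s; pose ga := GRing.isZmodMorphism.Build V V (g i) (morphD_sub (gD i)).
pose G : {additive V -> V} := HB.pack (g i) ga.
rewrite -[g i x]/(G x) xE raddf_sum big_seq big1 // => j js.
by rewrite /= gg; case: eqP => // ij; rewrite -ij (negbTE i_s) in js.
Qed.

Lemma gfin_sub x s t : uniq s -> uniq t -> x = \sum_(j <- s) g j x ->
  {subset s <= t} -> x = \sum_(j <- t) g j x.
Proof.
move=> us ut xE st; rewrite [LHS]xE [RHS](bigID (mem s) predT) /=.
rewrite [X in _ = _ + X]big1 ?addr0 => [|j js]; last exact: gfin_out xE js.
rewrite -[RHS]big_filter; apply: perm_big; apply: uniq_perm => //.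
  exact: filter_uniq.
by move=> j; rewrite mem_filter /=; case: (boolP (j \in s)) => // /st ->.
Qed.

Lemma gfinD x y : gfin x -> gfin y -> gfin (x + y).
Proof.
move=> [s us xE] [t ut yE]; have uu := undup_uniq (s ++ t).
exists (undup (s ++ t)) => //.
under eq_bigr do rewrite gD.
rewrite big_split /= -(gfin_sub us uu xE) -?(gfin_sub ut uu yE) //.
  by move=> j js; rewrite mem_undup mem_cat js orbT.
by move=> j js; rewrite mem_undup mem_cat js.
Qed.
End Finite.

Section GradedTheory.
Variables (V : zmodType) (S : dgstr V).

HB.instance Definition _ j := GRing.isZmodMorphism.Build V V (gpart S j)
  (morphD_sub (gpart_additive S j)).
HB.instance Definition _ := GRing.isZmodMorphism.Build V V (diff S)
  (morphD_sub (diff_additive S)).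

Definition gsupp (x : V) : seq int := s2val (cid2 (gpart_fin S x)).

Lemma gsupp_uniq x : uniq (gsupp x).
Proof. by rewrite /gsupp; case: cid2. Qed.

Lemma gsuppE x : x = \sum_(j <- gsupp x) gpart S j x.
Proof. by rewrite /gsupp; case: cid2. Qed.

Lemma gsupp_out x i : i \notin gsupp x -> gpart S i x = 0.
Proof. exact (gfin_out (gpart_additive S) (gpart_gpart S) (gsuppE x)). Qed.

Lemma homog_gpart j x : homog S j (gpart S j x).
Proof. by rewrite /homog gpart_gpart eqxx. Qed.

Lemma homog0 j : homog S j 0.
Proof. exact: raddf0. Qed.

Lemma homogD j x y : homog S j x -> homog S j y -> homog S j (x + y).
Proof. by rewrite /homog raddfD /= => -> ->. Qed.

Lemma homogN j x : homog S j x -> homog S j (- x).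
Proof. by rewrite /homog raddfN /= => ->. Qed.

Lemma homog_ksign i j x : homog S j x -> homog S j (ksign i x).
Proof. by rewrite /ksign; case: ifP => // _; apply: homogN. Qed.

Lemma homog_diff j x : homog S j x -> homog S (j + 1) (diff S x).
Proof. by rewrite /homog -diff_gpart => ->. Qed.

Lemma gpart_homog i j x : homog S j x -> gpart S i x = if i == j then x else 0.
Proof. by move=> <-; rewrite gpart_gpart; case: eqP. Qed.

Lemma gpart_ext x y : (forall j, gpart S j x = gpart S j y) -> x = y.
Proof.
move=> xy; apply/eqP; rewrite -subr_eq0 (gsuppE (x - y)) big1 // => j _.
by rewrite raddfB /= xy subrr.
Qed.

Lemma homog_ind (Q : V -> Prop) :
  Q 0 -> (forall x y, Q x -> Q y -> Q (x + y)) ->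
  (forall j x, homog S j x -> Q x) -> forall x, Q x.
Proof.
move=> Q0 QD Qh x; rewrite (gsuppE x); elim/big_rec: _ => // j y _ Qy.
by apply: QD => //; apply/Qh/homog_gpart.
Qed.

Section HSum.
Variables (W : zmodType) (f : int -> V -> W).
Hypothesis fD : forall j, {morph f j : x y / x + y}.

(* the map given by f j on the homogeneous elements of degree j *)
Definition hsum (x : V) : W := \sum_(j <- gsupp x) f j (gpart S j x).

Lemma hsum_f0 j : f j 0 = 0.
Proof. by apply/(addrI (f j 0)); rewrite -fD !addr0. Qed.

Lemma hsum_sub x s : uniq s -> {subset gsupp x <= s} ->
  hsum x = \sum_(j <- s) f j (gpart S j x).
Proof.
move=> us st; rewrite /hsum [RHS](bigID (mem (gsupp x)) predT) /=.
rewrite [X in _ = _ + X]big1 ?addr0 => [|j js].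
  rewrite -[RHS]big_filter; apply: perm_big; apply: uniq_perm.
  - exact: gsupp_uniq.
  - exact: filter_uniq.
  by move=> j; rewrite mem_filter /=; case: (boolP (j \in gsupp x)) => // /st ->.
by rewrite gsupp_out // hsum_f0.
Qed.

Lemma hsumD : {morph hsum : x y / x + y}.
Proof.
move=> x y; pose s := undup (gsupp x ++ gsupp y ++ gsupp (x + y)).
have us : uniq s by apply: undup_uniq.
rewrite !(hsum_sub us) => [|j|j|j]; last first.
- by rewrite mem_undup !mem_cat => ->; rewrite !orbT.
- by rewrite mem_undup !mem_cat => ->.
- by rewrite mem_undup !mem_cat => ->; rewrite !orbT.
by rewrite -big_split; apply: eq_bigr => j _; rewrite /= raddfD fD.
Qed.

Lemma hsum_homog j x : homog S j x -> hsum x = f j x.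
Proof.
move=> xj; rewrite (@hsum_sub _ (undup (j :: gsupp x))) ?undup_uniq //; last first.
  by move=> i i_x; rewrite mem_undup inE i_x orbT.
rewrite (bigD1_seq j) ?undup_uniq ?mem_undup ?mem_head //= xj.
rewrite big1 ?addr0 // => i ij.
by rewrite (gpart_homog _ xj) (negbTE ij) hsum_f0.
Qed.
End HSum.

(* x |-> (-1)^(n j) x on V^j *)
Definition twist (n : int) : V -> V := hsum (fun j => ksign (n * j)).

Lemma twistD n : {morph twist n : x y / x + y}.
Proof. by apply: hsumD => j; apply: ksignD. Qed.

HB.instance Definition _ n := GRing.isZmodMorphism.Build V V (twist n)
  (morphD_sub (twistD n)).

Lemma twist_homog n j x : homog S j x -> twist n x = ksign (n * j) x.
Proof. by move=> xj; rewrite /twist (hsum_homog _ xj) // => i; apply: ksignD. Qed.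

Lemma twist1_diff x : diff S (twist 1 x) = - twist 1 (diff S x).
Proof.
elim/homog_ind: x => [|x y xE yE|j x xj]; first by rewrite !raddf0.
  by rewrite !raddfD /= xE yE.
rewrite (twist_homog _ xj) (twist_homog _ (homog_diff xj)).
rewrite (ksign_mor _ _ (diff_additive S)) /= /ksign.
have -> : odd (absz (1 * (j + 1))) = ~~ odd (absz (1 * j)) by lia.
by case: odd; rewrite /= ?opprK.
Qed.

Lemma twist1K x : twist 1 (twist 1 x) = x.
Proof.
elim/homog_ind: x => [|x y xE yE|j x xj]; first by rewrite !raddf0.
  by rewrite !raddfD /= xE yE.
rewrite (twist_homog _ xj) (twist_homog _ (homog_ksign _ xj)) ksignK.
by rewrite /ksign; have -> : odd (absz (1 * j + 1 * j)) = false by lia.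
Qed.
End GradedTheory.

Lemma homog_ext (U W : zmodType) (S : dgstr U) (f g : {additive U -> W}) :
  (forall j x, homog S j x -> f x = g x) -> f =1 g.
Proof.
move=> fg; elim/(homog_ind (S := S)) => [|x y xE yE|]; last exact: fg.
  by rewrite !raddf0.
by rewrite !raddfD /= xE yE.
Qed.

Section DGATheory.
Variables (k : fieldType) (A : dga k).
Local Notation SA := (dga_str A).

Lemma twist1 n : twist SA n 1 = 1.
Proof. by rewrite (twist_homog _ (dga_homog1 A)) mulr0. Qed.

Lemma twistM n (a b : A) : twist SA n (a * b) = twist SA n a * twist SA n b.
Proof.
elim/(homog_ind (S := SA)): a => [|x y xE yE|i a ai]; first by rewrite !(mul0r, raddf0).
  by rewrite mulrDl !raddfD /= mulrDl xE yE.
elim/(homog_ind (S := SA)): b => [|x y xE yE|j b bj]; first by rewrite !(mulr0, raddf0).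
  by rewrite mulrDr !raddfD /= mulrDr xE yE.
rewrite (twist_homog _ ai) (twist_homog _ bj) (twist_homog _ (dga_homogM ai bj)).
rewrite mulrDr -ksignK /ksign.
by case: odd; case: odd; rewrite ?(mulrN, mulNr).
Qed.

Lemma twist_homogZ (M : lmodType A) n i (a : A) (x : M) :
  homog SA i a -> twist SA n a *: x = ksign (n * i) (a *: x).
Proof. by move=> ai; rewrite (twist_homog _ ai) ksignZl. Qed.

Section Left.
Variable X : dglmod A.

Lemma dgl_leibnizT (a : A) (x : X) :
  diff (dgl_str X) (a *: x) =
  diff SA a *: x + twist SA 1 a *: diff (dgl_str X) x.
Proof.
elim/(homog_ind (S := SA)): a => [|a b aE bE|i a ai].
- by rewrite !raddf0 !scale0r raddf0 addr0.
- by rewrite scalerDl !raddfD /= aE bE !scalerDl addrACA.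
by rewrite (dgl_leibniz _ ai) (twist_homogZ _ _ ai) mul1r.
Qed.
End Left.

Section Right.
Variable X : dgrmod A.

Lemma dgr_leibnizT (a : A) (x : X) :
  diff (dgr_str X) ((a : A^c) *: x) =
  (a : A^c) *: diff (dgr_str X) x + (diff SA a : A^c) *: twist (dgr_str X) 1 x.
Proof.
elim/(homog_ind (S := dgr_str X)): x => [|x y xE yE|i x xi].
- by rewrite !(raddf0, scaler0) addr0.
- by rewrite scalerDr !raddfD /= xE yE addrACA.
by rewrite (dgr_leibniz _ xi) (twist_homog _ xi) mul1r ksignZ.
Qed.

Lemma twist_dgr n (a : A) (x : X) :
  twist (dgr_str X) n ((a : A^c) *: x) =
  (twist SA n a : A^c) *: twist (dgr_str X) n x.
Proof.
elim/(homog_ind (S := dgr_str X)): x => [|x y xE yE|i x xi].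
- by rewrite !(raddf0, scaler0).
- by rewrite scalerDr !raddfD /= xE yE.
elim/(homog_ind (S := SA)): a => [|a b aE bE|j a aj].
- by rewrite raddf0 !scale0r raddf0.
- rewrite (scalerDl x (a : A^c) (b : A^c)) !raddfD /= aE bE.
  by rewrite (scalerDl _ (twist SA n a : A^c)).
rewrite (twist_homog _ xi) (twist_homog _ aj) (twist_homog _ (dgr_homogZ xi aj)).
by rewrite (@ksignZl A^c) ksignZ ksignK mulrDr addrC.
Qed.
End Right.
End DGATheory.

Section Regular.
Variables (k : fieldType) (A : dga k).

Definition regular : dglmod A :=
  @DGLmod k A A^o (dga_str A) (@dga_homogM k A) (@dga_leibniz k A).

End Regular.

Section Shift.
Variables (k : fieldType) (A : dga k) (n : int) (X : dglmod A).
Local Notation SA := (dga_str A).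
Local Notation SX := (dgl_str X).

(* Underlying group of the n-th suspension of X; the action of a in A^i is the
   action on X multiplied by (-1)^(n i). *)
Definition shift_sort of int : Type := X.
HB.instance Definition _ m := GRing.Zmodule.on (shift_sort m).
Local Notation nX := (shift_sort n).

Definition shift_scale (a : A) (x : nX) : nX := twist SA n a *: (x : X).

Lemma shift_scaleA a b x : shift_scale a (shift_scale b x) = shift_scale (a * b) x.
Proof. by rewrite /shift_scale scalerA -twistM. Qed.
Lemma shift_scale1 : left_id 1 shift_scale.
Proof. by move=> x; rewrite /shift_scale twist1 scale1r. Qed.
Lemma shift_scaleDr : right_distributive shift_scale +%R.
Proof. by move=> a x y; rewrite /shift_scale -scalerDr. Qed.
Lemma shift_scaleDl x : {morph shift_scale^~ x : a b / a + b}.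
Proof. by move=> a b; rewrite /shift_scale raddfD /= scalerDl. Qed.

HB.instance Definition _ := GRing.Zmodule_isLmodule.Build A nX
  shift_scaleA shift_scale1 shift_scaleDr shift_scaleDl.

Definition shift_gpart (j : int) (x : nX) : nX := gpart SX (j + n) x.
Definition shift_diff (x : nX) : nX := ksign n (diff SX x).

Lemma shift_gpartD j : {morph shift_gpart j : x y / x + y}.
Proof. exact: gpart_additive. Qed.

Lemma shift_gpart_gpart i j x :
  shift_gpart i (shift_gpart j x) = if i == j then shift_gpart j x else 0.
Proof. by rewrite /shift_gpart gpart_gpart (inj_eq (addIr n)). Qed.

Lemma shift_gpart_fin x :
  exists2 s : seq int, uniq s & x = \sum_(j <- s) shift_gpart j x.
Proof.
exists [seq j - n | j <- gsupp SX x].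
  by rewrite map_inj_uniq ?gsupp_uniq //; apply: addIr.
rewrite big_map [LHS](gsuppE SX); apply: eq_bigr => j _.
by rewrite /shift_gpart subrK.
Qed.

Lemma shift_diffD : {morph shift_diff : x y / x + y}.
Proof. by move=> x y; rewrite /shift_diff diff_additive ksignD. Qed.

Lemma shift_diff_gpart j x :
  shift_diff (shift_gpart j x) = shift_gpart (j + 1) (shift_diff x).
Proof.
rewrite /shift_diff /shift_gpart diff_gpart (ksign_mor _ _ (gpart_additive _ _)).
by rewrite addrAC.
Qed.

Lemma shift_diff_diff x : shift_diff (shift_diff x) = 0.
Proof.
by rewrite /shift_diff (ksign_mor _ _ (diff_additive _)) diff_diff !raddf0.
Qed.

Definition shift_str : dgstr nX :=
  DGStr shift_gpartD shift_gpart_gpart shift_gpart_fin shift_diffD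
    shift_diff_gpart shift_diff_diff.

Lemma shift_scaleE i (a : A) (x : nX) :
  homog SA i a -> a *: x = ksign (n * i) (a *: (x : X)).
Proof. exact: (@twist_homogZ k A X n i a x). Qed.

Lemma shift_homogZ i j (a : A) (x : nX) :
  homog SA i a -> homog shift_str j x -> homog shift_str (i + j) (a *: x).
Proof.
move=> ai xj; rewrite (shift_scaleE _ ai) /homog /= /shift_gpart -addrA.
by apply: homog_ksign; apply: dgl_homogZ.
Qed.

Lemma shift_leibniz i (a : A) (x : nX) : homog SA i a ->
  shift_diff (a *: x) = diff SA a *: x + ksign i (a *: shift_diff x).
Proof.
move=> ai; rewrite (shift_scaleE _ ai) (shift_scaleE _ (homog_diff ai)).
rewrite (shift_scaleE _ ai) /shift_diff (ksign_mor _ _ (diff_additive _)).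
rewrite (dgl_leibniz _ ai) !ksignD ksignZ !ksignK mulrDr mulr1.
congr (_ + _); first by rewrite addrC.
by congr (ksign _ _); lia.
Qed.

(* (Sigma^n X)^j = X^(j + n), with differential (-1)^n d *)
Definition shift : dglmod A := DGLmod shift_homogZ shift_leibniz.

End Shift.
Arguments shift : simpl never.

Lemma pairD (U W : zmodType) (x x' : U) (y y' : W) :
  (x, y) + (x', y') = (x + x', y + y').
Proof. by []. Qed.

Section Cone.
Variables (k : fieldType) (A : dga k) (X Y : dglmod A) (f : dghom X Y).
Local Notation SA := (dga_str A).
Local Notation SX := (dgl_str (shift 1 X)).
Local Notation SY := (dgl_str Y).
Local Notation C := (Y * shift 1 X)%type.

Definition cone_gpart (j : int) (u : C) : C := (gpart SY j u.1, gpart SX j u.2).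
Definition cone_diff (u : C) : C := (diff SY u.1 + f u.2, diff SX u.2).

Lemma cone_gpartD j : {morph cone_gpart j : x y / x + y}.
Proof.
by move=> x y; rewrite /cone_gpart !gpart_additive.
Qed.

Lemma cone_gpart_gpart i j x :
  cone_gpart i (cone_gpart j x) = if i == j then cone_gpart j x else 0.
Proof.
have -> : cone_gpart i (cone_gpart j x) =
    (if i == j then gpart SY j x.1 else 0, if i == j then gpart SX j x.2 else 0).
  by congr (_, _); apply: gpart_gpart.
by case: eqP.
Qed.

Lemma cone_gpart_fin x :
  exists2 s : seq int, uniq s & x = \sum_(j <- s) cone_gpart j x.
Proof.
have cD := cone_gpartD; have cg := cone_gpart_gpart.
have -> : x = (x.1, 0) + (0, x.2).
  by case: x => x y; rewrite pairD addr0 add0r.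
apply: gfinD => //.
  elim/(homog_ind (S := SY)): x.1 => [|y z|j y yj]; first exact: gfin0.
    have -> : (y + z, 0) = (y, 0) + (z, 0) :> C by rewrite pairD addr0.
    exact: gfinD.
  by apply: (@gfin_homog _ _ j); congr (_, _); [exact: yj | exact: homog0].
elim/(homog_ind (S := SX)): x.2 => [|y z|j y yj]; first exact: gfin0.
  have -> : (0, y + z) = (0, y) + (0, z) :> C by rewrite pairD addr0.
  exact: gfinD.
by apply: (@gfin_homog _ _ j); congr (_, _); [exact: homog0 | exact: yj].
Qed.

Lemma cone_diffD : {morph cone_diff : x y / x + y}.
Proof.
move=> x y; congr (_, _); last exact: diff_additive.
by rewrite /= diff_additive raddfD /= addrACA.
Qed.

Lemma cone_diff_gpart j x :
  cone_diff (cone_gpart j x) = cone_gpart (j + 1) (cone_diff x).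
Proof.
congr (_, _); last exact: diff_gpart.
by rewrite /= gpart_additive diff_gpart -dgh_gpart.
Qed.

Lemma cone_diff_diff x : cone_diff (cone_diff x) = 0.
Proof.
congr (_, _); last exact: diff_diff.
by rewrite /= diff_additive diff_diff add0r -dgh_diff -raddfD /= subrr raddf0.
Qed.

Definition cone_str : dgstr C :=
  DGStr cone_gpartD cone_gpart_gpart cone_gpart_fin cone_diffD
    cone_diff_gpart cone_diff_diff.

Lemma cone_homogZ i j (a : A) (x : C) :
  homog SA i a -> homog cone_str j x -> homog cone_str (i + j) (a *: x).
Proof.
case: x => x y ai [xj yj]; congr (_, _).
  exact: (dgl_homogZ ai).
exact: (@dgl_homogZ _ _ (shift 1 X) _ _ _ _ ai).
Qed.

Lemma cone_leibniz i (a : A) (x : C) : homog SA i a ->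
  cone_diff (a *: x) = diff SA a *: x + ksign i (a *: cone_diff x).
Proof.
move=> ai; have -> : ksign i (a *: cone_diff x) =
    (ksign i (a *: (cone_diff x).1), ksign i (a *: (cone_diff x).2)).
  by rewrite /ksign; case: ifP.
congr (_, _); last exact: (@dgl_leibniz _ _ (shift 1 X) _ _ _ ai).
have aE : f (a *: x).2 = ksign i (a *: f x.2).
  rewrite -[i]mul1r -linearZ -(ksign_mor _ _ (raddfD f)).
  by congr (f _); exact: (@shift_scaleE k A 1 X i a x.2 ai).
rewrite /cone_diff aE -[(a *: x).1]/(a *: x.1) (dgl_leibniz _ ai) /=.
by rewrite scalerDr ksignD addrA.
Qed.

Definition cone : dglmod A := DGLmod cone_homogZ cone_leibniz.

End Cone.

Section DirectSum.
Variables (k : fieldType) (A : dga k) (X Y : dglmod A).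
Local Notation SA := (dga_str A).
Local Notation SX := (dgl_str X).
Local Notation SY := (dgl_str Y).
Local Notation C := (X * Y)%type.

Definition dsum_gpart (j : int) (u : C) : C := (gpart SX j u.1, gpart SY j u.2).
Definition dsum_diff (u : C) : C := (diff SX u.1, diff SY u.2).

Lemma dsum_gpartD j : {morph dsum_gpart j : x y / x + y}.
Proof. by move=> x y; rewrite /dsum_gpart !gpart_additive. Qed.

Lemma dsum_gpart_gpart i j x :
  dsum_gpart i (dsum_gpart j x) = if i == j then dsum_gpart j x else 0.
Proof. by rewrite /dsum_gpart /= !gpart_gpart; case: eqP. Qed.

Lemma dsum_gpart_fin x :
  exists2 s : seq int, uniq s & x = \sum_(j <- s) dsum_gpart j x.
Proof.
have cD := dsum_gpartD; have cg := dsum_gpart_gpart.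
have -> : x = (x.1, 0) + (0, x.2).
  by case: x => x y; rewrite pairD addr0 add0r.
apply: gfinD => //.
  elim/(homog_ind (S := SX)): x.1 => [|y z|j y yj]; first exact: gfin0.
    have -> : (y + z, 0) = (y, 0) + (z, 0) :> C by rewrite pairD addr0.
    exact: gfinD.
  by apply: (@gfin_homog _ _ j); congr (_, _); [exact: yj | exact: homog0].
elim/(homog_ind (S := SY)): x.2 => [|y z|j y yj]; first exact: gfin0.
  have -> : (0, y + z) = (0, y) + (0, z) :> C by rewrite pairD addr0.
  exact: gfinD.
by apply: (@gfin_homog _ _ j); congr (_, _); [exact: homog0 | exact: yj].
Qed.

Lemma dsum_diffD : {morph dsum_diff : x y / x + y}.
Proof. by move=> x y; rewrite /dsum_diff !diff_additive. Qed.

Lemma dsum_diff_gpart j x :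
  dsum_diff (dsum_gpart j x) = dsum_gpart (j + 1) (dsum_diff x).
Proof. by rewrite /dsum_diff /dsum_gpart /= !diff_gpart. Qed.

Lemma dsum_diff_diff x : dsum_diff (dsum_diff x) = 0.
Proof. by rewrite /dsum_diff /= !diff_diff. Qed.

Definition dsum_str : dgstr C :=
  DGStr dsum_gpartD dsum_gpart_gpart dsum_gpart_fin dsum_diffD
    dsum_diff_gpart dsum_diff_diff.

Lemma dsum_homogZ i j (a : A) (x : C) :
  homog SA i a -> homog dsum_str j x -> homog dsum_str (i + j) (a *: x).
Proof. by case: x => x y ai [xj yj]; congr (_, _); apply: (dgl_homogZ ai). Qed.

Lemma dsum_leibniz i (a : A) (x : C) : homog SA i a ->
  dsum_diff (a *: x) = diff SA a *: x + ksign i (a *: dsum_diff x).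
Proof.
move=> ai; rewrite /dsum_diff /= !(dgl_leibniz _ ai) /ksign.
by case: ifP.
Qed.

Definition dsum : dglmod A := DGLmod dsum_homogZ dsum_leibniz.

End DirectSum.

(* The compact objects of D(A), i.e. those finitely built from A. Up to
   isomorphism in D(A), each distinguished triangle is
   X -> Y -> cone f -> Sigma X for a morphism f of DG modules, and a direct
   summand of Z is an X with Z isomorphic to X (+) Y. *)
Inductive compact_dg (k : fieldType) (A : dga k) : dglmod A -> Prop :=
| compact_dg_regular : compact_dg (regular A)
| compact_dg_iso X Y : derived_iso X Y -> compact_dg X -> compact_dg Y
| compact_dg_shift n X : compact_dg X -> compact_dg (shift n X)
| compact_dg_cone X Y (f : dghom X Y) : compact_dg X -> compact_dg Y -> compact_dg (cone f)
| compact_dg_dsum X Y : compact_dg X -> compact_dg Y -> compact_dg (dsum X Y)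
| compact_dg_summand X Y : compact_dg (dsum X Y) -> compact_dg X.

(* F has a basis of homogeneous elements e i, with a rank function such that
   d(e i) is a combination of basis elements of smaller rank. *)
Definition semifree (k : fieldType) (A : dga k) (F : dglmod A) :=
  exists (I : choiceType) (e : I -> F) (deg : I -> int) (rk : I -> nat),
  [/\ forall i, homog (dgl_str F) (deg i) (e i),
      forall x : F, exists s : seq (A * I), x = \sum_(u <- s) u.1 *: e u.2,
      forall (s : seq I) (a : I -> A), uniq s ->
        \sum_(i <- s) a i *: e i = 0 -> forall i, i \in s -> a i = 0 &
      forall i, exists2 s : seq (A * I), (forall u, u \in s -> (rk u.2 < rk i)%N) &
        diff (dgl_str F) (e i) = \sum_(u <- s) u.1 *: e u.2].

Section FSum.
Variables (R : nzRingType) (K : choiceType).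

Lemma fg_ext (x y : {freeg K / R}) : (forall i, coeff i x = coeff i y) -> x = y.
Proof. by move=> xy; apply/eqP/freeg_eqP. Qed.

Lemma coeff_delta (c : R) (i j : K) : coeff i << c *g j >> = if j == i then c else 0.
Proof. by rewrite coeffU; case: eqP; rewrite ?mulr1 ?mulr0. Qed.

Lemma fgU_D (i : K) : {morph (fun c : R => << c *g i >>) : a b / a + b}.
Proof. by move=> a b; rewrite freegUD. Qed.

Lemma fgU_Z (c a : R) (i : K) : c *: << a *g i >> = << c * a *g i >>.
Proof.
by apply: fg_ext => j; rewrite coeffZ !coeff_delta; case: eqP; rewrite ?mulr0.
Qed.

Section Def.
Variables (W : zmodType) (f : K -> R -> W).
Hypothesis fD : forall i, {morph f i : x y / x + y}.

Definition fsum (x : {freeg K / R}) : W := \sum_(i <- dom x) f i (coeff i x).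

Lemma fsum_f0 i : f i 0 = 0.
Proof. by apply/(addrI (f i 0)); rewrite -fD !addr0. Qed.

Lemma fsum_sub x s : uniq s -> {subset dom x <= s} ->
  fsum x = \sum_(i <- s) f i (coeff i x).
Proof.
move=> us st; rewrite /fsum [RHS](bigID (mem (dom x)) predT) /=.
rewrite [X in _ = _ + X]big1 ?addr0 => [|j js].
  rewrite -[RHS]big_filter; apply: perm_big; apply: uniq_perm.
  - exact: uniq_dom.
  - exact: filter_uniq.
  by move=> j; rewrite mem_filter /=; case: (boolP (j \in dom x)) => // /st ->.
by rewrite coeff_outdom // fsum_f0.
Qed.

Lemma fsumD : {morph fsum : x y / x + y}.
Proof.
move=> x y; pose s := undup (dom x ++ dom y ++ dom (x + y)).
have us : uniq s by apply: undup_uniq.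
rewrite !(fsum_sub us) => [|j|j|j]; last first.
- by rewrite mem_undup !mem_cat => ->; rewrite !orbT.
- by rewrite mem_undup !mem_cat => ->.
- by rewrite mem_undup !mem_cat => ->; rewrite !orbT.
by rewrite -big_split; apply: eq_bigr => j _; rewrite /= raddfD fD.
Qed.

Lemma fsumU c i : fsum << c *g i >> = f i c.
Proof.
have [->|c0] := eqVneq c 0.
  by rewrite freegU0 /fsum dom0 big_nil fsum_f0.
by rewrite /fsum domU // big_seq1 coeff_delta eqxx.
Qed.
End Def.

Lemma fg_ind (Q : {freeg K / R} -> Prop) :
  Q 0 -> (forall x y, Q x -> Q y -> Q (x + y)) -> (forall a i, Q << a *g i >>) ->
  forall x, Q x.
Proof.
move=> Q0 QD QU x; rewrite -(freeg_sumE x); elim/big_rec: _ => // i y _ Qy.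
exact: QD.
Qed.
End FSum.

Lemma dga_diff1 (k : fieldType) (A : dga k) : diff (dga_str A) 1 = 0.
Proof.
have d1 := dga_leibniz 1 (dga_homog1 A); rewrite !mulr1 mul1r in d1.
by apply: (addrI (diff (dga_str A) 1)); rewrite addr0 -[LHS]d1.
Qed.

Section Resolution.
Variables (k : fieldType) (A : dga k) (M : dglmod A).
Local Notation SA := (dga_str A).
Local Notation SM := (dgl_str M).

(* Basis of the resolution: [Gen j z m] has degree j and, when this is
   consistent, boundary z and image m in M. *)
Inductive gen : Type := Gen of int & seq (A * gen) & M.

HB.instance Definition _ := gen_eqMixin gen.
HB.instance Definition _ := gen_choiceMixin gen.

Local Notation L := {freeg gen / A}.

Definition gdeg (g : gen) : int := let: Gen j _ _ := g in j.

Fixpoint grank (g : gen) : nat :=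
  let: Gen _ z _ := g in
  (foldr maxn 0%N (map (fun u => let: (_, h) := u in grank h) z)).+1.

Definition gcomb (z : seq (A * gen)) : L := \sum_(u <- z) << u.1 *g u.2 >>.

(* v = (a, h, (boundary of h, image of h)) *)
Definition gen_ok (j : int) (zs : seq (A * gen * (L * M))) (m : M) : Prop :=
  [/\ forall v, v \in zs -> homog SA (j + 1 - gdeg v.1.2) v.1.1,
      \sum_(v <- zs) (<< diff SA v.1.1 *g v.1.2 >> + twist SA 1 v.1.1 *: v.2.1) = 0,
      homog SM j m &
      \sum_(v <- zs) v.1.1 *: v.2.2 = diff SM m].

Fixpoint gbd (g : gen) : L * M :=
  let: Gen j z m := g in
  let zs := map (fun u => let: (a, h) := u in (a, h, gbd h)) z in
  if `[< gen_ok j zs m >] then (gcomb z, m) else (0, 0).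

Definition res_gpart (n : int) : L -> L :=
  fsum (fun g a => << gpart SA (n - gdeg g) a *g g >>).

Definition res_diff : L -> L :=
  fsum (fun g a => << diff SA a *g g >> + twist SA 1 a *: (gbd g).1).

Definition res_eps : L -> M := fsum (fun g a => a *: (gbd g).2).

Lemma res_gpart_fD n g : {morph (fun a => << gpart SA (n - gdeg g) a *g g >>)
  : a b / a + b}.
Proof. by move=> a b; rewrite gpart_additive fgU_D. Qed.

Lemma res_diff_fD g :
  {morph (fun a => << diff SA a *g g >> + twist SA 1 a *: (gbd g).1) : a b / a + b}.
Proof. by move=> a b; rewrite diff_additive fgU_D twistD scalerDl addrACA. Qed.

Lemma res_eps_fD g : {morph (fun a => a *: (gbd g).2) : a b / a + b}.
Proof. by move=> a b; rewrite scalerDl. Qed.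

Lemma res_gpartD n : {morph res_gpart n : x y / x + y}.
Proof. exact: fsumD (res_gpart_fD n). Qed.
Lemma res_diffD : {morph res_diff : x y / x + y}.
Proof. exact: fsumD res_diff_fD. Qed.
Lemma res_epsD : {morph res_eps : x y / x + y}.
Proof. exact: fsumD res_eps_fD. Qed.

HB.instance Definition _ n := GRing.isZmodMorphism.Build L L (res_gpart n)
  (morphD_sub (res_gpartD n)).
HB.instance Definition _ := GRing.isZmodMorphism.Build L L res_diff
  (morphD_sub res_diffD).
HB.instance Definition _ := GRing.isZmodMorphism.Build L M res_eps
  (morphD_sub res_epsD).

Lemma res_gpartU n a g :
  res_gpart n << a *g g >> = << gpart SA (n - gdeg g) a *g g >>.
Proof. exact: (fsumU (res_gpart_fD n)). Qed.
Lemma res_diffU a g :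
  res_diff << a *g g >> = << diff SA a *g g >> + twist SA 1 a *: (gbd g).1.
Proof. exact: (fsumU res_diff_fD). Qed.
Lemma res_epsU a g : res_eps << a *g g >> = a *: (gbd g).2.
Proof. exact: (fsumU res_eps_fD). Qed.

Lemma coeff_res_gpart n g x :
  coeff g (res_gpart n x) = gpart SA (n - gdeg g) (coeff g x).
Proof.
elim/fg_ind: x => [|x y xE yE|b h]; first by rewrite !raddf0.
  by rewrite !raddfD /= xE yE.
by rewrite res_gpartU !coeff_delta; case: eqP => [->|_]; rewrite ?raddf0.
Qed.

Lemma res_epsZ a x : res_eps (a *: x) = a *: res_eps x.
Proof.
elim/fg_ind: x => [|x y xE yE|b g]; first by rewrite !(scaler0, raddf0).
  by rewrite scalerDr !raddfD /= xE yE.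
by rewrite fgU_Z !res_epsU scalerA.
Qed.

Lemma res_diffZ a x :
  res_diff (a *: x) = diff SA a *: x + twist SA 1 a *: res_diff x.
Proof.
elim/fg_ind: x => [|x y xE yE|b g]; first by rewrite !(scaler0, raddf0) addr0.
  by rewrite scalerDr !raddfD /= xE yE addrACA.
have bE := dgl_leibnizT (X := regular A) a b.
rewrite fgU_Z !res_diffU [diff SA (a * b)]bE twistM scalerDr !fgU_Z fgU_D.
by rewrite scalerA addrA.
Qed.

Variant gbd_spec (j : int) (z : seq (A * gen)) (m : M) : L * M -> Prop :=
| GbdBad : gbd_spec j z m (0, 0)
| GbdOk : (forall u, u \in z -> homog SA (j + 1 - gdeg u.2) u.1) ->
    res_diff (gcomb z) = 0 -> homog SM j m -> res_eps (gcomb z) = diff SM m ->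
    gbd_spec j z m (gcomb z, m).

Lemma gen_okP j z m :
  gen_ok j (map (fun u => let: (a, h) := u in (a, h, gbd h)) z) m <->
  [/\ forall u, u \in z -> homog SA (j + 1 - gdeg u.2) u.1,
      res_diff (gcomb z) = 0, homog SM j m & res_eps (gcomb z) = diff SM m].
Proof.
rewrite /gen_ok !big_map /gcomb !raddf_sum.
have -> : \sum_(u <- z) res_diff << u.1 *g u.2 >> = \sum_(u <- z)
   (<< diff SA (let: (a, h) := u in (a, h, gbd h)).1.1
      *g (let: (a, h) := u in (a, h, gbd h)).1.2 >> +
    twist SA 1 (let: (a, h) := u in (a, h, gbd h)).1.1
      *: (let: (a, h) := u in (a, h, gbd h)).2.1).
  by apply: eq_bigr => -[a h] _; rewrite res_diffU.
have -> : \sum_(u <- z) res_eps << u.1 *g u.2 >> =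
   \sum_(u <- z) (let: (a, h) := u in (a, h, gbd h)).1.1
      *: (let: (a, h) := u in (a, h, gbd h)).2.2.
  by apply: eq_bigr => -[a h] _; rewrite res_epsU.
split=> -[zh z0 mj zm]; split=> //.
  move=> [a h] ahz; apply: (zh (a, h, gbd h)).
  by apply/mapP; exists (a, h).
by move=> v /mapP[[a h] ahz ->]; apply: (zh (a, h)).
Qed.

Lemma gbdP j z m : gbd_spec j z m (gbd (Gen j z m)).
Proof.
rewrite /=; case: asboolP => [/gen_okP[zh z0 mj zm]|_]; last exact: GbdBad.
exact: GbdOk.
Qed.

Lemma gbd_ok j z m : (forall u, u \in z -> homog SA (j + 1 - gdeg u.2) u.1) ->
    res_diff (gcomb z) = 0 -> homog SM j m -> res_eps (gcomb z) = diff SM m ->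
  gbd (Gen j z m) = (gcomb z, m).
Proof. by move=> zh z0 mj zm /=; rewrite asboolT //; apply/gen_okP. Qed.

Lemma res_gpart_sub i (z : seq (A * gen)) :
  (forall u, u \in z -> homog SA (i - gdeg u.2) u.1) ->
  res_gpart i (gcomb z) = gcomb z.
Proof.
move=> zh; rewrite /gcomb raddf_sum; apply: eq_big_seq => u uz.
by rewrite /= res_gpartU (zh u uz).
Qed.

Lemma gbd_homog g : res_gpart (gdeg g + 1) (gbd g).1 = (gbd g).1.
Proof.
case: g => j z m; case: gbdP => [|zh _ _ _]; first exact: raddf0.
exact: res_gpart_sub.
Qed.

Lemma gbd_img_homog g : homog SM (gdeg g) (gbd g).2.
Proof. by case: g => j z m; case: gbdP => [|_ _ mj _] //; apply: homog0. Qed.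

Lemma gbd_diff g : res_diff (gbd g).1 = 0.
Proof. by case: g => j z m; case: gbdP => // ; rewrite raddf0. Qed.

Lemma gbd_eps g : res_eps (gbd g).1 = diff SM (gbd g).2.
Proof. by case: g => j z m; case: gbdP => // ; rewrite !raddf0. Qed.

Lemma res_gpart_gpart i j x :
  res_gpart i (res_gpart j x) = if i == j then res_gpart j x else 0.
Proof.
elim/fg_ind: x => [|x y xE yE|b g]; first by rewrite !raddf0 if_same.
  by rewrite !raddfD /= xE yE; case: eqP; rewrite ?addr0.
rewrite !res_gpartU gpart_gpart (inj_eq (addIr _)).
by case: eqP => // _; rewrite freegU0.
Qed.

Lemma res_gpart_fin x :
  exists2 s : seq int, uniq s & x = \sum_(j <- s) res_gpart j x.
Proof.
have gD := res_gpartD; have gg := res_gpart_gpart.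
elim/fg_ind: x => [|x y xE yE|b g]; [exact: gfin0 | exact: gfinD |].
elim/(homog_ind (S := SA)): b => [|x y xE yE|j a aj].
- by rewrite freegU0; exact: gfin0.
- by rewrite fgU_D; exact: gfinD.
by apply: (@gfin_homog _ _ (j + gdeg g)); rewrite res_gpartU addrK aj.
Qed.

Lemma res_homogZ' i j (a : A) x : homog SA i a -> res_gpart j x = x ->
  res_gpart (i + j) (a *: x) = a *: x.
Proof.
move=> ai <-; elim/fg_ind: x => [|x y xE yE|b g].
- by rewrite !(raddf0, scaler0).
- by rewrite raddfD scalerDr raddfD /= xE yE.
rewrite res_gpartU fgU_Z res_gpartU; congr (<< _ *g _ >>).
rewrite -addrA; exact: (dga_homogM ai (homog_gpart _ _ _)).
Qed.

Lemma res_diff_gpart j x :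
  res_diff (res_gpart j x) = res_gpart (j + 1) (res_diff x).
Proof.
elim/fg_ind: x => [|x y xE yE|b g]; first by rewrite !raddf0.
  by rewrite !raddfD /= xE yE.
elim/(homog_ind (S := SA)): b => [|x y xE yE|i a ai].
- by rewrite freegU0 !raddf0.
- by rewrite fgU_D !raddfD /= xE yE.
have ta : homog SA i (twist SA 1 a).
  by rewrite (twist_homog _ ai); apply: homog_ksign.
have gE := res_homogZ' ta (gbd_homog g).
rewrite res_diffU res_gpartU raddfD /= res_gpartU -gE res_gpart_gpart gE.
rewrite (gpart_homog _ ai) (gpart_homog _ (homog_diff ai)).
have -> : (j - gdeg g == i) = (j == i + gdeg g) by lia.
have -> : (j + 1 - gdeg g == i + 1) = (j == i + gdeg g) by lia.
have -> : (j + 1 == i + (gdeg g + 1)) = (j == i + gdeg g) by lia.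
by case: eqP => _; [rewrite res_diffU | rewrite !freegU0 raddf0 addr0].
Qed.

Lemma res_diff_diff x : res_diff (res_diff x) = 0.
Proof.
elim/fg_ind: x => [|x y xE yE|b g]; first by rewrite !raddf0.
  by rewrite !raddfD /= xE yE addr0.
rewrite res_diffU raddfD /= res_diffU diff_diff freegU0 add0r res_diffZ.
by rewrite gbd_diff scaler0 addr0 twist1_diff scaleNr subrr.
Qed.

Definition res_str : dgstr L :=
  DGStr res_gpartD res_gpart_gpart res_gpart_fin res_diffD
    res_diff_gpart res_diff_diff.

Lemma res_homogZ i j (a : A) (x : L) :
  homog SA i a -> homog res_str j x -> homog res_str (i + j) (a *: x).
Proof. exact: res_homogZ'. Qed.

Lemma res_leibniz i (a : A) (x : L) : homog SA i a ->
  res_diff (a *: x) = diff SA a *: x + ksign i (a *: res_diff x).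
Proof. by move=> ai; rewrite res_diffZ (twist_homogZ _ _ ai) mul1r. Qed.

Definition res_mod : dglmod A := DGLmod res_homogZ res_leibniz.

HB.instance Definition _ := GRing.isScalable.Build A L M *:%R res_eps res_epsZ.

Lemma res_eps_gpart j x : res_eps (res_gpart j x) = gpart SM j (res_eps x).
Proof.
elim/fg_ind: x => [|x y xE yE|b g]; first by rewrite !raddf0.
  by rewrite !raddfD /= xE yE.
elim/(homog_ind (S := SA)): b => [|x y xE yE|i a ai].
- by rewrite freegU0 !raddf0.
- by rewrite fgU_D !raddfD /= xE yE.
rewrite res_gpartU !res_epsU (gpart_homog _ ai).
rewrite (gpart_homog _ (dgl_homogZ ai (gbd_img_homog g))).
have -> : (j - gdeg g == i) = (j == i + gdeg g) by lia.
by case: eqP => // _; rewrite scale0r.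
Qed.

Lemma res_eps_diff x : res_eps (res_diff x) = diff SM (res_eps x).
Proof.
elim/fg_ind: x => [|x y xE yE|b g]; first by rewrite !raddf0.
  by rewrite !raddfD /= xE yE.
by rewrite res_diffU raddfD /= !res_epsU res_epsZ gbd_eps dgl_leibnizT.
Qed.

Definition res_hom : dghom res_mod M :=
  @DGHom k A res_mod M res_eps res_eps_gpart res_eps_diff.

Lemma res_semifree : semifree res_mod.
Proof.
exists gen, (fun g => << 1 *g g >> : L), gdeg, grank; split.
- by move=> g; rewrite /homog /= res_gpartU subrr (dga_homog1 A).
- move=> x; exists [seq (coeff g x, g) | g <- dom x].
  rewrite big_map -[LHS]freeg_sumE; apply: eq_bigr => g _ /=.
  by rewrite fgU_Z mulr1.
- move=> s a us /(congr1 (coeff _)) s0 g gs; have := s0 g.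
  rewrite raddf_sum coeff0 (bigD1_seq g) //= coeffZ coeff_delta eqxx mulr1.
  rewrite big1 ?addr0 // => h /negbTE hg.
  by rewrite coeffZ coeff_delta hg mulr0.
case=> j z m; rewrite /= res_diffU.
rewrite dga_diff1 freegU0 add0r twist1 scale1r.
case: gbdP => [|_ _ _ _]; first by exists [::]; rewrite ?big_nil.
exists z; last by apply: eq_bigr => u _; rewrite fgU_Z mulr1.
move=> u; rewrite ltnS; elim: z => //= -[a h] z IHz.
rewrite inE => /orP[/eqP -> /=|/IHz]; first exact: leq_maxl.
by move=> /leq_trans -> //; apply: leq_maxr.
Qed.

Lemma res_qis : quasi_iso res_hom.
Proof.
move=> j; split.
  move=> x [xj x0] [m mj mE]; pose z := [seq (coeff g x, g) | g <- dom x].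
  have zE : gcomb z = x by rewrite /gcomb big_map freeg_sumE.
  have gE : gbd (Gen (j - 1) z m) = (x, m).
    rewrite -[in RHS]zE; apply: gbd_ok; [|by rewrite zE|exact: mj|by rewrite zE].
    move=> u /mapP[g gx ->] /=; rewrite subrK /homog.
    by rewrite -coeff_res_gpart (xj : res_gpart j x = x).
  exists (<< 1 *g Gen (j - 1) z m >> : L).
    by rewrite /homog /= res_gpartU subrr (dga_homog1 A).
  rewrite [LHS]res_diffU gE /= twist1 scale1r.
  by rewrite dga_diff1 freegU0 add0r.
move=> m [mj m0].
have gE : gbd (Gen j [::] m) = (0, m).
  have c0 : gcomb [::] = 0 by rewrite /gcomb big_nil.
  by rewrite -c0; apply: gbd_ok; rewrite // c0 raddf0.
exists (<< 1 *g Gen j [::] m >> : L).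
  split; first by rewrite /homog /= res_gpartU subrr (dga_homog1 A).
  rewrite [LHS]res_diffU gE /= scaler0 addr0.
  by rewrite dga_diff1 freegU0.
exists 0; first exact: homog0.
by rewrite raddf0 /= res_epsU gE scale1r subrr.
Qed.

End Resolution.

Lemma semifree_resolution (k : fieldType) (A : dga k) (M : dglmod A) :
  exists F : dglmod A, semifree F /\ exists f : dghom F M, quasi_iso f.
Proof.
exists (res_mod M); split; first exact: res_semifree.
by exists (res_hom M); apply: res_qis.
Qed.

Definition resolution (k : fieldType) (A : dga k) (M : dglmod A) : dglmod A :=
  sval (cid (semifree_resolution M)).

Section Tensor.
Variables (k : fieldType) (A : dga k) (P : dgrmod A) (F : dglmod A).
Local Notation SA := (dga_str A).
Local Notation SP := (dgr_str P).
Local Notation SF := (dgl_str F).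
Local Notation Z := {freeg (P * F)%type / int}.

Variant tensor_relator : Z -> Prop :=
| TensorDl p q f : tensor_relator (<< (p + q, f) >> - << (p, f) >> - << (q, f) >>)
| TensorDr p f g : tensor_relator (<< (p, f + g) >> - << (p, f) >> - << (p, g) >>)
| TensorZ (a : A) p f :
    tensor_relator (<< ((a : A^c) *: p, f) >> - << (p, a *: f) >>).

(* the subgroup generated by the relators *)
Definition tensor_ker : {pred Z} := fun z =>
  `[< forall S : zmodClosed Z, (forall r, tensor_relator r -> r \in S) -> z \in S >].

Lemma tensor_ker_zmod_closed : zmod_closed tensor_ker.
Proof.
split; first by apply/asboolP => S _; apply: rpred0.
move=> x y /asboolP xS /asboolP yS; apply/asboolP => S rS.
by apply: rpredB; [apply: xS | apply: yS].
Qed.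

HB.instance Definition _ := GRing.isZmodClosed.Build Z tensor_ker
  tensor_ker_zmod_closed.

Definition tensor_sort : zmodType := {ideal_quot tensor_ker}.

Definition tensor_pi (z : Z) : tensor_sort := \pi_({ideal_quot tensor_ker})%qT z.

Definition tens (p : P) (f : F) : tensor_sort := tensor_pi << (p, f) >>.

Lemma tensor_pi_sub : zmod_morphism tensor_pi.
Proof. by move=> x y; rewrite /tensor_pi raddfB. Qed.

HB.instance Definition _ := GRing.isZmodMorphism.Build Z tensor_sort tensor_pi
  tensor_pi_sub.

Lemma tensor_pi0 z : z \in tensor_ker -> tensor_pi z = 0.
Proof.
move=> zI; rewrite /tensor_pi -[RHS](raddf0 (\pi_({ideal_quot tensor_ker})%qT)).
by apply/eqP; rewrite -Quotient.idealrBE subr0.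
Qed.

Lemma tensor_pi_repr (t : tensor_sort) : tensor_pi (repr t) = t.
Proof. exact: reprK. Qed.

Lemma tensor_pi_eq0 z : tensor_pi z = 0 -> z \in tensor_ker.
Proof.
rewrite /tensor_pi -[RHS](raddf0 (\pi_({ideal_quot tensor_ker})%qT)).
by move/eqP; rewrite -Quotient.idealrBE subr0.
Qed.

Lemma tensor_relatorP r : tensor_relator r -> tensor_pi r = 0.
Proof. by move=> rR; apply/tensor_pi0/asboolP => S; apply. Qed.

Lemma tensDl p q f : tens (p + q) f = tens p f + tens q f.
Proof.
have := tensor_relatorP (TensorDl p q f); rewrite !raddfB /= -addrA -opprD.
by move/eqP; rewrite subr_eq0 => /eqP.
Qed.

Lemma tensDr p f g : tens p (f + g) = tens p f + tens p g.
Proof.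
have := tensor_relatorP (TensorDr p f g); rewrite !raddfB /= -addrA -opprD.
by move/eqP; rewrite subr_eq0 => /eqP.
Qed.

Lemma tensZ (a : A) p f : tens ((a : A^c) *: p) f = tens p (a *: f).
Proof.
have := tensor_relatorP (TensorZ a p f); rewrite raddfB /=.
by move/eqP; rewrite subr_eq0 => /eqP.
Qed.

Lemma tens0 p : tens p 0 = 0.
Proof. by apply/(addrI (tens p 0)); rewrite -tensDr !addr0. Qed.

Lemma ten0s f : tens 0 f = 0.
Proof. by apply/(addrI (tens 0 f)); rewrite -tensDl !addr0. Qed.

Lemma tens_ksignl i p f : tens (ksign i p) f = ksign i (tens p f).
Proof. by rewrite (ksign_mor _ _ (fun p q => tensDl p q f)). Qed.

Lemma tens_ksignr i p f : tens p (ksign i f) = ksign i (tens p f).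
Proof. by rewrite (ksign_mor _ _ (tensDr p)). Qed.

Lemma tens_ind (Q : tensor_sort -> Prop) :
  Q 0 -> (forall x y, Q x -> Q y -> Q (x + y)) -> (forall x, Q x -> Q (- x)) ->
  (forall i j p f, homog SP i p -> homog SF j f -> Q (tens p f)) -> forall t, Q t.
Proof.
move=> Q0 QD QN Qt.
have Qn n x : Q x -> Q (x *+ n).
  by move=> Qx; elim: n => [|n IHn]; rewrite ?mulr0n // mulrS; apply: QD.
have Qh p f : Q (tens p f).
  elim/(homog_ind (S := SP)): p => [|p q pE qE|i p pi]; rewrite ?ten0s //.
    by rewrite tensDl; apply: QD.
  elim/(homog_ind (S := SF)): f => [|f g fE gE|j f fj]; rewrite ?tens0 //.
    by rewrite tensDr; apply: QD.
  exact: Qt pi fj.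
move=> t; rewrite -(tensor_pi_repr t); elim/fg_ind: (repr t) => [|x y xE yE|a u].
- by rewrite raddf0.
- by rewrite raddfD; apply: QD.
have -> : << a *g u >> = << u >> *~ a :> Z.
  by rewrite freegU_mulz intz.
rewrite raddfMz; case: u => p f; case: a => n.
  by rewrite -pmulrn; apply/Qn/Qh.
by rewrite NegzE mulrNz -pmulrn; apply/QN/Qn/Qh.
Qed.

Section Lift.
Variables (W : zmodType) (b : P -> F -> W).
Hypothesis bDl : forall p q f, b (p + q) f = b p f + b q f.
Hypothesis bDr : forall p f g, b p (f + g) = b p f + b p g.
Hypothesis bZ : forall (a : A) p f, b ((a : A^c) *: p) f = b p (a *: f).

Definition tensor_prelift : Z -> W := fsum (fun u c => b u.1 u.2 *~ c).

Lemma tensor_prelift_fD u :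
  {morph (fun c : int => b u.1 u.2 *~ c) : x y / x + y}.
Proof. by move=> x y; rewrite mulrzDr. Qed.

Lemma tensor_prelift_sub : zmod_morphism tensor_prelift.
Proof. exact: morphD_sub (fsumD tensor_prelift_fD). Qed.

HB.instance Definition _ := GRing.isZmodMorphism.Build Z W tensor_prelift
  tensor_prelift_sub.

Lemma tensor_preliftU p f : tensor_prelift << (p, f) >> = b p f.
Proof. by rewrite /tensor_prelift (fsumU tensor_prelift_fD). Qed.

Definition prelift_ker : {pred Z} := fun z => tensor_prelift z == 0.

Lemma prelift_ker_closed : zmod_closed prelift_ker.
Proof.
split; first by rewrite unfold_in raddf0.
move=> x y; rewrite !unfold_in raddfB /= => /eqP -> /eqP ->.
by rewrite subrr.
Qed.

HB.instance Definition _ := GRing.isZmodClosed.Build Z prelift_ker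
  prelift_ker_closed.

Lemma tensor_prelift0 z : z \in tensor_ker -> tensor_prelift z = 0.
Proof.
move=> /asboolP/(_ prelift_ker) zI; apply/eqP/zI => r [] *;
  rewrite unfold_in !raddfB /= !tensor_preliftU.
- by rewrite bDl addrAC addrK subrr.
- by rewrite bDr addrAC addrK subrr.
- by rewrite bZ subrr.
Qed.

Definition tensor_lift (t : tensor_sort) : W := tensor_prelift (repr t).

Lemma tensor_lift_pi z : tensor_lift (tensor_pi z) = tensor_prelift z.
Proof.
apply/eqP; rewrite /tensor_lift -subr_eq0 -raddfB; apply/eqP/tensor_prelift0.
by apply: tensor_pi_eq0; rewrite raddfB /= tensor_pi_repr subrr.
Qed.

Lemma tensor_liftE p f : tensor_lift (tens p f) = b p f.
Proof. by rewrite tensor_lift_pi tensor_preliftU. Qed.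

Lemma tensor_liftD : {morph tensor_lift : x y / x + y}.
Proof.
move=> x y; rewrite -(tensor_pi_repr x) -(tensor_pi_repr y) -raddfD.
by rewrite !tensor_lift_pi raddfD.
Qed.
End Lift.

(* The component of degree n of p (x) f is \sum_i p_i (x) f_(n - i). *)
Definition bal_gpart (n : int) (p : P) (f : F) : tensor_sort :=
  hsum SP (fun i q => tens q (gpart SF (n - i) f)) p.

(* d (p (x) f) = d p (x) f + (-1)^|p| p (x) d f *)
Definition bal_diff (p : P) (f : F) : tensor_sort :=
  tens (diff SP p) f + tens (twist SP 1 p) (diff SF f).

Lemma bal_gpart_fD n f i : {morph (fun q => tens q (gpart SF (n - i) f)) : p q / p + q}.
Proof. by move=> p q; rewrite tensDl. Qed.

Lemma bal_gpartDl n p q f : bal_gpart n (p + q) f = bal_gpart n p f + bal_gpart n q f.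
Proof. exact: (hsumD SP (bal_gpart_fD n f)). Qed.

Lemma bal_gpartDr n p f g : bal_gpart n p (f + g) = bal_gpart n p f + bal_gpart n p g.
Proof.
rewrite /bal_gpart /hsum -big_split; apply: eq_bigr => i _.
by rewrite /= gpart_additive tensDr.
Qed.

Lemma bal_gpart_homogl n i p f : homog SP i p ->
  bal_gpart n p f = tens p (gpart SF (n - i) f).
Proof. exact: (hsum_homog (bal_gpart_fD n f)). Qed.

Lemma bal_gpart_homog n i j p f : homog SP i p -> homog SF j f ->
  bal_gpart n p f = if n == i + j then tens p f else 0.
Proof.
move=> pi fj; rewrite (bal_gpart_homogl _ _ pi) (gpart_homog _ fj).
have -> : (n - i == j) = (n == i + j) by lia.
by case: eqP; rewrite ?tens0.
Qed.

Lemma bal_gpartZ n (a : A) p f :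
  bal_gpart n ((a : A^c) *: p) f = bal_gpart n p (a *: f).
Proof.
have g0l g : bal_gpart n 0 g = 0.
  by apply/(addrI (bal_gpart n 0 g)); rewrite -bal_gpartDl !addr0.
have g0r q : bal_gpart n q 0 = 0.
  by apply/(addrI (bal_gpart n q 0)); rewrite -bal_gpartDr !addr0.
elim/(homog_ind (S := SP)): p => [|p q pE qE|i p pi]; first by rewrite scaler0 !g0l.
  by rewrite scalerDr !bal_gpartDl pE qE.
elim/(homog_ind (S := SF)): f => [|f g fE gE|j f fj]; first by rewrite scaler0 !g0r.
  by rewrite scalerDr !bal_gpartDr fE gE.
elim/(homog_ind (S := SA)): a => [|a b aE bE|l a al].
- by rewrite !scale0r g0l g0r.
- by rewrite (scalerDl p (a : A^c) (b : A^c)) scalerDl bal_gpartDl bal_gpartDr aE bE.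
rewrite (bal_gpart_homog n (dgr_homogZ pi al) fj).
by rewrite (bal_gpart_homog n pi (dgl_homogZ al fj)) tensZ addrA.
Qed.

Lemma bal_diffDl p q f : bal_diff (p + q) f = bal_diff p f + bal_diff q f.
Proof. by rewrite /bal_diff diff_additive twistD !tensDl addrACA. Qed.

Lemma bal_diffDr p f g : bal_diff p (f + g) = bal_diff p f + bal_diff p g.
Proof. by rewrite /bal_diff diff_additive !tensDr addrACA. Qed.

Lemma bal_diffZ (a : A) p f : bal_diff ((a : A^c) *: p) f = bal_diff p (a *: f).
Proof.
rewrite /bal_diff dgr_leibnizT twist_dgr dgl_leibnizT tensDl tensDr !tensZ.
by rewrite addrA.
Qed.

Definition tensor_gpart (n : int) : tensor_sort -> tensor_sort :=
  tensor_lift (bal_gpart n).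
Definition tensor_diff : tensor_sort -> tensor_sort := tensor_lift bal_diff.

Lemma tensor_gpartD n : {morph tensor_gpart n : x y / x + y}.
Proof.
exact: tensor_liftD (bal_gpartDl n) (bal_gpartDr n) (bal_gpartZ n).
Qed.
Lemma tensor_diffD : {morph tensor_diff : x y / x + y}.
Proof. exact: tensor_liftD bal_diffDl bal_diffDr bal_diffZ. Qed.

HB.instance Definition _ n := GRing.isZmodMorphism.Build tensor_sort tensor_sort
  (tensor_gpart n) (morphD_sub (tensor_gpartD n)).
HB.instance Definition _ := GRing.isZmodMorphism.Build tensor_sort tensor_sort
  tensor_diff (morphD_sub tensor_diffD).

Lemma tensor_gpartE n i j p f : homog SP i p -> homog SF j f ->
  tensor_gpart n (tens p f) = if n == i + j then tens p f else 0.
Proof.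
move=> pi fj; rewrite -(bal_gpart_homog n pi fj).
exact: tensor_liftE (bal_gpartDl n) (bal_gpartDr n) (bal_gpartZ n) _ _.
Qed.

Lemma tensor_diffE p f : tensor_diff (tens p f) =
  tens (diff SP p) f + tens (twist SP 1 p) (diff SF f).
Proof. exact: tensor_liftE bal_diffDl bal_diffDr bal_diffZ _ _. Qed.

Lemma tensor_gpart_gpart i j x :
  tensor_gpart i (tensor_gpart j x) = if i == j then tensor_gpart j x else 0.
Proof.
elim/tens_ind: x => [|x y xE yE|x xE|a b p f pa fb].
- by rewrite !raddf0 if_same.
- by rewrite !raddfD /= xE yE; case: eqP; rewrite ?addr0.
- by rewrite !raddfN /= xE; case: eqP; rewrite ?oppr0.
rewrite !(tensor_gpartE _ pa fb); case: (j =P a + b) => [->|_].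
  by rewrite (tensor_gpartE _ pa fb).
by rewrite raddf0 if_same.
Qed.

Lemma tensor_gpart_fin x :
  exists2 s : seq int, uniq s & x = \sum_(j <- s) tensor_gpart j x.
Proof.
have gD := tensor_gpartD; have gg := tensor_gpart_gpart.
elim/tens_ind: x => [|x y xE yE|x [s us xE]|a b p f pa fb].
- exact: gfin0.
- exact: gfinD.
- exists s => //; rewrite {1}xE -sumrN; apply: eq_bigr => j _.
  by rewrite raddfN.
by apply: (@gfin_homog _ _ (a + b)); rewrite (tensor_gpartE _ pa fb) eqxx.
Qed.

Lemma homog_twist n i p : homog SP i p -> homog SP i (twist SP n p).
Proof. by move=> pi; rewrite (twist_homog _ pi); apply: homog_ksign. Qed.

Lemma tensor_diff_gpart j x :
  tensor_diff (tensor_gpart j x) = tensor_gpart (j + 1) (tensor_diff x).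
Proof.
elim/tens_ind: x => [|x y xE yE|x xE|a b p f pa fb].
- by rewrite !raddf0.
- by rewrite !raddfD /= xE yE.
- by rewrite !raddfN /= xE.
rewrite (tensor_gpartE _ pa fb) tensor_diffE raddfD /=.
rewrite (tensor_gpartE _ (homog_diff pa) fb).
rewrite (tensor_gpartE _ (homog_twist 1 pa) (homog_diff fb)).
have -> : (j + 1 == a + 1 + b) = (j == a + b) by lia.
have -> : (j + 1 == a + (b + 1)) = (j == a + b) by lia.
by case: eqP => _; rewrite ?tensor_diffE // raddf0 addr0.
Qed.

Lemma tensor_diff_diff x : tensor_diff (tensor_diff x) = 0.
Proof.
elim/tens_ind: x => [|x y xE yE|x xE|a b p f pa fb].
- by rewrite !raddf0.
- by rewrite !raddfD /= xE yE addr0.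
- by rewrite !raddfN /= xE oppr0.
rewrite tensor_diffE raddfD /= !tensor_diffE !diff_diff ten0s tens0.
rewrite add0r addr0 twist1_diff.
by rewrite -tensDl subrr ten0s.
Qed.

Definition tensor_str : dgstr tensor_sort :=
  DGStr tensor_gpartD tensor_gpart_gpart tensor_gpart_fin tensor_diffD
    tensor_diff_gpart tensor_diff_diff.

Definition tensor : complex := Complex tensor_str.

End Tensor.

Definition dtensor (k : fieldType) (A : dga k) (P : dgrmod A) (M : dglmod A) :
    complex :=
  tensor P (resolution M).

Section Residue.
Variables (k : fieldType) (R : dga k) (hR : simply_connected R).
Local Notation SR := (dga_str R).

(* the augmentation R -> R^0 = k *)
Definition aug (r : R) : k := sval (cid (sc_zero hR (homog_gpart SR 0 r))).

Lemma augE r : (aug r)%:A = gpart SR 0 r.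
Proof. by rewrite /aug; case: cid. Qed.

Lemma dga_scalar_inj : injective (fun c : k => c%:A : R).
Proof.
move=> a b /eqP; rewrite -subr_eq0 -scalerBl scaler_eq0 oner_eq0 orbF subr_eq0.
by move/eqP.
Qed.

Lemma augD : {morph aug : a b / a + b}.
Proof.
by move=> a b; apply: dga_scalar_inj; rewrite scalerDl !augE gpart_additive.
Qed.

HB.instance Definition _ := GRing.isZmodMorphism.Build R k aug (morphD_sub augD).

Lemma aug1 : aug 1 = 1.
Proof. by apply: dga_scalar_inj; rewrite augE scale1r (dga_homog1 R). Qed.

Lemma aug_homog j r : homog SR j r -> j != 0 -> aug r = 0.
Proof.
move=> rj j0; apply: dga_scalar_inj; rewrite augE scale0r (gpart_homog _ rj).
by rewrite eq_sym (negbTE j0).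
Qed.

Lemma augM a b : aug (a * b) = aug a * aug b.
Proof.
elim/(homog_ind (S := SR)): a => [|x y xE yE|i a ai]; first by rewrite mul0r raddf0 mul0r.
  by rewrite mulrDl !raddfD /= xE yE mulrDl.
elim/(homog_ind (S := SR)): b => [|x y xE yE|j b bj]; first by rewrite mulr0 raddf0 mulr0.
  by rewrite mulrDr !raddfD /= xE yE mulrDr.
have [i0|i0] := boolP (i < 0); first by rewrite (sc_neg hR i0 ai) mul0r raddf0 mul0r.
have [j0|j0] := boolP (j < 0); first by rewrite (sc_neg hR j0 bj) mulr0 raddf0 mulr0.
have abij := dga_homogM ai bj.
have [ie|ie] := eqVneq i 0; last first.
  by rewrite (aug_homog ai ie) mul0r (aug_homog abij) //; lia.
have [je|je] := eqVneq j 0; last first.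
  by rewrite (aug_homog bj je) mulr0 (aug_homog abij) //; lia.
rewrite ie je addr0 in ai bj abij.
apply: dga_scalar_inj; rewrite augE abij -{1}ai -{1}bj -!augE.
by rewrite -scalerAl mul1r scalerA.
Qed.

Lemma aug_diff r : aug (diff SR r) = 0.
Proof.
elim/(homog_ind (S := SR)): r => [|x y xE yE|i r ri]; first by rewrite !raddf0.
  by rewrite !raddfD /= xE yE addr0.
have [i1|i1] := eqVneq (i + 1) 0; last exact: aug_homog (homog_diff ri) i1.
have i0 : i < 0 by lia.
by rewrite (sc_neg hR i0 ri) !raddf0.
Qed.

Definition residue_sort of simply_connected R : Type := k.
HB.instance Definition _ h := GRing.Zmodule.on (residue_sort h).
Local Notation resk := (residue_sort hR).

Definition residue_scale (r : R^c) (x : resk) : resk :=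
  (x : k) * aug r.

Lemma residue_scaleA a b x :
  residue_scale a (residue_scale b x) = residue_scale (a * b) x.
Proof. by rewrite /residue_scale -mulrA -augM. Qed.
Lemma residue_scale1 : left_id 1 residue_scale.
Proof. by move=> x; rewrite /residue_scale aug1 mulr1. Qed.
Lemma residue_scaleDr : right_distributive residue_scale +%R.
Proof. by move=> a x y; rewrite /residue_scale -mulrDl. Qed.
Lemma residue_scaleDl x : {morph residue_scale^~ x : a b / a + b}.
Proof. by move=> a b; rewrite /residue_scale -mulrDr -augD. Qed.

HB.instance Definition _ := GRing.Zmodule_isLmodule.Build R^c resk
  residue_scaleA residue_scale1 residue_scaleDr residue_scaleDl.

Lemma residue_scale0 (a : R) (x : resk) : aug a = 0 -> (a : R^c) *: x = 0.
Proof. by move=> a0; rewrite [LHS]/(residue_scale a x) /residue_scale a0 mulr0. Qed.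

Definition residue_gpart (j : int) (x : resk) : resk :=
  if j == 0 then x else 0.
Definition residue_diff (x : resk) : resk := 0.

Lemma residue_gpartD j : {morph residue_gpart j : x y / x + y}.
Proof. by move=> x y; rewrite /residue_gpart; case: ifP; rewrite ?addr0. Qed.

Lemma residue_gpart_gpart i j x :
  residue_gpart i (residue_gpart j x) = if i == j then residue_gpart j x else 0.
Proof.
rewrite /residue_gpart; have [->|i0] := eqVneq i 0.
  by rewrite eq_sym; case: eqP.
by have [->|j0] := eqVneq j 0; rewrite ?(negbTE i0) // if_same.
Qed.

Lemma residue_gpart_fin x :
  exists2 s : seq int, uniq s & x = \sum_(j <- s) residue_gpart j x.
Proof. by exists [:: 0]; rewrite ?big_seq1. Qed.

Lemma residue_diffD : {morph residue_diff : x y / x + y}.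
Proof. by move=> x y; rewrite /residue_diff addr0. Qed.

Lemma residue_diff_gpart j x :
  residue_diff (residue_gpart j x) = residue_gpart (j + 1) (residue_diff x).
Proof. by rewrite /residue_gpart if_same. Qed.

Lemma residue_diff_diff x : residue_diff (residue_diff x) = 0.
Proof. by []. Qed.

Definition residue_str : dgstr resk :=
  DGStr residue_gpartD residue_gpart_gpart residue_gpart_fin residue_diffD
    residue_diff_gpart residue_diff_diff.

Lemma residue_homogZ i j (a : R) (x : resk) :
  homog residue_str i x -> homog SR j a ->
  homog residue_str (i + j) ((a : R^c) *: x).
Proof.
rewrite /homog /= /residue_gpart => xi aj.
have [i0|i0] := eqVneq i 0; last first.
  by rewrite -xi (negbTE i0) scaler0 if_same.
have [j0|j0] := eqVneq j 0; first by rewrite i0 j0 addr0 eqxx.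
by rewrite (residue_scale0 _ (aug_homog aj j0)) if_same.
Qed.

Lemma residue_leibniz i (a : R) (x : resk) : homog residue_str i x ->
  residue_diff ((a : R^c) *: x) =
  (a : R^c) *: residue_diff x + ksign i ((diff SR a : R^c) *: x).
Proof.
by move=> _; rewrite (residue_scale0 _ (aug_diff a)) scaler0 raddf0 addr0.
Qed.

(* k as a DG right-R-module in degree 0; its left structure plays no role in
   k (x)^L_R M, seen as a complex. *)
Definition residue : dgrmod R := DGRmod residue_homogZ residue_leibniz.

Definition pcd (M : dglmod R) : \bar int := coh_sup (dtensor residue M).

End Residue.

(* Main.v *)
Require Import Defs.
From HB Require Import structures.
From mathcomp Require Import all_boot all_order all_algebra.
From mathcomp Require Import boolp classical_sets constructive_ereal.
From mathcomp.multinomials Require Import freeg.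
From mathcomp Require Import zify.

(** Everything rests on the triangle obtained by killing the lowest cohomology of a
    semifree module [F]. If [H^j(F) = 0] for [j < i], map a free module [E] on
    cocycles of degree [i] onto a basis of [H^i(F)] and let [G] be the cone of [E -> F].
    Since [R^0 = k] and [R^1 = 0], the module [G] has no cohomology up to degree [i]
    ([kill_lowest]), and it is again semifree. As [P (x) E] is a sum of copies
    of [P] shifted by [i], the long exact sequence compares [P (x) F] with [P (x) G]
    for every [P] at once ([peel]). All the estimates follow by repeating this step,
    which unwinds a minimal semifree resolution of [F] one degree at a time.

    For the infimum, let [a] be a lower bound for the degrees in which [P] has
    cohomology. Peeling is injective on [H^j(P (x) F)] for [j < a + i], however often
    it is repeated. On the other hand a cocycle of [P (x) F] involves only finitely many
    basis elements of [F], and after enough peelings the map from [F] to the peeled module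
    is null-homotopic on the submodule that they generate
    ([tensor_null_bounded]). Hence [H^j(P (x) F) = 0] for [j < a + i]
    ([tensor_acyclic_below]). Applied to [G], this makes [H^a(P)^(beta)] inject into
    [H^(a + i)(P (x) F)], where [beta] is the dimension of [H^i(F)]
    ([tensor_lowest]); so inf adds up. For [P = k] one gets Nakayama's lemma: [F] is
    acyclic as soon as [k (x) F] is.

    For the supremum, let [p] be the top degree of the cohomology of [k (x) F] and [s] that
    of [P]. Peeling removes [H^i(k (x) F)] and leaves the rest of the
    cohomology of [k (x) F] unchanged, so that after finitely many steps [F] has become
    acyclic, hence contractible. Each step alters [H^j(P (x) F)] only in degrees
    [j <= s + i], and the last nontrivial one, with [i = p], contributes a nonzero
    [H^s(P)^(beta)] in degree [s + p] ([tensor_acyclic_above],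
    [tensor_highest]); so the supremum is [s + p].

    Compactness of [M] enters through two bounds: [inf M] is not [-oo], and
    [k (x)^L M] is bounded above ([compact_below], [compact_bounded]). Both pass
    through the constructions that build [M] from [R]. For the second one, a semifree
    resolution must be carried along, which is possible because maps from semifree
    modules lift along quasi-isomorphisms up to homotopy ([semifree_lift]); the same lifting
    shows that the bound does not depend on the resolution
    ([tensor_resolution]). *)

Set Implicit Arguments.
Unset Strict Implicit.
Unset Printing Implicit Defensive.

Import Order.TTheory GRing.Theory Num.Theory.
Local Open Scope ring_scope.

(** * Additive maps and the cohomology of complexes *)

Section AdditiveMaps.
Variables (U W : zmodType) (f : U -> W).
Hypothesis fD : {morph f : x y / x + y}.

Lemma morphD0 : f 0 = 0.
Proof. by apply: (addrI (f 0)); rewrite -fD !addr0. Qed.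

Lemma morphDN x : f (- x) = - f x.
Proof. exact: (ksign_mor 1 x fD). Qed.

Lemma morphD_sum I (s : seq I) (F : I -> U) :
  f (\sum_(i <- s) F i) = \sum_(i <- s) f (F i).
Proof. exact: (big_morph f fD morphD0). Qed.
End AdditiveMaps.

Definition acyclic_at (C : complex) j := forall x : C, cocycle j x -> coboundary j x.

Lemma acyclic_atP C j : acyclic_at C j <-> ~ coh_neq0 C j.
Proof.
split=> [Cj [x xc]|nC x xc]; first by apply; apply: Cj.
by apply: contrapT => xb; apply: nC; exists x.
Qed.

Lemma not_acyclic_at C j : coh_neq0 C j <-> ~ acyclic_at C j.
Proof.
split=> [Cj /acyclic_atP //|nC]; apply: contrapT => nCj.
by apply: nC; apply/acyclic_atP.
Qed.

Section Cohomology.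
Variable C : complex.
Implicit Types x y : C.

Lemma cocycle0 j : @cocycle C j 0.
Proof. by split; [exact: homog0 | exact: raddf0]. Qed.

Lemma cocycleD j x y : cocycle j x -> cocycle j y -> cocycle j (x + y).
Proof. by move=> [xj x0] [yj y0]; split; [exact: homogD | rewrite raddfD /= x0 y0 addr0]. Qed.

Lemma cocycleN j x : cocycle j x -> cocycle j (- x).
Proof. by move=> [xj x0]; split; [exact: homogN | rewrite raddfN /= x0 oppr0]. Qed.

Lemma cocycleB j x y : cocycle j x -> cocycle j y -> cocycle j (x - y).
Proof. by move=> xc yc; apply: cocycleD => //; apply: cocycleN. Qed.

Lemma coboundary0 j : @coboundary C j 0.
Proof. by exists 0; [exact: homog0 | exact: raddf0]. Qed.

Lemma coboundaryD j x y : coboundary j x -> coboundary j y -> coboundary j (x + y).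
Proof.
move=> [u uj <-] [v vj <-]; exists (u + v); first exact: homogD.
by rewrite raddfD.
Qed.

Lemma coboundaryN j x : coboundary j x -> coboundary j (- x).
Proof. by move=> [u uj <-]; exists (- u); [exact: homogN | rewrite raddfN]. Qed.

Lemma coboundaryB j x y : coboundary j x -> coboundary j y -> coboundary j (x - y).
Proof. by move=> xc yc; apply: coboundaryD => //; apply: coboundaryN. Qed.

Lemma coboundary_sub j x y : coboundary j (x - y) -> coboundary j y -> coboundary j x.
Proof. by move=> xy yb; rewrite -(subrK y x); apply: coboundaryD. Qed.

Lemma coboundary_diff j x : homog C j x -> coboundary (j + 1) (diff C x).
Proof. by move=> xj; exists x; rewrite // addrK. Qed.

Lemma coboundary_ksign n j x : coboundary j x -> coboundary j (ksign n x).
Proof. by rewrite /ksign; case: ifP => // _; apply: coboundaryN. Qed.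
End Cohomology.

Lemma ksign_inv (V : zmodType) n (x : V) : ksign n (ksign n x) = x.
Proof. by rewrite /ksign; case: odd; rewrite ?opprK. Qed.

(** * The invariants inf, sup and amp of a complex *)

Definition acyclic_below (C : complex) i := forall j, j < i -> acyclic_at C j.
Definition acyclic_above (C : complex) i := forall j, i < j -> acyclic_at C j.

Section Bounds.
Variable C : complex.

Lemma acyclic_from_below i : acyclic_below C i ->
  (forall j, acyclic_below C j -> acyclic_at C j) -> forall j, acyclic_at C j.
Proof.
move=> Ci Cstep.
have Cn n : acyclic_below C (i + n%:Z).
  elim: n => [|n IHn]; first by rewrite addr0.
  move=> j jn; have [|ij] := ltP j (i + n%:Z); first exact: IHn.
  by have -> : j = i + n%:Z; [lia | apply: Cstep].
by move=> j; apply: (Cn (absz (j - i)).+1); lia.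
Qed.

Lemma acyclic_from_above i : acyclic_above C i ->
  (forall j, acyclic_above C j -> acyclic_at C j) -> forall j, acyclic_at C j.
Proof.
move=> Ci Cstep.
have Cn n : acyclic_above C (i - n%:Z).
  elim: n => [|n IHn]; first by rewrite subr0.
  move=> j jn; have [|ij] := ltP (i - n%:Z) j; first exact: IHn.
  by have -> : j = i - n%:Z; [lia | apply: Cstep].
by move=> j; apply: (Cn (absz (j - i)).+1); lia.
Qed.

Lemma lowest_degree i : acyclic_below C i -> ~ (forall j, acyclic_at C j) ->
  exists j, acyclic_below C j /\ ~ acyclic_at C j.
Proof.
move=> Ci nC; apply: contrapT => nj; apply: nC; apply: acyclic_from_below Ci _ => j Cj.
by apply: contrapT => nCj; apply: nj; exists j.
Qed.

Lemma highest_degree i : acyclic_above C i -> ~ (forall j, acyclic_at C j) ->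
  exists j, acyclic_above C j /\ ~ acyclic_at C j.
Proof.
move=> Ci nC; apply: contrapT => nj; apply: nC; apply: acyclic_from_above Ci _ => j Cj.
by apply: contrapT => nCj; apply: nj; exists j.
Qed.

Let degrees := [set j%:E | j in [set j | coh_neq0 C j]]%classic.

Lemma coh_sup_unique (b : \bar int) j : coh_neq0 C j -> supremums degrees b -> coh_sup C = b.
Proof.
move=> Cj bS; rewrite /coh_sup /supremum -/degrees ifF; last first.
  by apply/eqP => /seteqP[+ _] => /(_ j%:E); apply; exists j.
apply: (xget_unique _ bS) => y yS; apply: (is_subset1_supremums yS bS).
Qed.

Lemma coh_inf_unique (b : \bar int) j : coh_neq0 C j -> infimums degrees b -> coh_inf C = b.
Proof.
move=> Cj bS; rewrite /coh_inf /infimum -/degrees ifF; last first.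
  by apply/eqP => /seteqP[+ _] => /(_ j%:E); apply; exists j.
apply: (xget_unique _ bS) => y yS; apply: (is_subset1_infimums yS bS).
Qed.

Lemma acyclic_degrees : (forall j, acyclic_at C j) -> degrees = set0.
Proof.
move=> Cac; apply/seteqP; split=> // x [j Cj _].
by have /acyclic_atP := Cac j.
Qed.

Lemma coh_sup_acyclic : (forall j, acyclic_at C j) -> coh_sup C = -oo%E.
Proof. by move=> /acyclic_degrees d0; rewrite /coh_sup -/degrees d0 supremum0. Qed.

Lemma acyclic_below_le i j : acyclic_below C i -> coh_neq0 C j -> i <= j.
Proof. by move=> Ci Cj; rewrite leNgt; apply/negP => /Ci/acyclic_atP. Qed.

Lemma acyclic_above_ge i j : acyclic_above C i -> coh_neq0 C j -> j <= i.
Proof. by move=> Ci Cj; rewrite leNgt; apply/negP => /Ci/acyclic_atP. Qed.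

Lemma coh_infE i : acyclic_below C i -> ~ acyclic_at C i -> coh_inf C = i%:E.
Proof.
move=> Ci /not_acyclic_at nC; apply: (coh_inf_unique nC); split.
  by move=> _ [j Cj <-]; rewrite lee_fin; apply: acyclic_below_le Ci Cj.
by move=> y; apply; exists i.
Qed.

Lemma coh_supE i : acyclic_above C i -> ~ acyclic_at C i -> coh_sup C = i%:E.
Proof.
move=> Ci /not_acyclic_at nC; apply: (coh_sup_unique nC); split.
  by move=> _ [j Cj <-]; rewrite lee_fin; apply: acyclic_above_ge Ci Cj.
by move=> y; apply; exists i.
Qed.

Lemma coh_inf_unbounded : ~ (exists i, acyclic_below C i) -> coh_inf C = -oo%E.
Proof.
move=> nC; have [j [Cj _]] : exists j, coh_neq0 C j /\ j < 0.
  apply: contrapT => nj; apply: nC; exists 0 => j j0; apply/acyclic_atP => Cj.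
  by apply: nj; exists j.
apply: (coh_inf_unique Cj); split=> [x _|y yd]; first exact: leNye.
case: y yd => [i yd|/(_ j%:E)|//]; last by apply; exists j.
case: nC; exists i => l li; apply/acyclic_atP => Cl.
by have := yd l%:E; rewrite lee_fin leNgt li => H; apply: (notF (H _)); exists l.
Qed.

Lemma coh_sup_unbounded : ~ (exists i, acyclic_above C i) -> coh_sup C = +oo%E.
Proof.
move=> nC; have [j [Cj _]] : exists j, coh_neq0 C j /\ 0 < j.
  apply: contrapT => nj; apply: nC; exists 0 => j j0; apply/acyclic_atP => Cj.
  by apply: nj; exists j.
apply: (coh_sup_unique Cj); split=> [x _|y yd]; first exact: leey.
case: y yd => [i yd|//|/(_ j%:E)]; last by apply; exists j.
case: nC; exists i => l li; apply/acyclic_atP => Cl.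
by have := yd l%:E; rewrite lee_fin leNgt li => H; apply: (notF (H _)); exists l.
Qed.

(** When there is cohomology at all, inf is not [+oo] and sup is not [-oo], so an infinite
    value of one of them makes the difference [+oo]. *)
Lemma amp_lt_pinfty : (amp C < +oo)%E -> ~ (forall j, acyclic_at C j) ->
  (exists i, acyclic_below C i) /\ (exists s, acyclic_above C s).
Proof.
move=> Camp nC; have [[i Ci]|nb] := pselect (exists i, acyclic_below C i).
  have [[s Cs]|na] := pselect (exists s, acyclic_above C s).
    by split; [exists i | exists s].
  have [j [Cj nj]] := lowest_degree Ci nC.
  by move: Camp; rewrite /amp (coh_infE Cj nj) coh_sup_unbounded.
have [[s Cs]|na] := pselect (exists s, acyclic_above C s).
  have [j [Cj nj]] := highest_degree Cs nC.
  by move: Camp; rewrite /amp (coh_supE Cj nj) coh_inf_unbounded.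
by move: Camp; rewrite /amp coh_sup_unbounded // coh_inf_unbounded.
Qed.
End Bounds.

(** * Morphisms of complexes and mapping cones *)

(** The sign is the one for which suspensions and the projection of a cone onto the
    suspended source are morphisms, of degrees other than [0]. *)
Record chain_map n (B C : complex) (f : B -> C) : Prop := ChainMap {
  chain_add : {morph f : x y / x + y};
  chain_gpart : forall j x, f (gpart B j x) = gpart C (j + n) (f x);
  chain_diff : forall x, diff C (f x) = ksign n (f (diff B x))
}.

Section ChainMaps.
Variables (n : int) (B C : complex) (f : B -> C).
Hypothesis fC : chain_map n f.

Lemma chain_homog j x : homog B j x -> homog C (j + n) (f x).
Proof. by move=> xj; rewrite /homog -(chain_gpart fC) xj. Qed.

Lemma chain_cocycle j x : cocycle j x -> cocycle (j + n) (f x).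
Proof.
move=> [xj x0]; split; first exact: chain_homog.
by rewrite (chain_diff fC) x0 (morphD0 (chain_add fC)) raddf0.
Qed.

Lemma chain_coboundary j x : coboundary j x -> coboundary (j + n) (f x).
Proof.
move=> [u uj <-]; exists (ksign n (f u)).
  by apply: homog_ksign; have := chain_homog uj; rewrite addrAC.
by rewrite (ksign_mor _ _ (diff_additive C)) (chain_diff fC) ksign_inv.
Qed.
End ChainMaps.

Lemma chain_map0_cocycle (B C : complex) (f : B -> C) j x :
  chain_map 0 f -> cocycle j x -> cocycle j (f x).
Proof. by move=> fC /(chain_cocycle fC); rewrite addr0. Qed.

Lemma chain_map0_coboundary (B C : complex) (f : B -> C) j x :
  chain_map 0 f -> coboundary j x -> coboundary j (f x).
Proof. by move=> fC /(chain_coboundary fC); rewrite addr0. Qed.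

Lemma retract_acyclic n m (B C : complex) (f : B -> C) (g : C -> B) j :
  chain_map n f -> chain_map m g -> n + m = 0 ->
  (forall x, cocycle j x -> coboundary j (x - g (f x))) ->
  acyclic_at C (j + n) -> acyclic_at B j.
Proof.
move=> fC gC nm gf Cj x xc; apply: (coboundary_sub (gf x xc)).
have := chain_coboundary gC (Cj _ (chain_cocycle fC xc)).
by rewrite -addrA nm addr0.
Qed.

(** The long exact sequence of a cone only uses the splitting of the underlying graded
    object and the formulas for the differential. In this form it applies to a
    cone of DG modules as well as to its image under [P (x) -]. *)
Record cone_data (A B C : complex) (f : A -> B) (iota : B -> C) (kappa : A -> C)
    (pr : C -> A) (rho : C -> B) : Prop := ConeData {
  cone_f : chain_map 0 f;
  cone_iota : chain_map 0 iota;
  cone_pr : chain_map 1 pr;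
  cone_rhoD : {morph rho : x y / x + y};
  cone_rho_gpart : forall j x, rho (gpart C j x) = gpart B j (rho x);
  cone_rho_diff : forall x, diff B (rho x) = rho (diff C x) - f (pr x);
  cone_kappaD : {morph kappa : x y / x + y};
  cone_kappa_gpart : forall j x, kappa (gpart A j x) = gpart C (j - 1) (kappa x);
  cone_kappa_diff : forall x, diff C (kappa x) = iota (f x) - kappa (diff A x);
  cone_split : forall x, iota (rho x) + kappa (pr x) = x;
  cone_pr_iota : forall x, pr (iota x) = 0;
  cone_pr_kappa : forall x, pr (kappa x) = x;
  cone_rho_iota : forall x, rho (iota x) = x
}.

Section ConeSequence.
Variables (A B C : complex) (f : A -> B) (iota : B -> C) (kappa : A -> C).
Variables (pr : C -> A) (rho : C -> B).
Hypothesis cD : cone_data f iota kappa pr rho.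

Lemma cone_kappa_homog j x : homog A (j + 1) x -> homog C j (kappa x).
Proof. by move=> xj; rewrite /homog -[in LHS](addrK 1 j) -(cone_kappa_gpart cD) xj. Qed.

Lemma cone_rho_homog j x : homog C j x -> homog B j (rho x).
Proof. by move=> xj; rewrite /homog -(cone_rho_gpart cD) xj. Qed.

Lemma cone_pr_homog j x : homog C j x -> homog A (j + 1) (pr x).
Proof. by move=> xj; apply: (chain_homog (cone_pr cD) xj). Qed.

Lemma cone_pr_cocycle j x : cocycle j x -> cocycle (j + 1) (pr x).
Proof. by move=> xj; apply: (chain_cocycle (cone_pr cD) xj). Qed.

Lemma cone_f_pr j c : cocycle j c -> coboundary (j + 1) (f (pr c)).
Proof.
move=> [cj c0]; have := cone_rho_diff cD c.
rewrite c0 (morphD0 (cone_rhoD cD)) sub0r => /(canLR opprK) <-.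
by apply/coboundaryN/coboundary_diff/cone_rho_homog.
Qed.

Lemma cone_exact_C j c : cocycle j c -> coboundary (j + 1) (pr c) ->
  exists2 b, cocycle j b & coboundary j (c - iota b).
Proof.
move=> [cj c0] [w]; rewrite addrK => wj wE.
have fwj : homog B j (f w) by have := chain_homog (cone_f cD) wj; rewrite addr0.
exists (rho c + f w); last first.
  have -> : c - iota (rho c + f w) = - diff C (kappa w).
    rewrite (cone_kappa_diff cD) wE -{1}(cone_split cD c).
    by rewrite (chain_add (cone_iota cD)) opprB opprD addrACA subrr add0r.
  apply: coboundaryN; exists (kappa w) => //.
  by apply: cone_kappa_homog; rewrite subrK.
split; first exact: homogD (cone_rho_homog cj) fwj.
rewrite raddfD /= (cone_rho_diff cD) c0 (morphD0 (cone_rhoD cD)) sub0r.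
by rewrite (chain_diff (cone_f cD)) wE addNr.
Qed.

Lemma cone_exact_B j b : cocycle j b -> coboundary j (iota b) ->
  exists2 a, cocycle j a & coboundary j (b - f a).
Proof.
move=> [bj b0] [w wj wE]; exists (pr w).
  split; first by have := cone_pr_homog wj; rewrite subrK.
  by rewrite (chain_diff (cone_pr cD)) wE (cone_pr_iota cD) raddf0.
exists (rho w); first exact: cone_rho_homog.
by rewrite (cone_rho_diff cD) wE (cone_rho_iota cD).
Qed.

Lemma cone_exact_A j a : cocycle (j + 1) a -> coboundary (j + 1) (f a) ->
  exists2 c, cocycle j c & pr c = a.
Proof.
move=> [aj a0] [y]; rewrite addrK => yj yE; exists (kappa a - iota y); last first.
  rewrite (chain_add (cone_pr cD)) (morphDN (chain_add (cone_pr cD))).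
  by rewrite (cone_pr_kappa cD) (cone_pr_iota cD) subr0.
split.
  apply: homogD; first exact: cone_kappa_homog.
  by apply: homogN; have := chain_homog (cone_iota cD) yj; rewrite addr0.
rewrite raddfB /= (cone_kappa_diff cD) a0 (morphD0 (cone_kappaD cD)) subr0.
by rewrite (chain_diff (cone_iota cD)) yE subrr.
Qed.

Lemma cone_iota_f j a : cocycle j a -> coboundary j (iota (f a)).
Proof.
move=> [aj a0]; exists (kappa a); first by apply: cone_kappa_homog; rewrite subrK.
by rewrite (cone_kappa_diff cD) a0 (morphD0 (cone_kappaD cD)) subr0.
Qed.

Lemma cone_acyclic j : acyclic_at B j -> acyclic_at A (j + 1) -> acyclic_at C j.
Proof.
move=> Bj Aj c cc; have [b bc cb] := cone_exact_C cc (Aj _ (cone_pr_cocycle cc)).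
by apply: (coboundary_sub cb); apply: (chain_map0_coboundary (cone_iota cD)); apply: Bj.
Qed.

Lemma cone_acyclic_A j : acyclic_at B (j + 1) -> acyclic_at C j -> acyclic_at A (j + 1).
Proof.
move=> Bj Cj a ac.
have [c cc <-] := cone_exact_A ac (Bj _ (chain_map0_cocycle (cone_f cD) ac)).
exact: (chain_coboundary (cone_pr cD) (Cj _ cc)).
Qed.
End ConeSequence.

Definition qis (B C : complex) (f : B -> C) := forall j,
  (forall x : B, cocycle j x -> coboundary j (f x) -> coboundary j x) /\
  (forall y : C, cocycle j y -> exists2 x : B, cocycle j x & coboundary j (y - f x)).

Lemma qis_acyclic (B C : complex) (f : B -> C) j :
  chain_map 0 f -> qis f -> acyclic_at B j <-> acyclic_at C j.
Proof.
move=> fC fq; have [fi fs] := fq j; split=> [Bj y yc|Cj x xc].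
  have [x xc yx] := fs _ yc; apply: (coboundary_sub yx).
  by apply: (chain_map0_coboundary fC); apply: Bj.
by apply: fi => //; apply: Cj; apply: chain_map0_cocycle.
Qed.

Lemma cone_acyclic_qis (A B C : complex) (f : A -> B) iota kappa pr rho j :
  @cone_data A B C f iota kappa pr rho -> qis f -> acyclic_at C j.
Proof.
move=> cD fq c cc.
have [b bc cb] := cone_exact_C cD cc
  ((fq _).1 _ (cone_pr_cocycle cD cc) (cone_f_pr cD cc)).
apply: (coboundary_sub cb); have [a ac ba] := (fq j).2 _ bc.
apply: (@coboundary_sub _ _ _ (iota (f a))); last exact: (cone_iota_f cD).
rewrite -(morphDN (chain_add (cone_iota cD))) -(chain_add (cone_iota cD)).
exact: (chain_map0_coboundary (cone_iota cD)).
Qed.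

(** * Graded maps of DG modules and the tensor product *)

Section Twist.
Variables (V : zmodType) (S : dgstr V).
Implicit Types (x : V) (n m : int).

Lemma twist_twist n m x : twist S n (twist S m x) = twist S (n + m) x.
Proof.
elim/(homog_ind (S := S)): x => [|x y xE yE|j x xj]; first by rewrite !raddf0.
  by rewrite !raddfD /= xE yE.
by rewrite !(twist_homog _ xj) (twist_homog _ (homog_ksign _ xj)) ksignK mulrDl.
Qed.

Lemma twist_parity n m : odd (absz n) = odd (absz m) -> twist S n =1 twist S m.
Proof.
move=> nm x; elim/(homog_ind (S := S)): x => [|x y xE yE|j x xj]; first by rewrite !raddf0.
  by rewrite !raddfD /= xE yE.
rewrite !(twist_homog _ xj); apply: ksign_odd.
by rewrite !abszM !oddM nm.
Qed.

Lemma twist0 x : twist S 0 x = x.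
Proof.
elim/(homog_ind (S := S)): x => [|x y xE yE|j x xj]; first by rewrite !raddf0.
  by rewrite !raddfD /= xE yE.
by rewrite (twist_homog _ xj) mul0r.
Qed.

Lemma twistNn n x : twist S (- n) x = twist S n x.
Proof. by apply: twist_parity; rewrite abszN. Qed.

Lemma twist_gpart n j x : twist S n (gpart S j x) = gpart S j (twist S n x).
Proof.
elim/(homog_ind (S := S)): x => [|x y xE yE|i x xi]; first by rewrite !raddf0.
  by rewrite !raddfD /= xE yE.
rewrite (gpart_homog _ xi) (twist_homog _ xi) (gpart_homog _ (homog_ksign _ xi)).
by case: eqP => _; rewrite ?(twist_homog _ xi) ?raddf0.
Qed.

Lemma twist_homogeneous n j x : homog S j x -> homog S j (twist S n x).
Proof. by move=> xj; rewrite /homog -twist_gpart xj. Qed.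

Lemma twist_diff n x : diff S (twist S n x) = ksign n (twist S n (diff S x)).
Proof.
elim/(homog_ind (S := S)): x => [|x y xE yE|i x xi]; first by rewrite !raddf0.
  by rewrite !raddfD /= xE yE.
rewrite (twist_homog _ xi) (twist_homog _ (homog_diff xi)) ksignK.
rewrite (ksign_mor _ _ (diff_additive S)); apply: ksign_odd; lia.
Qed.
End Twist.

Section GradedMaps.
Variables (k : fieldType) (A : dga k).
Local Notation SA := (dga_str A).
Implicit Types X Y Z : dglmod A.

(** Moving a map of degree [n] past [a] in [A^i] costs the sign [(-1)^(n i)].
    Homotopies are the case [n = -1]. *)
Record gmap n X Y (f : X -> Y) : Prop := GMap {
  gmap_add : {morph f : x y / x + y};
  gmap_scale : forall a x, f (a *: x) = twist SA n a *: f x;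
  gmap_gpart : forall j x, f (gpart (dgl_str X) j x) = gpart (dgl_str Y) (j + n) (f x)
}.

Lemma gmap_homog n X Y (f : X -> Y) j x :
  gmap n f -> homog (dgl_str X) j x -> homog (dgl_str Y) (j + n) (f x).
Proof. by move=> fn xj; rewrite /homog -(gmap_gpart fn) xj. Qed.

Lemma gmap_id X : gmap 0 (fun x : X => x).
Proof. by split=> // *; rewrite ?twist0 ?addr0. Qed.

Lemma gmap_comp n m X Y Z (f : X -> Y) (g : Y -> Z) :
  gmap m g -> gmap n f -> gmap (n + m) (fun x => g (f x)).
Proof.
move=> gm fn; split=> [x y|a x|j x] /=.
- by rewrite (gmap_add fn) (gmap_add gm).
- by rewrite (gmap_scale fn) (gmap_scale gm) twist_twist [m + n]addrC.
- by rewrite (gmap_gpart fn) (gmap_gpart gm) addrA.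
Qed.

Lemma gmap_addf n X Y (f g : X -> Y) :
  gmap n f -> gmap n g -> gmap n (fun x => f x + g x).
Proof.
move=> fn gn; split=> [x y|a x|j x] /=.
- by rewrite (gmap_add fn) (gmap_add gn) addrACA.
- by rewrite (gmap_scale fn) (gmap_scale gn) scalerDr.
- by rewrite (gmap_gpart fn) (gmap_gpart gn) raddfD.
Qed.

Lemma gmap_oppf n X Y (f : X -> Y) : gmap n f -> gmap n (fun x => - f x).
Proof.
move=> fn; split=> [x y|a x|j x] /=.
- by rewrite (gmap_add fn) opprD.
- by rewrite (gmap_scale fn) scalerN.
- by rewrite (gmap_gpart fn) raddfN.
Qed.

Lemma gmap_dghom X Y (f : dghom X Y) : gmap 0 f.
Proof.
split=> *; first exact: raddfD.
  by rewrite twist0 linearZ.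
by rewrite addr0 dgh_gpart.
Qed.

Lemma dghom_of_gmap X Y (f : X -> Y) : gmap 0 f ->
  (forall x, f (diff (dgl_str X) x) = diff (dgl_str Y) (f x)) ->
  exists g : dghom X Y, g =1 f.
Proof.
move=> f0 fd.
have fZ : scalable f by move=> a x; rewrite (gmap_scale f0) twist0.
pose fa := GRing.isZmodMorphism.Build X Y f (morphD_sub (gmap_add f0)).
pose fs := GRing.isScalable.Build A X Y *:%R f fZ.
pose F : {linear X -> Y} := HB.pack f fa fs.
by exists (@DGHom k A X Y F (fun j x => etrans (gmap_gpart f0 j x)
  (congr1 (fun i => gpart (dgl_str Y) i (f x)) (addr0 j))) fd).
Qed.

Lemma chain_dghom X Y (f : dghom X Y) : @chain_map 0 X Y f.
Proof.
split=> *; first exact: raddfD.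
  by rewrite addr0; apply: dgh_gpart.
by rewrite -[LHS]dgh_diff.
Qed.

Lemma gmap_homotopy X Y (h : X -> Y) : gmap (- 1) h ->
  gmap 0 (fun x => diff (dgl_str Y) (h x) + h (diff (dgl_str X) x)).
Proof.
move=> hn; split=> [x y|a x|j x].
- by rewrite !raddfD /= !(gmap_add hn) raddfD addrACA.
- rewrite twist0 dgl_leibnizT (gmap_add hn) !(gmap_scale hn) !twistNn dgl_leibnizT.
  by rewrite twist1K twist1_diff scaleNr addrAC addKr addrC scalerDr.
by rewrite addr0 diff_gpart !(gmap_gpart hn) raddfD diff_gpart subrK addrK.
Qed.

Section Tensor.
Variable P : dgrmod A.
Local Notation SP := (dgr_str P).

Lemma tensor_ext X (W : zmodType) (f g : tensor_sort P X -> W) :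
  {morph f : x y / x + y} -> {morph g : x y / x + y} ->
  (forall i j p x, homog SP i p -> homog (dgl_str X) j x ->
     f (tens p x) = g (tens p x)) -> f =1 g.
Proof.
move=> fD gD fg; elim/tens_ind => [|x y xE yE|x xE|]; last exact: fg.
- by rewrite (morphD0 fD) (morphD0 gD).
- by rewrite fD gD xE yE.
- by rewrite (morphDN fD) (morphDN gD) xE.
Qed.

Definition tmap n X Y (f : X -> Y) : tensor P X -> tensor P Y :=
  tensor_lift (fun p x => tens (twist SP n p) (f x)).

Section TMap.
Variables (n : int) (X Y : dglmod A) (f : X -> Y).
Hypothesis fn : gmap n f.

Let bDl p q x : tens (twist SP n (p + q)) (f x) =
  tens (twist SP n p) (f x) + tens (twist SP n q) (f x).
Proof. by rewrite raddfD tensDl. Qed.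
Let bDr p x y : tens (twist SP n p) (f (x + y)) =
  tens (twist SP n p) (f x) + tens (twist SP n p) (f y).
Proof. by rewrite (gmap_add fn) tensDr. Qed.
Let bZ (a : A) p x : tens (twist SP n ((a : A^c) *: p)) (f x) =
  tens (twist SP n p) (f (a *: x)).
Proof. by rewrite twist_dgr tensZ (gmap_scale fn). Qed.

Lemma tmapE p x : tmap n f (tens p x) = tens (twist SP n p) (f x).
Proof. exact: (tensor_liftE bDl bDr bZ). Qed.

Lemma tmapD : {morph tmap n f : t u / t + u}.
Proof. exact: (tensor_liftD bDl bDr bZ). Qed.

Lemma tmap_gpart j t :
  tmap n f (gpart (tensor P X) j t) = gpart (tensor P Y) (j + n) (tmap n f t).
Proof.
move: t; apply: tensor_ext => [x y|x y|a b p x pa xb].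
- by rewrite raddfD tmapD.
- by rewrite tmapD raddfD.
rewrite /= (tensor_gpartE _ pa xb) tmapE.
rewrite (tensor_gpartE _ (twist_homogeneous n pa) (gmap_homog fn xb)).
have -> : (j + n == a + (b + n)) = (j == a + b) by lia.
by case: eqP => _; rewrite ?tmapE // (morphD0 tmapD).
Qed.
End TMap.

Lemma eq_tmap n m X Y (f g : X -> Y) : gmap n f -> gmap m g ->
  odd (absz n) = odd (absz m) -> f =1 g -> tmap n f =1 tmap m g.
Proof.
move=> fn gm nm fg; apply: tensor_ext (tmapD fn) (tmapD gm) _ => i j p x _ _.
by rewrite (tmapE fn) (tmapE gm) fg (twist_parity _ nm).
Qed.

Lemma tmap_id X t : tmap 0 (fun x : X => x) t = t.
Proof.
move: t; apply: tensor_ext (tmapD (gmap_id X)) _ _ => // i j p x _ _.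
by rewrite (tmapE (gmap_id X)) twist0.
Qed.

Lemma tmap_comp n m X Y Z (f : X -> Y) (g : Y -> Z) : gmap m g -> gmap n f ->
  forall t, tmap m g (tmap n f t) = tmap (n + m) (fun x => g (f x)) t.
Proof.
move=> gm fn; have gf := gmap_comp gm fn.
apply: tensor_ext (tmapD gf) _ => [t u|i j p x _ _].
  by rewrite (tmapD fn) (tmapD gm).
by rewrite (tmapE fn) (tmapE gm) (tmapE gf) twist_twist addrC.
Qed.

Lemma tmap_addf n X Y (f g : X -> Y) : gmap n f -> gmap n g ->
  forall t, tmap n (fun x => f x + g x) t = tmap n f t + tmap n g t.
Proof.
move=> fn gn; have fg := gmap_addf fn gn.
apply: tensor_ext (tmapD fg) _ _ => [t u|i j p x _ _].
  by rewrite (tmapD fn) (tmapD gn) addrACA.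
by rewrite (tmapE fn) (tmapE gn) (tmapE fg) tensDr.
Qed.

Lemma tmap_oppf n X Y (f : X -> Y) : gmap n f ->
  forall t, tmap n (fun x => - f x) t = - tmap n f t.
Proof.
move=> fn; have fg := gmap_oppf fn.
apply: tensor_ext (tmapD fg) _ _ => [t u|i j p x _ _].
  by rewrite (tmapD fn) opprD.
rewrite (tmapE fn) (tmapE fg); exact: (morphDN (tensDr _)).
Qed.

(** The differential of the first factor contributes the same terms on both sides, so the
    commutator of [P (x) f] with the differentials comes from that of [f]
    alone. Hence [P (x) -] preserves chain maps, homotopies and the splitting of
    a mapping cone. *)
Lemma tmap_diff n m X Y (f g : X -> Y) : gmap n f -> gmap m g ->
  odd (absz m) = ~~ odd (absz n) ->
  (forall x, diff (dgl_str Y) (f x) = ksign n (f (diff (dgl_str X) x)) + g x) ->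
  forall t, diff (tensor P Y) (tmap n f t) =
            ksign n (tmap n f (diff (tensor P X) t)) + tmap m g t.
Proof.
move=> fn gm nm fg; apply: tensor_ext => [t u|t u|i j p x _ _].
- by rewrite (tmapD fn) raddfD.
- by rewrite raddfD (tmapD fn) (tmapD gm) ksignD addrACA.
rewrite /= (tmapE fn) !tensor_diffE (tmapD fn) !(tmapE fn) (tmapE gm) fg.
rewrite twist_diff tens_ksignl tensDr tens_ksignr !ksignD addrA !twist_twist.
have mE := @twist_parity _ SP m (1 + n); rewrite mE; last by lia.
by rewrite [n + 1]addrC.
Qed.

Lemma tmap_chain n X Y (f : X -> Y) : gmap n f ->
  (forall x, diff (dgl_str Y) (f x) = ksign n (f (diff (dgl_str X) x))) ->
  chain_map n (tmap n f).
Proof.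
move=> fn fd; split; [exact: tmapD | exact: tmap_gpart |] => t.
have z0 : gmap (n + 1) (fun _ : X => 0 : Y).
  by split=> [x y|a x|j x]; rewrite ?addr0 // ?scaler0 // raddf0.
rewrite (tmap_diff fn z0) => [|//=|x]; last by rewrite fd addr0.
  have -> : tmap (n + 1) (fun _ : X => 0 : Y) t = 0; last by rewrite addr0.
  by move: t; apply: tensor_ext (tmapD z0) _ _ => [x y|i j p x _ _];
    rewrite ?addr0 // (tmapE z0) tens0.
lia.
Qed.

Lemma tmap_dghom X Y (f : dghom X Y) : chain_map 0 (tmap 0 f).
Proof. by apply: tmap_chain (gmap_dghom f) _ => x; rewrite -dgh_diff. Qed.

Lemma tmap_homotopy X Y (h : X -> Y) : gmap (- 1) h -> forall t,
  tmap 0 (fun x => diff (dgl_str Y) (h x) + h (diff (dgl_str X) x)) t =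
  diff (tensor P Y) (tmap (- 1) h t) + tmap (- 1) h (diff (tensor P X) t).
Proof.
move=> hn t; rewrite (tmap_diff hn (gmap_homotopy hn)) //.
  by rewrite addrAC [ksign _ _]/ksign /= addNr add0r.
by move=> x; rewrite /ksign /= addrCA addNr addr0.
Qed.

Lemma tmap_homotopic X Y (f g h : X -> Y) : gmap 0 f -> gmap 0 g -> gmap (- 1) h ->
  (forall x, f x - g x = diff (dgl_str Y) (h x) + h (diff (dgl_str X) x)) ->
  forall j t, cocycle j t -> coboundary j (tmap 0 f t - tmap 0 g t).
Proof.
move=> f0 g0 hn fg j t [tj t0].
rewrite -(tmap_oppf g0) -(tmap_addf f0 (gmap_oppf g0)).
rewrite (eq_tmap (gmap_addf f0 (gmap_oppf g0)) (gmap_homotopy hn) erefl fg).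
rewrite (tmap_homotopy hn) t0 (morphD0 (tmapD hn)) addr0.
exists (tmap (- 1) h t) => //.
by rewrite /homog -(tmap_gpart hn) tj.
Qed.
End Tensor.

Lemma homotopic_coboundary X Y (f g h : X -> Y) j (x : X) : gmap (- 1) h ->
  (forall x, f x - g x = diff (dgl_str Y) (h x) + h (diff (dgl_str X) x)) ->
  @cocycle X j x -> @coboundary Y j (f x - g x).
Proof.
move=> hn fg [xj x0]; exists (h x); first exact: (gmap_homog hn xj).
by rewrite fg [diff _ x]x0 (morphD0 (gmap_add hn)) addr0.
Qed.

End GradedMaps.

(** * Mapping cones, suspensions and direct sums *)

Section Cones.
Variables (k : fieldType) (A : dga k) (X Y : dglmod A) (f : dghom X Y).

Definition cone_in (y : Y) : cone f := (y, 0).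
Definition cone_sec (x : X) : cone f := (0, x).
Definition cone_out (c : cone f) : X := c.2.
Definition cone_ret (c : cone f) : Y := c.1.

Lemma gmap_cone_in : gmap 0 cone_in.
Proof.
split=> [x y|a x|j x].
- by rewrite /cone_in pairD addr0.
- by rewrite twist0; congr (_, _); rewrite /= scaler0.
- by rewrite addr0; congr (_, _); apply/esym/raddf0.
Qed.

Lemma gmap_cone_sec : gmap (- 1) cone_sec.
Proof.
split=> [x y|a x|j x].
- by congr (_, _); rewrite /= addr0.
- congr (_, _); first by rewrite /= scaler0.
  by rewrite /= [RHS]/(twist _ 1 _ *: _) twistNn twist1K.
- congr (_, _); first by rewrite /= raddf0.
  by rewrite /= /shift_gpart subrK.
Qed.

Lemma gmap_cone_out : gmap 1 cone_out.
Proof. by split. Qed.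

Lemma gmap_cone_ret : gmap 0 cone_ret.
Proof. by split=> [x y|a x|j x]; rewrite ?twist0 ?addr0. Qed.

Lemma cone_in_diff y :
  diff (dgl_str (cone f)) (cone_in y) = cone_in (diff (dgl_str Y) y).
Proof.
congr (_, _); first by rewrite /= raddf0 addr0.
by rewrite /= /shift_diff raddf0 raddf0.
Qed.

Lemma cone_sec_diff x : diff (dgl_str (cone f)) (cone_sec x) =
  cone_in (f x) - cone_sec (diff (dgl_str X) x).
Proof.
congr (_, _); first by rewrite /= raddf0 add0r subr0.
by rewrite /= sub0r.
Qed.

Lemma cone_out_diff c : diff (dgl_str X) (cone_out c) =
  - cone_out (diff (dgl_str (cone f)) c).
Proof. by rewrite /= /shift_diff /ksign /= opprK. Qed.

Lemma cone_ret_diff c : diff (dgl_str Y) (cone_ret c) =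
  cone_ret (diff (dgl_str (cone f)) c) - f (cone_out c).
Proof. by rewrite /= /cone_ret /= addrK. Qed.

Lemma cone_decomp c : cone_in (cone_ret c) + cone_sec (cone_out c) = c.
Proof. by case: c => x y; congr (_, _); rewrite /= ?addr0 ?add0r. Qed.

Lemma cone_cone_data :
  @cone_data X Y (cone f) f cone_in cone_sec cone_out cone_ret.
Proof.
split=> //.
- exact: chain_dghom.
- split=> [x y|j x|x].
  + exact: (gmap_add gmap_cone_in).
  + exact: (gmap_gpart gmap_cone_in).
  + exact: cone_in_diff.
- by split=> // c; apply: cone_out_diff.
- exact: cone_ret_diff.
- exact: (gmap_add gmap_cone_sec).
- exact: (gmap_gpart gmap_cone_sec).
- exact: cone_sec_diff.
- exact: cone_decomp.
Qed.

Variable P : dgrmod A.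

Lemma tensor_cone_data : @cone_data (tensor P X) (tensor P Y) (tensor P (cone f))
  (tmap 0 f) (tmap 0 cone_in) (tmap (- 1) cone_sec) (tmap 1 cone_out)
  (tmap 0 cone_ret).
Proof.
have fG := gmap_dghom f; have iG := gmap_cone_in; have sG := gmap_cone_sec.
have oG := gmap_cone_out; have rG := gmap_cone_ret.
have foG := gmap_comp fG oG; have ifG := gmap_comp iG fG.
split.
- exact: tmap_dghom.
- by apply: tmap_chain iG _ => x; rewrite cone_in_diff.
- by apply: tmap_chain oG _ => x; rewrite cone_out_diff.
- exact: tmapD.
- by move=> j t; rewrite (tmap_gpart rG) addr0.
- move=> t; rewrite (tmap_diff rG (gmap_oppf foG)) //; last exact: cone_ret_diff.
  by rewrite (tmap_oppf foG) -(tmap_comp fG oG).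
- exact: tmapD.
- by move=> j t; rewrite (tmap_gpart sG).
- move=> t; rewrite (tmap_diff sG ifG) //.
    by rewrite -(tmap_comp iG fG) addrC.
  by move=> x; rewrite cone_sec_diff addrC.
- move=> t; rewrite (tmap_comp iG rG) (tmap_comp sG oG).
  rewrite -(tmap_addf (gmap_comp iG rG) (gmap_comp sG oG)) -[RHS]tmap_id.
  have dG := gmap_addf (gmap_comp iG rG) (gmap_comp sG oG).
  exact: (eq_tmap dG (gmap_id _) erefl cone_decomp).
- move=> t; rewrite (tmap_comp oG iG); have oiG := gmap_comp oG iG.
  move: t; apply: tensor_ext (tmapD oiG) _ _ => [x y|i j p x _ _]; first by rewrite addr0.
  by rewrite (tmapE oiG) tens0.
- move=> t; rewrite (tmap_comp oG sG) -[RHS]tmap_id.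
  exact: (eq_tmap (gmap_comp oG sG) (gmap_id _)).
- move=> t; rewrite (tmap_comp rG iG) -[RHS]tmap_id.
  exact: (eq_tmap (gmap_comp rG iG) (gmap_id _)).
Qed.
End Cones.

Section Shifts.
Variables (k : fieldType) (A : dga k) (n : int) (X : dglmod A).

Definition shift_in (x : X) : shift n X := x.
Definition shift_out (x : shift n X) : X := x.

Lemma gmap_shift_in : gmap (- n) shift_in.
Proof.
split=> // [a x|j x]; last by rewrite /= /shift_gpart subrK.
have tE : odd (absz (n + - n)) = odd (absz 0) by rewrite subrr.
by rewrite [RHS]/(twist _ n _ *: _) twist_twist (twist_parity _ tE) twist0.
Qed.

Lemma gmap_shift_out : gmap n shift_out.
Proof. by []. Qed.

Lemma shift_out_diff x : diff (dgl_str X) (shift_out x) =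
  ksign n (shift_out (diff (dgl_str (shift n X)) x)).
Proof. by rewrite /= /shift_diff ksign_inv. Qed.

Lemma shift_in_diff x : diff (dgl_str (shift n X)) (shift_in x) =
  ksign (- n) (shift_in (diff (dgl_str X) x)).
Proof. by apply: ksign_odd; rewrite abszN. Qed.

Lemma chain_shift_in : @chain_map (- n) X (shift n X) shift_in.
Proof.
split=> // [j x|x]; first exact: (gmap_gpart gmap_shift_in).
exact: shift_in_diff.
Qed.

Lemma chain_shift_out : @chain_map n (shift n X) X shift_out.
Proof. by split=> // x; apply: shift_out_diff. Qed.

Lemma shift_acyclic j : acyclic_at X (j + n) -> acyclic_at (shift n X) j.
Proof.
apply: retract_acyclic chain_shift_out chain_shift_in (subrr n) _ => x _.
by rewrite subrr; apply: coboundary0.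
Qed.

Lemma tensor_shift_acyclic (P : dgrmod A) j :
  acyclic_at (tensor P X) (j + n) -> acyclic_at (tensor P (shift n X)) j.
Proof.
have iG := gmap_shift_in; have oG := gmap_shift_out.
apply: retract_acyclic (tmap_chain P oG shift_out_diff)
  (tmap_chain P iG shift_in_diff) (subrr n) _ => t _.
rewrite (tmap_comp iG oG) (eq_tmap (gmap_comp iG oG) (gmap_id _)) ?subrr //.
by rewrite tmap_id subrr; apply: coboundary0.
Qed.
End Shifts.

Section Sums.
Variables (k : fieldType) (A : dga k) (X Y : dglmod A).

Definition dsum_inl (x : X) : dsum X Y := (x, 0).
Definition dsum_inr (y : Y) : dsum X Y := (0, y).
Definition dsum_prl (u : dsum X Y) : X := u.1.
Definition dsum_prr (u : dsum X Y) : Y := u.2.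

Lemma gmap_dsum_inl : gmap 0 dsum_inl.
Proof.
split=> [x y|a x|j x]; rewrite ?twist0 ?addr0; congr (_, _);
  by rewrite /= ?addr0 ?scaler0 ?raddf0.
Qed.

Lemma gmap_dsum_inr : gmap 0 dsum_inr.
Proof.
split=> [x y|a x|j x]; rewrite ?twist0 ?addr0; congr (_, _);
  by rewrite /= ?addr0 ?scaler0 ?raddf0.
Qed.

Lemma gmap_dsum_prl : gmap 0 dsum_prl.
Proof. by split=> [x y|a x|j x]; rewrite ?twist0 ?addr0. Qed.

Lemma gmap_dsum_prr : gmap 0 dsum_prr.
Proof. by split=> [x y|a x|j x]; rewrite ?twist0 ?addr0. Qed.

Lemma dsum_inl_diff x :
  diff (dgl_str (dsum X Y)) (dsum_inl x) = dsum_inl (diff (dgl_str X) x).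
Proof. by congr (_, _); rewrite /= raddf0. Qed.

Lemma dsum_inr_diff x :
  diff (dgl_str (dsum X Y)) (dsum_inr x) = dsum_inr (diff (dgl_str Y) x).
Proof. by congr (_, _); rewrite /= raddf0. Qed.

Lemma dsum_decomp u : dsum_inl (dsum_prl u) + dsum_inr (dsum_prr u) = u.
Proof. by case: u => x y; congr (_, _); rewrite /= ?addr0 ?add0r. Qed.

Lemma chain_gmap0 (U V : dglmod A) (f : U -> V) : gmap 0 f ->
  (forall x, diff (dgl_str V) (f x) = f (diff (dgl_str U) x)) -> @chain_map 0 U V f.
Proof.
by move=> fG fd; split=> [|j x|x]; [exact: gmap_add fG | exact: (gmap_gpart fG) |].
Qed.

Lemma chain_dsum_inl : @chain_map 0 X (dsum X Y) dsum_inl.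
Proof. exact: chain_gmap0 gmap_dsum_inl dsum_inl_diff. Qed.

Lemma chain_dsum_inr : @chain_map 0 Y (dsum X Y) dsum_inr.
Proof. exact: chain_gmap0 gmap_dsum_inr dsum_inr_diff. Qed.

Lemma chain_dsum_prl : @chain_map 0 (dsum X Y) X dsum_prl.
Proof. exact: chain_gmap0 gmap_dsum_prl (fun=> erefl). Qed.

Lemma chain_dsum_prr : @chain_map 0 (dsum X Y) Y dsum_prr.
Proof. exact: chain_gmap0 gmap_dsum_prr (fun=> erefl). Qed.

Lemma sum_acyclic (B C D : complex) (i1 : B -> D) (i2 : C -> D) (p1 : D -> B)
    (p2 : D -> C) j :
  chain_map 0 i1 -> chain_map 0 i2 -> chain_map 0 p1 -> chain_map 0 p2 ->
  (forall x, i1 (p1 x) + i2 (p2 x) = x) ->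
  acyclic_at B j -> acyclic_at C j -> acyclic_at D j.
Proof.
move=> i1C i2C p1C p2C dec Bj Cj x xc; rewrite -(dec x); apply: coboundaryD.
  by apply: (chain_map0_coboundary i1C); apply/Bj/(chain_map0_cocycle p1C).
by apply: (chain_map0_coboundary i2C); apply/Cj/(chain_map0_cocycle p2C).
Qed.

Lemma dsum_acyclic j : acyclic_at X j -> acyclic_at Y j -> acyclic_at (dsum X Y) j.
Proof.
exact: sum_acyclic chain_dsum_inl chain_dsum_inr chain_dsum_prl chain_dsum_prr
  dsum_decomp.
Qed.

Lemma dsum_acyclic_l j : acyclic_at (dsum X Y) j -> acyclic_at X j.
Proof.
rewrite -{1}[j]addr0.
apply: retract_acyclic chain_dsum_inl chain_dsum_prl (addr0 0) _ => x _.
by rewrite subrr; apply: coboundary0.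
Qed.

Variable P : dgrmod A.

Let tC (U V : dglmod A) (f : U -> V) : gmap 0 f ->
  (forall x, diff (dgl_str V) (f x) = f (diff (dgl_str U) x)) ->
  chain_map 0 (tmap (P := P) 0 f).
Proof. by move=> fG fd; apply: tmap_chain fG _ => x; rewrite fd. Qed.

Lemma tensor_dsum_acyclic j : acyclic_at (tensor P X) j -> acyclic_at (tensor P Y) j ->
  acyclic_at (tensor P (dsum X Y)) j.
Proof.
have ilG := gmap_dsum_inl; have irG := gmap_dsum_inr.
have plG := gmap_dsum_prl; have prG := gmap_dsum_prr.
apply: sum_acyclic (tC ilG dsum_inl_diff) (tC irG dsum_inr_diff)
  (tC plG (fun=> erefl)) (tC prG (fun=> erefl)) _ => t.
rewrite (tmap_comp ilG plG) (tmap_comp irG prG).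
rewrite -(tmap_addf (gmap_comp ilG plG) (gmap_comp irG prG)) -[RHS]tmap_id.
have dG := gmap_addf (gmap_comp ilG plG) (gmap_comp irG prG).
exact: (eq_tmap dG (gmap_id _) erefl dsum_decomp).
Qed.

Lemma tensor_dsum_acyclic_l j :
  acyclic_at (tensor P (dsum X Y)) j -> acyclic_at (tensor P X) j.
Proof.
have ilG := gmap_dsum_inl; have plG := gmap_dsum_prl; rewrite -{1}[j]addr0.
apply: retract_acyclic (tC ilG dsum_inl_diff) (tC plG (fun=> erefl)) (addr0 0) _ => t _.
rewrite (tmap_comp plG ilG) (eq_tmap (gmap_comp plG ilG) (gmap_id _)) //.
by rewrite tmap_id subrr; apply: coboundary0.
Qed.
End Sums.

(** * Maps out of semifree modules *)

Section Spans.
Variables (k : fieldType) (A : dga k).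
Implicit Types X Y : dglmod A.

Definition spanned X (I : choiceType) (e : I -> X) (Q : I -> Prop) (x : X) :=
  exists2 s : seq (A * I), (forall u, u \in s -> Q u.2) & x = \sum_(u <- s) u.1 *: e u.2.

Section Basics.
Variables (X : dglmod A) (I : choiceType) (e : I -> X).
Implicit Type Q : I -> Prop.

Lemma spanned0 Q : spanned e Q 0.
Proof. by exists [::]; rewrite ?big_nil. Qed.

Lemma spannedD Q x y : spanned e Q x -> spanned e Q y -> spanned e Q (x + y).
Proof.
move=> [s sQ ->] [t tQ ->]; exists (s ++ t); last by rewrite big_cat.
by move=> u; rewrite mem_cat => /orP[/sQ|/tQ].
Qed.

Lemma spannedZ Q a x : spanned e Q x -> spanned e Q (a *: x).
Proof.
move=> [s sQ ->]; exists [seq (a * u.1, u.2) | u <- s].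
  by move=> _ /mapP[u us ->]; apply: sQ us.
by rewrite big_map scaler_sumr; apply: eq_bigr => u _; rewrite scalerA.
Qed.

Lemma spannedN Q x : spanned e Q x -> spanned e Q (- x).
Proof. by rewrite -scaleN1r; apply: spannedZ. Qed.

Lemma spanned_basis Q i : Q i -> spanned e Q (e i).
Proof.
exists [:: (1, i)]; last by rewrite big_seq1 scale1r.
by move=> u; rewrite inE => /eqP ->.
Qed.

End Basics.

Lemma spanned_gmap n X Y (I J : choiceType) (e : I -> X) (e' : J -> Y) (f : X -> Y)
    (Q : I -> Prop) (Q' : J -> Prop) x : gmap n f ->
  (forall i, Q i -> spanned e' Q' (f (e i))) -> spanned e Q x -> spanned e' Q' (f x).
Proof.
move=> fG fe [s sQ ->]; rewrite (morphD_sum (gmap_add fG)).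
elim: s sQ => [|u s IHs] sQ; rewrite ?big_nil ?big_cons; first exact: spanned0.
apply: spannedD; last by apply: IHs => v vs; apply: sQ; rewrite inE vs orbT.
by rewrite (gmap_scale fG); apply/spannedZ/fe/sQ; rewrite inE eqxx.
Qed.

End Spans.

Section Basis.
Variables (k : fieldType) (A : dga k) (F : dglmod A).
Local Notation SA := (dga_str A).
Local Notation SF := (dgl_str F).
Variables (I : choiceType) (e : I -> F) (deg : I -> int).

Record hbasis : Prop := HBasis {
  hb_homog : forall i, homog SF (deg i) (e i);
  hb_span : forall x : F, exists s : seq (A * I), x = \sum_(u <- s) u.1 *: e u.2;
  hb_free : forall (s : seq I) (a : I -> A), uniq s ->
    \sum_(i <- s) a i *: e i = 0 -> forall i, i \in s -> a i = 0
}.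

Hypothesis eB : hbasis.
Local Notation L := {freeg I / A}.

Lemma comb_fD i : {morph (fun a : A => a *: e i) : a b / a + b}.
Proof. by move=> a b; rewrite scalerDl. Qed.

Definition comb : L -> F := fsum (fun i a => a *: e i).

Lemma combD : {morph comb : x y / x + y}.
Proof. exact: fsumD comb_fD. Qed.

Lemma combU a i : comb << a *g i >> = a *: e i.
Proof. exact: (fsumU comb_fD). Qed.

Lemma comb_inj : injective comb.
Proof.
move=> x y xy; apply/eqP; rewrite -subr_eq0; apply/eqP/fg_ext => i; rewrite coeff0.
have : comb (x - y) = 0 by rewrite combD (morphDN combD) xy subrr.
rewrite /comb /fsum => /(hb_free eB (uniq_dom _)) z0.
by have [/z0//|/coeff_outdom] := boolP (i \in dom (x - y)).
Qed.

Lemma comb_surj x : exists z, comb z = x.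
Proof.
have [s ->] := hb_span eB x; exists (\sum_(u <- s) << u.1 *g u.2 >>).
by rewrite (morphD_sum combD); apply: eq_bigr => u _; rewrite combU.
Qed.

Definition crd (x : F) : L := sval (cid (comb_surj x)).

Lemma crdK x : comb (crd x) = x.
Proof. by rewrite /crd; case: cid. Qed.

Lemma crd_comb z : crd (comb z) = z.
Proof. by apply: comb_inj; rewrite crdK. Qed.

Lemma crdD : {morph crd : x y / x + y}.
Proof. by move=> x y; apply: comb_inj; rewrite combD !crdK. Qed.

Lemma crdE a i : crd (a *: e i) = << a *g i >>.
Proof. by rewrite -combU crd_comb. Qed.

Lemma comb_sum x : x = \sum_(i <- dom (crd x)) coeff i (crd x) *: e i.
Proof. by rewrite -{1}(crdK x). Qed.

Lemma basis_ind (Q : F -> Prop) : Q 0 -> (forall x y, Q x -> Q y -> Q (x + y)) ->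
  (forall j a i, homog SA j a -> Q (a *: e i)) -> forall x, Q x.
Proof.
move=> Q0 QD Qe x; have [s ->] := hb_span eB x.
elim/big_rec: _ => // -[a i] y _ Qy; apply: (QD) => //=.
elim/(homog_ind (S := SA)): a => [|a b|j a]; last exact: Qe.
  by rewrite scale0r.
by rewrite scalerDl; apply: QD.
Qed.

Lemma crdZ a x : crd (a *: x) = a *: crd x.
Proof.
elim/basis_ind: x => [|x y xE yE|j b i _]; first by rewrite scaler0 (morphD0 crdD) scaler0.
  by rewrite scalerDr !crdD scalerDr xE yE.
by rewrite scalerA !crdE fgU_Z.
Qed.

Lemma crd_gpart j x i :
  coeff i (crd (gpart SF j x)) = gpart SA (j - deg i) (coeff i (crd x)).
Proof.
elim/basis_ind: x => [|x y xE yE|l b h bl].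
- by rewrite !(raddf0, morphD0 crdD).
- by rewrite raddfD !crdD !raddfD /= xE yE.
rewrite (gpart_homog _ (dgl_homogZ bl (hb_homog eB h))) crdE coeff_delta.
have [->|ih] := eqVneq h i.
  rewrite (gpart_homog _ bl); have -> : (j - deg i == l) = (j == l + deg i) by lia.
  by case: eqP => _; rewrite ?crdE ?coeff_delta ?eqxx // (morphD0 crdD) coeff0.
rewrite raddf0; case: eqP => _; last by rewrite (morphD0 crdD) coeff0.
by rewrite crdE coeff_delta (negbTE ih).
Qed.

Section Extension.
Variables (n : int) (Y : dglmod A) (c : I -> Y).
Local Notation SY := (dgl_str Y).

Lemma extend_fD i : {morph (fun a : A => twist SA n a *: c i) : a b / a + b}.
Proof. by move=> a b; rewrite raddfD scalerDl. Qed.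

Definition extend (x : F) : Y := fsum (fun i a => twist SA n a *: c i) (crd x).

Lemma extendE a i : extend (a *: e i) = twist SA n a *: c i.
Proof. by rewrite /extend crdE (fsumU extend_fD). Qed.

Lemma extendD : {morph extend : x y / x + y}.
Proof. by move=> x y; rewrite /extend crdD (fsumD extend_fD). Qed.

Lemma extend_basis i : extend (e i) = c i.
Proof. by rewrite -[e i]scale1r extendE twist1 scale1r. Qed.

Lemma gmap_extend : (forall i, homog SY (deg i + n) (c i)) -> gmap n extend.
Proof.
move=> cn; split=> [|a x|j x]; first exact: extendD.
  elim/basis_ind: x => [|x y xE yE|l b i _].
  - by rewrite scaler0 (morphD0 extendD) scaler0.
  - by rewrite scalerDr !extendD xE yE scalerDr.
  by rewrite scalerA !extendE twistM scalerA.
elim/basis_ind: x => [|x y xE yE|l b i bl].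
- by rewrite raddf0 (morphD0 extendD) raddf0.
- by rewrite raddfD !extendD xE yE raddfD.
rewrite (gpart_homog _ (dgl_homogZ bl (hb_homog eB i))) extendE.
rewrite (gpart_homog _ (dgl_homogZ (twist_homogeneous n bl) (cn i))).
have -> : (j + n == l + (deg i + n)) = (j == l + deg i) by lia.
by case: eqP => _; rewrite ?extendE // (morphD0 extendD).
Qed.
End Extension.

Lemma gmap_eq_basis n (Y : dglmod A) (f g : F -> Y) : gmap n f -> gmap n g ->
  (forall i, f (e i) = g (e i)) -> f =1 g.
Proof.
move=> fG gG fg x; rewrite (comb_sum x) (morphD_sum (gmap_add fG)).
rewrite (morphD_sum (gmap_add gG)); apply: eq_bigr => i _.
by rewrite (gmap_scale fG) (gmap_scale gG) fg.
Qed.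

Section NullHomotopy.
Variable rk : I -> nat.

(** The span of such a [J] is a DG submodule, on which a homotopy can be built by
    induction on the rank without looking at the other basis elements. *)
Definition closed_basis (J : I -> Prop) :=
  forall i, J i -> spanned e (fun j => (rk j < rk i)%N /\ J j) (diff SF (e i)).

Variables (J : I -> Prop) (C : dglmod A) (f : F -> C).
Local Notation SC := (dgl_str C).
Hypothesis J_closed : closed_basis J.
Hypothesis J_acyclic : forall i, J i -> acyclic_at C (deg i).
Hypothesis fG : gmap 0 f.
Hypothesis f_diff : forall x, f (diff SF x) = diff SC (f x).

(** The default value [0] is only taken where no suitable element exists, which does not
    happen on [J]; the values stay homogeneous in any case. *)
Definition nh_step (c : I -> C) (i : I) : C :=
  xget 0 [set y | homog SC (deg i - 1) y /\
    diff SC y = f (e i) - extend (- 1) c (diff SF (e i))]%classic.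

Fixpoint nh_iter (n : nat) : I -> C := fun i =>
  if n is m.+1 then if rk i == m then nh_step (nh_iter m) i else nh_iter m i else 0.

Definition nh_val (i : I) : C := nh_iter (rk i).+1 i.

Lemma nh_iterE n i : (rk i < n)%N -> nh_iter n i = nh_val i.
Proof.
elim: n => // n IHn; rewrite ltnS leq_eqVlt => /orP[/eqP <- //|i_n].
by rewrite /= ltn_eqF // IHn.
Qed.

Lemma nh_val_homog i : homog SC (deg i - 1) (nh_val i).
Proof.
rewrite /nh_val /= eqxx /nh_step; case: xgetP => [y _ []//|_].
exact: homog0.
Qed.

Let h := extend (- 1) nh_val.

Lemma gmap_nh : gmap (- 1) h.
Proof. exact: gmap_extend nh_val_homog. Qed.

Lemma nh_lower i x : spanned e (fun j => (rk j < rk i)%N /\ J j) x ->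
  extend (- 1) (nh_iter (rk i)) x = h x.
Proof.
move=> [s sJ ->]; rewrite /h !(morphD_sum (extendD _ _)); apply: eq_big_seq => u us.
by rewrite !extendE nh_iterE //; case: (sJ u us).
Qed.

(** On the span of [J], [f] is the boundary of [h]; the values of [h] are found
    by induction on the rank, [f (e i) - h (d (e i))] being a cocycle of
    degree [deg i] in [C]. *)
Lemma null_homotopy_basis i : J i -> f (e i) = diff SC (h (e i)) + h (diff SF (e i)).
Proof.
move: {2}(rk i).+1 (ltnSn (rk i)) => n; elim: n i => // n IHn i i_n Ji.
have dJ := J_closed Ji.
have hE x : spanned e (fun j => (rk j < rk i)%N /\ J j) x -> f x = diff SC (h x) + h (diff SF x).
  move=> [s sJ ->]; have hhG := gmap_homotopy gmap_nh.
  rewrite (morphD_sum (gmap_add fG)) [RHS](morphD_sum (gmap_add hhG)).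
  apply: eq_big_seq => u us; have [ui Ju] := sJ u us.
  rewrite (gmap_scale hhG) (gmap_scale fG) -IHn //.
  by rewrite ltnS in i_n; apply: leq_trans ui i_n.
have di := homog_diff (hb_homog eB i).
have zc : @cocycle C (deg i) (f (e i) - h (diff SF (e i))).
  split.
    apply: homogD; first by rewrite -[deg i]addr0; apply: (gmap_homog fG (hb_homog eB i)).
    by apply: homogN; have := gmap_homog gmap_nh di; rewrite addrK.
  rewrite /= raddfB /= -f_diff (hE _ dJ) diff_diff (morphD0 (gmap_add gmap_nh)).
  by rewrite addr0 subrr.
have [y yj yE] := J_acyclic Ji zc.
have -> : h (e i) = nh_val i by exact: extend_basis.
have -> : diff SC (nh_val i) = f (e i) - h (diff SF (e i)); last by rewrite subrK.
rewrite /nh_val /= eqxx /nh_step; case: xgetP => [z _ [_ ->]|/(_ y)[]].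
  by rewrite (nh_lower dJ).
by split; [exact: yj | rewrite (nh_lower dJ)].
Qed.

Lemma null_homotopy : exists2 h : F -> C, gmap (- 1) h &
  forall i, J i -> f (e i) = diff SC (h (e i)) + h (diff SF (e i)).
Proof. by exists h; [exact: gmap_nh | exact: null_homotopy_basis]. Qed.
End NullHomotopy.
End Basis.

Section Semifree.
Variables (k : fieldType) (A : dga k).
Implicit Types (F G X Y C : dglmod A) (P : dgrmod A).

(** When the target has no cohomology at all, every basis element is admissible in
    [null_homotopy], and the homotopy is defined on the whole module. *)
Lemma semifree_null F C (f : dghom F C) : semifree F -> (forall j, acyclic_at C j) ->
  exists2 h : F -> C, gmap (- 1) h &
    forall x, f x = diff (dgl_str C) (h x) + h (diff (dgl_str F) x).
Proof.
move=> [I [e [deg [rk [eh es ef ed]]]]] Cac.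
have eB : hbasis e deg by split.
have [|i _|x|h hG hE] := @null_homotopy _ _ _ _ _ _ eB rk (fun=> True) C f _ _ (gmap_dghom f).
- by move=> i _; have [s sr sE] := ed i; exists s => // u /sr.
- exact: Cac.
- exact: dgh_diff.
exists h => //; apply: (gmap_eq_basis eB (gmap_dghom f) (gmap_homotopy hG)) => i.
exact: hE.
Qed.

(** The composite of [f] with the inclusion of [Y] into [cone q] is null-homotopic, as
    [cone q] is acyclic. The two components of the homotopy are the lift [g] and
    the homotopy [h] between [f] and [q g]. *)
Lemma semifree_lift F X Y (q : dghom X Y) (f : dghom F Y) : semifree F -> quasi_iso q ->
  exists (g : dghom F X) (h : F -> Y), gmap (- 1) h /\
    forall x, f x - q (g x) = diff (dgl_str Y) (h x) + h (diff (dgl_str F) x).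
Proof.
move=> Fs qq; have inG := gmap_cone_in q; have outG := gmap_cone_out q.
have retG := gmap_cone_ret q.
have fiG := gmap_comp inG (gmap_dghom f).
have [fi fiE] := dghom_of_gmap fiG
  (fun x => etrans (congr1 _ (dgh_diff f x)) (esym (cone_in_diff q (f x)))).
have [j|h hG hE] := semifree_null fi Fs.
  exact: cone_acyclic_qis (cone_cone_data q) qq.
have {}hE x : cone_in q (f x) =
    diff (dgl_str (cone q)) (h x) + h (diff (dgl_str F) x) by rewrite -fiE hE.
have gG : gmap 0 (fun x => cone_out (h x)) := gmap_comp outG hG.
have [x|g gE] := dghom_of_gmap gG.
  have /(congr1 (@cone_out _ _ _ _ q)) := hE x.
  rewrite (gmap_add outG) => hx; apply/eqP.
  by rewrite cone_out_diff -addr_eq0 addrC -hx.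
exists g, (fun x => cone_ret (h x)); split; first exact: (gmap_comp retG hG).
move=> x; have /(congr1 (@cone_ret _ _ _ _ q)) := hE x.
rewrite (gmap_add retG) [LHS]/= => ->; rewrite gE cone_ret_diff -!addrA.
by do 2!congr (_ + _); apply: addrC.
Qed.

End Semifree.

(** * Semifree modules are closed under cones, suspensions and sums *)

Section HomogeneousBases.
Variables (k : fieldType) (A : dga k).
Implicit Types X : dglmod A.

Lemma semifreeP X : semifree X <-> exists (I : choiceType) (e : I -> X) (deg : I -> int)
    (rk : I -> nat), hbasis e deg /\
  forall i, spanned e (fun j => (rk j < rk i)%N) (diff (dgl_str X) (e i)).
Proof.
split=> [[I [e [deg [rk [eh es ef ed]]]]]|[I [e [deg [rk [[eh es ef] ed]]]]]].
  by exists I, e, deg, rk.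
by exists I, e, deg, rk.
Qed.

(** Applying [c i] to a linear relation isolates its [i]-th coefficient. The twist allows
    for suspensions and cones, whose scalar action carries signs. *)
Lemma hbasis_coords X (I : choiceType) (e : I -> X) deg (n : I -> int) (c : I -> X -> A) :
  (forall i, homog (dgl_str X) (deg i) (e i)) ->
  (forall x, spanned e (fun=> True) x) ->
  (forall i, {morph c i : x y / x + y}) ->
  (forall i a x, c i (a *: x) = twist (dga_str A) (n i) a * c i x) ->
  (forall i j, c i (e j) = if j == i then 1 else 0) -> hbasis e deg.
Proof.
move=> eh es cD cZ ce; split=> // [x|s a us s0 i iS]; first by have [s _] := es x; exists s.
have := congr1 (c i) s0; rewrite (morphD0 (cD i)) (morphD_sum (cD i)).
rewrite (bigD1_seq i) //= big1 => [|j /negbTE ji]; last by rewrite cZ ce ji mulr0.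
rewrite addr0 cZ ce eqxx mulr1 => /(congr1 (twist (dga_str A) (- n i))).
by rewrite twist_twist addNr twist0 raddf0.
Qed.
End HomogeneousBases.

Section SemifreeClosure.
Variables (k : fieldType) (A : dga k).
Implicit Types X Y : dglmod A.

Section Coordinates.
Variables (X : dglmod A) (I : choiceType) (e : I -> X) (deg : I -> int).
Hypothesis eB : hbasis e deg.

Definition coord i (x : X) : A := coeff i (crd eB x).

Lemma coordD i : {morph coord i : x y / x + y}.
Proof. by move=> x y; rewrite /coord crdD raddfD. Qed.

Lemma coordZ i a x : coord i (a *: x) = a * coord i x.
Proof. by rewrite /coord crdZ coeffZ. Qed.

Lemma coord_basis i j : coord i (e j) = if j == i then 1 else 0.
Proof. by rewrite /coord -[e j]scale1r crdE coeff_delta. Qed.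

Lemma coord_gpart i j x :
  coord i (gpart (dgl_str X) j x) = gpart (dga_str A) (j - deg i) (coord i x).
Proof. exact: crd_gpart. Qed.

Lemma coord_sum x (s : seq I) : uniq s -> {subset dom (crd eB x) <= s} ->
  x = \sum_(i <- s) coord i x *: e i.
Proof. by move=> us xs; rewrite -{1}(crdK eB x) /comb (fsum_sub (comb_fD e) us xs). Qed.

Lemma hb_spanned x : spanned e (fun=> True) x.
Proof. by have [s sE] := hb_span eB x; exists s. Qed.
End Coordinates.

Lemma regular_hbasis : hbasis (fun _ : unit => 1 : regular A) (fun=> 0).
Proof.
apply: (@hbasis_coords _ _ (regular A) unit (fun=> 1) (fun=> 0) (fun=> 0)
  (fun _ x => x)) => //.
- by move=> _; apply: dga_homog1.
- move=> x; have -> : x = x *: (1 : regular A) by exact: (esym (mulr1 (x : A))).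
  exact/spannedZ/(spanned_basis (fun _ : unit => 1 : regular A) (i := tt)).
by move=> _ a x; rewrite twist0.
Qed.

Lemma semifree_regular : semifree (regular A).
Proof.
apply/semifreeP; exists unit, (fun=> 1), (fun=> 0), (fun=> 0%N).
split; first exact: regular_hbasis.
by move=> i; rewrite dga_diff1; apply: spanned0.
Qed.

Lemma semifree_shift n X : semifree X -> semifree (shift n X).
Proof.
move=> /semifreeP[I [e [deg [rk [eB ed]]]]]; apply/semifreeP.
have inG := gmap_shift_in n X; have outG := gmap_shift_out n X.
exists I, (fun i => shift_in n (e i)), (fun i => deg i - n), rk; split.
  apply: (@hbasis_coords _ _ _ _ _ _ (fun=> n) (fun i x => coord eB i (shift_out x))).
  - by move=> i; apply: (gmap_homog inG (hb_homog eB i)).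
  - move=> x; have -> : x = shift_in n (shift_out x) by [].
    apply: (spanned_gmap inG) (hb_spanned eB _) => i _.
    exact: (spanned_basis (fun i => shift_in n (e i))).
  - by move=> i x y; apply: coordD.
  - by move=> i a x; rewrite (gmap_scale outG) coordZ.
  by move=> i j; apply: coord_basis.
move=> i; rewrite shift_in_diff /ksign.
have dS : spanned (fun i => shift_in n (e i)) (fun j => (rk j < rk i)%N)
    (shift_in n (diff (dgl_str X) (e i))).
  apply: (spanned_gmap inG) (ed i) => j ji.
  exact: (spanned_basis (fun i => shift_in n (e i))).
by case: ifP => // _; apply: spannedN.
Qed.

Lemma semifree_dsum X Y : semifree X -> semifree Y -> semifree (dsum X Y).
Proof.
move=> /semifreeP[I [e [deg [rk [eB ed]]]]] /semifreeP[J [e' [deg' [rk' [eB' ed']]]]].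
apply/semifreeP; have lG := gmap_dsum_inl X Y; have rG := gmap_dsum_inr X Y.
have plG := gmap_dsum_prl X Y; have prG := gmap_dsum_prr X Y.
pose E (i : I + J) : dsum X Y :=
  match i with inl i => dsum_inl Y (e i) | inr j => dsum_inr X (e' j) end.
pose D (i : I + J) := match i with inl i => deg i | inr j => deg' j end.
pose R (i : I + J) := match i with inl i => rk i | inr j => rk' j end.
pose c (i : I + J) (u : dsum X Y) := match i with
  inl i => coord eB i (dsum_prl u) | inr j => coord eB' j (dsum_prr u) end.
exists (I + J)%type, E, D, R; split.
  apply: (@hbasis_coords _ _ _ _ _ _ (fun=> 0) c).
  - case=> i; rewrite -[D _]addr0.
      exact: (gmap_homog lG (hb_homog eB i)).
    exact: (gmap_homog rG (hb_homog eB' i)).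
  - move=> x; rewrite -(dsum_decomp x); apply: spannedD.
      apply: (spanned_gmap lG) (hb_spanned eB _) => i _.
      exact: (@spanned_basis _ _ _ _ E _ (inl i)).
    apply: (spanned_gmap rG) (hb_spanned eB' _) => i _.
    exact: (@spanned_basis _ _ _ _ E _ (inr i)).
  - by case=> i x y; apply: coordD.
  - by case=> i a x; rewrite twist0; apply: coordZ.
  by case=> i [] j; rewrite /= ?coord_basis // (morphD0 (coordD _ _)).
case=> i.
  rewrite [X in spanned _ _ X](dsum_inl_diff Y (e i)).
  apply: (spanned_gmap lG) (ed i) => j ji.
  exact: (@spanned_basis _ _ _ _ E _ (inl j)).
rewrite [X in spanned _ _ X](dsum_inr_diff X (e' i)).
apply: (spanned_gmap rG) (ed' i) => j ji.
exact: (@spanned_basis _ _ _ _ E _ (inr j)).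
Qed.

Lemma mem_leq_sum (T : eqType) (r : seq T) (F : T -> nat) x :
  x \in r -> (F x <= \sum_(y <- r) F y)%N.
Proof. by move=> xr; rewrite (big_rem x xr) leq_addr. Qed.

(** By recursion along the old rank, each set [s i] being finite. In a cone
    this puts the basis elements of the source above those of the target. *)
Lemma raise_rank (I : eqType) (rk m : I -> nat) (s : I -> seq I) :
  (forall i j, j \in s i -> (rk j < rk i)%N) ->
  exists rk' : I -> nat, forall i, (m i < rk' i)%N /\
    forall j, j \in s i -> (rk' j < rk' i)%N.
Proof.
move=> sr; pose fix R (n : nat) (i : I) {struct n} : nat :=
  if n is l.+1 then (m i + \sum_(j <- s i) R l j).+1 else 0%N.
have R_mono i : {homo R^~ i : l n / (l <= n)%N}.
  apply: homo_leq => // [l n p|n]; first exact: leq_trans.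
  elim: n i => // n IHn i; rewrite [X in (_ <= X)%N]/= ltnS leq_add2l.
  by apply: leq_sum => j _; apply: IHn.
exists (fun i => R (rk i).+1 i) => i; split=> [|j ji]; first by rewrite ltnS leq_addr.
rewrite [X in (_ < X)%N]/= ltnS; apply: leq_trans (leq_addl _ _).
apply: leq_trans (R_mono _ _ _ (sr _ _ ji)) _.
exact: (mem_leq_sum (R (rk i))).
Qed.

(** The basis elements coming from [X] must get a rank above those of the basis
    elements of [Y] that occur in their image under [f]. *)
Lemma semifree_cone X Y (f : dghom X Y) : semifree X -> semifree Y -> semifree (cone f).
Proof.
move=> /semifreeP[I [e [deg [rk [eB ed]]]]] /semifreeP[J [e' [deg' [rk' [eB' ed']]]]].
apply/semifreeP; have inG := gmap_cone_in f; have secG := gmap_cone_sec f.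
have outG := gmap_cone_out f; have retG := gmap_cone_ret f.
have ex_s i : exists s : seq (A * I), (forall u, u \in s -> (rk u.2 < rk i)%N) /\
    diff (dgl_str X) (e i) = \sum_(u <- s) u.1 *: e u.2.
  by have [s] := ed i; exists s.
pose s i := sval (cid (ex_s i)).
pose t i := sval (cid (hb_span eB' (f (e i)))).
have tE i : f (e i) = \sum_(u <- t i) u.1 *: e' u.2 by rewrite /t; case: cid.
have sE i : diff (dgl_str X) (e i) = \sum_(u <- s i) u.1 *: e u.2.
  by rewrite /s; case: cid => z [].
have sr i u : u \in s i -> (rk u.2 < rk i)%N.
  by rewrite /s; case: cid => z [+ _] /=; apply.
pose m i := (\sum_(u <- t i) rk' u.2)%N.
have [i j /mapP[u us ->]|R Rm] := @raise_rank I rk m (fun i => [seq u.2 | u <- s i]).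
  exact: sr us.
pose E (i : J + I) : cone f :=
  match i with inl j => cone_in f (e' j) | inr i => cone_sec f (e i) end.
pose D (i : J + I) := match i with inl j => deg' j | inr i => deg i - 1 end.
pose K (i : J + I) := match i with inl j => rk' j | inr i => R i end.
pose n (i : J + I) : int := match i with inl _ => 0 | inr _ => 1 end.
pose c (i : J + I) (u : cone f) := match i with
  inl j => coord eB' j (cone_ret u) | inr i => coord eB i (cone_out u) end.
exists (J + I)%type, E, D, K; split.
  apply: (@hbasis_coords _ _ _ _ _ _ n c).
  - case=> i; last exact: (gmap_homog secG (hb_homog eB i)).
    by rewrite -[D _]addr0; apply: (gmap_homog inG (hb_homog eB' i)).
  - move=> x; rewrite -(cone_decomp x); apply: spannedD.
      apply: (spanned_gmap inG) (hb_spanned eB' _) => i _.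
      exact: (@spanned_basis _ _ _ _ E _ (inl i)).
    apply: (spanned_gmap secG) (hb_spanned eB _) => i _.
    exact: (@spanned_basis _ _ _ _ E _ (inr i)).
  - by case=> i x y; apply: coordD.
  - by case=> i a x; rewrite /= ?twist0 -coordZ.
  by case=> i [] j; rewrite /= ?coord_basis // (morphD0 (coordD _ _)).
case=> i.
  rewrite [X in spanned _ _ X](cone_in_diff f (e' i)).
  apply: (spanned_gmap inG) (ed' i) => j ji.
  exact: (@spanned_basis _ _ _ _ E _ (inl j)).
rewrite [X in spanned _ _ X](cone_sec_diff f (e i)).
apply: spannedD; last apply: spannedN.
  have : spanned e' (fun j => (rk' j < K (inr i))%N) (f (e i)).
    exists (t i) => // u ut; have [mi _] := Rm i; apply: leq_ltn_trans mi.
    exact: (mem_leq_sum (fun u => rk' u.2)).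
  apply: (spanned_gmap inG) => j ji; exact: (@spanned_basis _ _ _ _ E _ (inl j)).
have : spanned e (fun j => (K (inr j) < K (inr i))%N) (diff (dgl_str X) (e i)).
  by exists (s i) => // u us; have [_ Ri] := Rm i; apply/Ri/map_f.
apply: (spanned_gmap secG) => j ji; exact: (@spanned_basis _ _ _ _ E _ (inr j)).
Qed.
End SemifreeClosure.

Section Lifting.
Variables (k : fieldType) (A : dga k).
Implicit Types (F G X Y Z M : dglmod A) (P : dgrmod A).

Lemma dghom_comp X Y Z (g : dghom Y Z) (f : dghom X Y) :
  exists h : dghom X Z, h =1 (fun x => g (f x)).
Proof.
apply: dghom_of_gmap (gmap_comp (gmap_dghom g) (gmap_dghom f)) _ => x.
by rewrite !dgh_diff.
Qed.

Lemma dghom_id X : exists f : dghom X X, f =1 id.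
Proof. exact: dghom_of_gmap (gmap_id X) (fun=> erefl). Qed.

Lemma quasi_iso_comp X Y Z (g : dghom Y Z) (f : dghom X Y) (h : dghom X Z) :
  h =1 (fun x => g (f x)) -> quasi_iso f -> quasi_iso g -> quasi_iso h.
Proof.
move=> hE fq gq j; have [fi fs] := fq j; have [gi gs] := gq j; split.
  move=> x xc; rewrite hE => hb; apply: fi => //; apply: gi => //.
  exact: chain_map0_cocycle (chain_dghom f) xc.
move=> z /gs[y yc zy]; have [x xc yx] := fs _ yc; exists x => //.
rewrite hE -(subrK (g y) z) -addrA -[g y - _](raddfB g).
by apply: coboundaryD => //; apply: (chain_map0_coboundary (chain_dghom g)).
Qed.

Lemma homotopic_quasi_iso X Y Z (q : dghom Y Z) (f : dghom X Z) (g : dghom X Y) h :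
  gmap (- 1) h ->
  (forall x, f x - q (g x) = diff (dgl_str Z) (h x) + h (diff (dgl_str X) x)) ->
  quasi_iso q -> quasi_iso f -> quasi_iso g.
Proof.
move=> hG hE qq fq j; have [qi _] := qq j; have [fi fs] := fq j; split.
  move=> x xc gb; apply: fi => //.
  apply: (coboundary_sub (homotopic_coboundary hG hE xc)).
  exact: (chain_map0_coboundary (chain_dghom q)).
move=> y yc; have [x xc yx] := fs _ (chain_map0_cocycle (chain_dghom q) yc).
exists x => //; apply: qi.
  by apply: cocycleB => //; apply: (chain_map0_cocycle (chain_dghom g)).
rewrite raddfB /= -(subrK (f x) (q y)) -addrA; apply: coboundaryD => //.
exact: homotopic_coboundary hG hE xc.
Qed.

(** An acyclic semifree module is contractible, and [P (x) -] preserves the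
    contraction. *)
Lemma tensor_semifree_acyclic P F : semifree F -> (forall j, acyclic_at F j) ->
  forall j, acyclic_at (tensor P F) j.
Proof.
move=> Fs Fac j t tc; have [i iE] := dghom_id F.
have [h hG hE] := semifree_null i Fs Fac.
have zG : gmap 0 (fun _ : F => 0 : F).
  by split=> [x y|a x|n x]; rewrite ?addr0 // ?scaler0 // raddf0.
have := tmap_homotopic (gmap_id F) zG hG _ tc; rewrite tmap_id.
have -> : tmap 0 (fun _ : F => 0 : F) t = 0.
  by move: t {tc}; apply: tensor_ext (tmapD zG) _ _ => [x y|a b p x _ _];
    rewrite ?addr0 // (tmapE zG) tens0.
by rewrite subr0; apply=> x; rewrite subr0 -hE iE.
Qed.

(** Two semifree resolutions are comparable up to homotopy: lift [F -> M] to a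
    quasi-isomorphism [F -> G], and lift the identity of [G] along it to a homotopy right
    inverse, through which every class of [P (x) G] comes from [P (x) F]. *)
Lemma tensor_resolution P F G M (q : dghom F M) (r : dghom G M) j :
  semifree F -> semifree G -> quasi_iso q -> quasi_iso r ->
  acyclic_at (tensor P F) j -> acyclic_at (tensor P G) j.
Proof.
move=> Fs Gs qq rq Fj t tc.
have [g [h [hG hE]]] := semifree_lift q Fs rq.
have gq := homotopic_quasi_iso hG hE rq qq.
have [i iE] := dghom_id G; have [u [h' [hG' hE']]] := semifree_lift i Gs gq.
have uG := gmap_dghom u; have gG := gmap_dghom g.
have := tmap_homotopic (gmap_id G) (gmap_comp gG uG) hG' _ tc.
rewrite tmap_id -(tmap_comp gG uG) => tE.
apply: (@coboundary_sub _ _ _ (tmap 0 g (tmap 0 u t))).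
  by apply: tE => x; rewrite -hE' iE.
apply: (chain_map0_coboundary (tmap_dghom P g)); apply: Fj.
exact: (chain_map0_cocycle (tmap_dghom P u)).
Qed.
End Lifting.

(** * Free modules and their tensor products *)

Section FreeModule.
Variables (k : fieldType) (A : dga k) (I : choiceType) (n : int).
Local Notation SA := (dga_str A).
Local Notation L := {freeg I / A}.

Section Coefficientwise.
Variable f : A -> A.
Hypothesis fD : {morph f : x y / x + y}.

Definition coeffwise (x : L) : L := fsum (fun i a => << f a *g i >>) x.

Lemma coeffwise_fD i : {morph (fun a => << f a *g i >> : L) : x y / x + y}.
Proof. by move=> x y; rewrite fD fgU_D. Qed.

Lemma coeffwiseD : {morph coeffwise : x y / x + y}.
Proof. exact: fsumD coeffwise_fD. Qed.

Lemma coeff_coeffwise i x : coeff i (coeffwise x) = f (coeff i x).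
Proof.
elim/fg_ind: x => [|x y xE yE|a j]; first by rewrite (morphD0 coeffwiseD) coeff0 (morphD0 fD).
  by rewrite coeffwiseD !raddfD /= xE yE fD.
rewrite /coeffwise (fsumU coeffwise_fD) !coeff_delta.
by case: eqP => // _; rewrite (morphD0 fD).
Qed.
End Coefficientwise.

Definition free_gpart (j : int) : L -> L := coeffwise (gpart SA (j - n)).
Definition free_diff : L -> L := coeffwise (diff SA).

Lemma coeff_gpart i j x : coeff i (free_gpart j x) = gpart SA (j - n) (coeff i x).
Proof. exact: coeff_coeffwise (gpart_additive SA _) _ _. Qed.

Lemma coeff_diff i x : coeff i (free_diff x) = diff SA (coeff i x).
Proof. exact: coeff_coeffwise (diff_additive SA) _ _. Qed.

Lemma free_gpartD j : {morph free_gpart j : x y / x + y}.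
Proof. exact: coeffwiseD (gpart_additive SA _). Qed.

Lemma free_gpart_gpart i j x :
  free_gpart i (free_gpart j x) = if i == j then free_gpart j x else 0.
Proof.
apply: fg_ext => l; rewrite !coeff_gpart gpart_gpart (inj_eq (addIr _)).
by case: eqP => _; rewrite ?coeff_gpart ?coeff0.
Qed.

Lemma free_gpart_fin x :
  exists2 s : seq int, uniq s & x = \sum_(j <- s) free_gpart j x.
Proof.
have gD := free_gpartD; have gg := free_gpart_gpart.
elim/fg_ind: x => [|x y xE yE|b g]; [exact: gfin0 | exact: gfinD |].
elim/(homog_ind (S := SA)): b => [|x y xE yE|j a aj].
- by rewrite freegU0; exact: gfin0.
- by rewrite fgU_D; exact: gfinD.
apply: (@gfin_homog _ _ (j + n)); apply: fg_ext => l.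
by rewrite coeff_gpart addrK coeff_delta; case: eqP => _; rewrite ?aj ?raddf0.
Qed.

Lemma free_diffD : {morph free_diff : x y / x + y}.
Proof. exact: coeffwiseD (diff_additive SA). Qed.

Lemma free_diff_gpart j x : free_diff (free_gpart j x) = free_gpart (j + 1) (free_diff x).
Proof. by apply: fg_ext => l; rewrite !(coeff_diff, coeff_gpart) diff_gpart addrAC. Qed.

Lemma free_diff_diff x : free_diff (free_diff x) = 0.
Proof. by apply: fg_ext => l; rewrite !coeff_diff diff_diff coeff0. Qed.

Definition free_str : dgstr L :=
  DGStr free_gpartD free_gpart_gpart free_gpart_fin free_diffD
    free_diff_gpart free_diff_diff.

Lemma free_homogZ i j (a : A) (x : L) :
  homog SA i a -> homog free_str j x -> homog free_str (i + j) (a *: x).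
Proof.
move=> ai xj; apply: fg_ext => l; rewrite /= coeff_gpart coeffZ -addrA.
by apply: (dga_homogM ai); rewrite /homog -coeff_gpart [free_gpart _ _]xj.
Qed.

Lemma free_leibniz i (a : A) (x : L) : homog SA i a ->
  free_diff (a *: x) = diff SA a *: x + ksign i (a *: free_diff x).
Proof.
move=> ai; apply: fg_ext => l; rewrite coeff_diff coeffZ raddfD /= coeffZ.
rewrite (dga_leibniz _ ai) /ksign.
by case: ifP => _; rewrite ?raddfN /= coeffZ coeff_diff.
Qed.

Definition free_mod : dglmod A := DGLmod free_homogZ free_leibniz.

Definition free_gen (i : I) : free_mod := << 1 *g i >> : L.

Lemma free_gen_diff i : diff (dgl_str free_mod) (free_gen i) = 0.
Proof.
apply: fg_ext => l; rewrite /= coeff_diff coeff_delta coeff0.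
by case: eqP => _; rewrite ?dga_diff1 ?raddf0.
Qed.

Lemma free_hbasis : hbasis free_gen (fun=> n).
Proof.
apply: (@hbasis_coords _ _ free_mod I free_gen (fun=> n) (fun=> 0)
  (fun i (x : L) => coeff i x)).
- move=> i; apply: fg_ext => l; rewrite /= coeff_gpart coeff_delta subrr.
  by case: eqP => _; rewrite ?(dga_homog1 A) ?raddf0.
- elim/fg_ind => [|x y xE yE|a i]; [exact: spanned0 | exact: spannedD |].
  have -> : << a *g i >> = a *: (<< 1 *g i >> : L) by rewrite fgU_Z mulr1.
  by apply: spannedZ; apply: (spanned_basis free_gen).
- by move=> i x y; apply: raddfD.
- by move=> i a x; rewrite twist0; apply: coeffZ.
by move=> i j; apply: coeff_delta.
Qed.

Lemma semifree_free : semifree free_mod.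
Proof.
apply/semifreeP; exists I, free_gen, (fun=> n), (fun=> 0%N).
by split; [exact: free_hbasis | move=> i; rewrite free_gen_diff; apply: spanned0].
Qed.
End FreeModule.

Section TensorFree.
Variables (k : fieldType) (A : dga k) (P : dgrmod A).
Variables (E : dglmod A) (I : choiceType) (e : I -> E) (n : int).
Hypothesis eB : hbasis e (fun=> n).
Hypothesis e_diff : forall i, diff (dgl_str E) (e i) = 0.
Local Notation SP := (dgr_str P).

(** Tensor coordinates commute with the differentials without a sign, whereas morphisms of
    degree [m] carry one; the twist makes up for it. *)
Lemma chain_map_twist m (B C : complex) (f : B -> C) : {morph f : x y / x + y} ->
  (forall j x, f (gpart B j x) = gpart C (j + m) (f x)) ->
  (forall x, diff C (f x) = f (diff B x)) -> chain_map m (fun x => twist C m (f x)).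
Proof.
move=> fD fg fd; split=> [x y|j x|x]; first by rewrite fD raddfD.
  by rewrite fg twist_gpart.
by rewrite twist_diff fd.
Qed.

Lemma coord_diff i x : coord eB i (diff (dgl_str E) x) = diff (dga_str A) (coord eB i x).
Proof.
elim/(basis_ind eB): x => [|x y xE yE|j a l _].
- by rewrite raddf0 !(morphD0 (coordD _ _)) raddf0.
- by rewrite raddfD !coordD raddfD /= xE yE.
rewrite dgl_leibnizT e_diff scaler0 addr0 !coordZ coord_basis.
by case: eqP => _; rewrite ?mulr1 // !mulr0 raddf0.
Qed.

Definition tcoord (i : I) : tensor P E -> P :=
  tensor_lift (fun p x => (coord eB i x : A^c) *: p).

Section TCoord.
Variable i : I.

Let bDl p q x : (coord eB i x : A^c) *: (p + q : P) =
  (coord eB i x : A^c) *: p + (coord eB i x : A^c) *: q.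
Proof. exact: scalerDr. Qed.
Let bDr (p : P) x y : (coord eB i (x + y) : A^c) *: p =
  (coord eB i x : A^c) *: p + (coord eB i y : A^c) *: p.
Proof. by rewrite coordD (scalerDl p (coord eB i x : A^c)). Qed.
Let bZ (a : A) (p : P) x : (coord eB i x : A^c) *: ((a : A^c) *: p) =
  (coord eB i (a *: x) : A^c) *: p.
Proof. by rewrite scalerA coordZ. Qed.

Lemma tcoordE p x : tcoord i (tens p x) = (coord eB i x : A^c) *: p.
Proof. exact: (tensor_liftE bDl bDr bZ). Qed.

Lemma tcoordD : {morph tcoord i : x y / x + y}.
Proof. exact: (tensor_liftD bDl bDr bZ). Qed.
End TCoord.

Lemma tcoord_gpart i j t :
  tcoord i (gpart (tensor P E) j t) = gpart SP (j - n) (tcoord i t).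
Proof.
move: t; apply: tensor_ext => [x y|x y|a b p x pa xb].
- by rewrite raddfD tcoordD.
- by rewrite tcoordD raddfD.
rewrite /= (tensor_gpartE _ pa xb) tcoordE.
have cb : homog (dga_str A) (b - n) (coord eB i x).
  by rewrite /homog -(coord_gpart eB) xb.
rewrite (gpart_homog _ (dgr_homogZ pa cb)).
have -> : (j - n == a + (b - n)) = (j == a + b) by lia.
by case: eqP => _; rewrite ?tcoordE // (morphD0 (tcoordD i)).
Qed.

Lemma tcoord_diff i t : diff SP (tcoord i t) = tcoord i (diff (tensor P E) t).
Proof.
move: t; apply: tensor_ext => [x y|x y|a b p x _ _].
- by rewrite tcoordD raddfD.
- by rewrite raddfD tcoordD.
rewrite tcoordE /= tensor_diffE (tcoordD i) !tcoordE coord_diff.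
by rewrite dgr_leibnizT.
Qed.

Lemma tens_gen_gpart i j p :
  tens (gpart SP j p) (e i) = gpart (tensor P E) (j + n) (tens p (e i)).
Proof.
elim/(homog_ind (S := SP)): p => [|x y xE yE|l p pl].
- by rewrite raddf0 ten0s raddf0.
- by rewrite raddfD !tensDl raddfD /= xE yE.
rewrite (gpart_homog _ pl) [RHS](tensor_gpartE _ pl (hb_homog eB i)).
by rewrite (inj_eq (addIr n)); case: eqP => _; rewrite ?ten0s.
Qed.

Lemma tens_gen_diff i p :
  diff (tensor P E) (tens p (e i)) = tens (diff SP p) (e i).
Proof. by rewrite [LHS]tensor_diffE e_diff tens0 addr0. Qed.

Lemma chain_tcoord i : @chain_map (- n) (tensor P E) P
  (fun t => twist SP (- n) (tcoord i t)).
Proof.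
exact: (@chain_map_twist (- n) (tensor P E) P _ (tcoordD i) (tcoord_gpart i)
  (tcoord_diff i)).
Qed.

Lemma chain_tens_gen i : @chain_map n P (tensor P E)
  (fun p => twist (tensor P E) n (tens p (e i))).
Proof.
exact: (@chain_map_twist n P (tensor P E) _ (fun p q => tensDl p q (e i))
  (tens_gen_gpart i) (tens_gen_diff i)).
Qed.

Lemma tens_gen_twist i m p :
  twist (tensor P E) m (tens p (e i)) = ksign (m * n) (tens (twist SP m p) (e i)).
Proof.
elim/(homog_ind (S := SP)): p => [|x y xE yE|l p pl].
- by rewrite !(raddf0, ten0s).
- by rewrite !(raddfD, tensDl) /= xE yE.
rewrite (twist_homog _ pl) tens_ksignl ksignK -mulrDr addrC.
by apply: twist_homog; rewrite /homog [LHS](tensor_gpartE _ pl (hb_homog eB i)) eqxx.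
Qed.

(** Through the coordinates and the generators, [P (x) E] becomes a direct sum of copies of
    the complex [P] shifted by [n]. *)
Lemma tensor_free_sum t : exists s : seq I,
  t = \sum_(i <- s) tens (tcoord i t) (e i).
Proof.
suff [s sE] : exists s : seq I, forall r, uniq r -> {subset s <= r} ->
    t = \sum_(i <- r) tens (tcoord i t) (e i).
  by exists (undup s); apply: sE; [exact: undup_uniq | move=> i; rewrite mem_undup].
elim/tens_ind: t => [|x y [s sE] [r rE]|x [s sE]|a b p x _ _].
- exists [::] => r _ _; rewrite big1 // => i _.
  by rewrite (morphD0 (tcoordD i)) ten0s.
- exists (s ++ r) => q uq sq.
  have xE : x = \sum_(i <- q) tens (tcoord i x) (e i).
    by apply: sE => // i i_s; apply: sq; rewrite mem_cat i_s.
  have yE : y = \sum_(i <- q) tens (tcoord i y) (e i).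
    by apply: rE => // i ir; apply: sq; rewrite mem_cat ir orbT.
  rewrite {1}xE {1}yE -big_split; apply: eq_bigr => i _.
  by rewrite tcoordD tensDl.
- exists s => r ur sr; rewrite {1}(sE r) // -sumrN; apply: eq_bigr => i _.
  by rewrite (morphDN (tcoordD i)) (morphDN (fun p q => tensDl p q (e i))).
exists (dom (crd eB x)) => r ur xr; rewrite {1}(coord_sum ur xr).
rewrite (morphD_sum (tensDr p)); apply: eq_bigr => i _.
by rewrite tcoordE tensZ.
Qed.

Lemma tensor_free_acyclic j : acyclic_at P (j - n) -> acyclic_at (tensor P E) j.
Proof.
move=> Pj t tc; have [s ->] := tensor_free_sum t.
elim/big_rec: _ => [|i x _ xb]; first exact: coboundary0.
apply: coboundaryD => //; have := Pj _ (chain_cocycle (chain_tcoord i) tc).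
move/(chain_coboundary (chain_tens_gen i)); rewrite subrK tens_gen_twist.
rewrite twist_twist subrr twist0 => /(coboundary_ksign (n * n)).
by rewrite ksign_inv.
Qed.

Lemma tensor_free_inhabited j : inhabited I -> acyclic_at (tensor P E) j ->
  acyclic_at P (j - n).
Proof.
case=> i; rewrite -{1}(subrK n j) => Ej p pc.
have := chain_coboundary (chain_tcoord i) (Ej _ (chain_cocycle (chain_tens_gen i) pc)).
rewrite addrK tens_gen_twist (ksign_mor _ _ (tcoordD i)) tcoordE coord_basis eqxx.
rewrite scale1r (ksign_mor _ _ (twistD SP _)) twist_twist addNr twist0.
by move/(coboundary_ksign (n * n)); rewrite ksign_inv.
Qed.
End TensorFree.

(** * Killing the lowest cohomology of a module *)

Section ScalarAction.
Variables (k : fieldType) (A : dga k) (X : dglmod A).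

Lemma homog_scalar (c : k) : homog (dga_str A) 0 c%:A.
Proof. by rewrite /homog dga_gpartZ (dga_homog1 A). Qed.

Lemma homogZk j (c : k) x : homog (dgl_str X) j x -> homog (dgl_str X) j (c%:A *: x).
Proof. by move=> xj; rewrite -[j]add0r; apply: dgl_homogZ (homog_scalar c) xj. Qed.

Lemma diffZk (c : k) x :
  diff (dgl_str X) (c%:A *: x) = c%:A *: diff (dgl_str X) x.
Proof.
rewrite (dgl_leibniz _ (homog_scalar c)) dga_diffZ dga_diff1 scaler0 scale0r add0r.
by rewrite /ksign.
Qed.

Lemma coboundaryZk j (c : k) x : @coboundary X j x -> @coboundary X j (c%:A *: x).
Proof. by move=> [y yj <-]; exists (c%:A *: y); [exact: homogZk | exact: diffZk]. Qed.
End ScalarAction.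

Lemma bigcup_chain_seq (T : eqType) (F : set (set T)) (s : seq T) : total_on F subset ->
  (forall x, x \in s -> (\bigcup_(S in F) S)%classic x) ->
  s = [::] \/ exists2 S, F S & forall x, x \in s -> S x.
Proof.
move=> Ftot; elim: s => [|x s IHs] sF; first by left.
right; have [S FS Sx] := sF x (mem_head x s).
have [y ys|->|[S' FS' sS']] := IHs _; first by apply: sF; rewrite inE ys orbT.
  by exists S => // y; rewrite inE => /eqP ->.
have [SS'|S'S] := Ftot _ _ FS FS'.
  by exists S' => // y; rewrite inE => /orP[/eqP ->|/sS' //]; apply: SS'.
by exists S => // y; rewrite inE => /orP[/eqP -> //|/sS' /S'S].
Qed.

Section CohomologyBasis.
Variables (k : fieldType) (A : dga k) (X : dglmod A) (i : int).

Definition kcomb (c : X -> k) (s : seq X) : X := \sum_(x <- s) (c x)%:A *: x.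

Definition coh_free (S : set X) := (forall x, S x -> @cocycle X i x) /\
  forall (s : seq X) (c : X -> k), uniq s -> (forall x, x \in s -> S x) ->
    @coboundary X i (kcomb c s) -> forall x, x \in s -> c x = 0.

(** As [H^i(X)] need not be finite-dimensional, the basis is a maximal set of
    cocycles with linearly independent classes. *)
Lemma coh_basis : exists2 S : set X, coh_free S &
  forall z, @cocycle X i z -> exists (s : seq X) (c : X -> k),
    [/\ uniq s, forall x, x \in s -> S x & @coboundary X i (z - kcomb c s)].
Proof.
have [F FS Ftot|S [[Sc Sf] Smax]] := @Zorn_bigcup X coh_free.
  split=> [x [T FT Tx]|s c us sF sb]; first by have [Tc _] := FS T FT; apply: Tc.
  have [-> //|[T FT sT]] := bigcup_chain_seq Ftot sF.
  by have [_ Tf] := FS T FT; apply: Tf.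
exists S => // z zc; have [Sz|nSz] := pselect (S z).
  exists [:: z], (fun=> 1); split=> // [x|]; first by rewrite inE => /eqP ->.
  by rewrite /kcomb big_seq1 scale1r scale1r subrr; apply: coboundary0.
apply: contrapT => nz; apply: (Smax (S `|` [set z])%classic).
  split; first by left.
  by move/(_ z (or_intror erefl)).
split=> [x [/Sc//|->//]|s c us sS sb x xs].
have [zs|zs] := boolP (z \in s); last first.
  apply: (Sf s c us _ sb x xs) => y ys; have [//|yz] := sS y ys.
  by rewrite -yz ys in zs.
have sE : kcomb c s = (c z)%:A *: z + kcomb c (rem z s) by rewrite /kcomb (big_rem z zs).
have remS y : y \in rem z s -> S y.
  rewrite mem_rem_uniq // => /andP[/= yz ys]; have [//|yz'] := sS y ys.
  by rewrite yz' eqxx in yz.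
have urem := rem_uniq z us.
have cz : c z = 0.
  apply/eqP; apply: contrapT => /negP cz; apply: nz.
  exists (rem z s), (fun x => - ((c z)^-1 * c x)); split=> //.
  have := coboundaryZk (c z)^-1 sb; rewrite sE scalerDr scalerA -scalerAl mul1r.
  rewrite scalerA mulVf // scale1r scale1r /kcomb scaler_sumr -sumrN.
  congr (coboundary _ (_ + _)); apply: eq_bigr => y _.
  by rewrite scalerA -scalerAl mul1r scalerA scaleNr scaleNr opprK.
have [->//|xz] := eqVneq x z.
apply: (Sf (rem z s) c urem remS _ x); last by rewrite mem_rem_uniq // inE xz.
by rewrite sE cz !scale0r add0r in sb.
Qed.
End CohomologyBasis.

Section Killing.
Variables (k : fieldType) (R : dga k) (hR : simply_connected R).
Implicit Types (F X : dglmod R) (P : dgrmod R).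

Section FreeLow.
Variables (I : choiceType) (n : int).
Local Notation E := (free_mod R I n).

Lemma free_low j (x : E) : homog (dgl_str E) j x -> j < n \/ j = n + 1 -> x = 0.
Proof.
move=> xj jn; apply: fg_ext => l; rewrite coeff0.
have xl : homog (dga_str R) (j - n) (coeff l x).
  by rewrite /homog -coeff_gpart; congr (coeff l _); exact: xj.
case: jn => [jn|jE]; first by apply: (sc_neg hR _ xl); lia.
by apply: (sc_one hR); rewrite jE addrC addKr in xl.
Qed.

Lemma free_scalar (x : E) : homog (dgl_str E) n x -> forall l,
  exists c : k, coeff l (x : {freeg I / R}) = c%:A.
Proof.
move=> xn l; apply: (sc_zero hR); rewrite -(subrr n) /homog -coeff_gpart.
by congr (coeff l _); exact: xn.
Qed.
End FreeLow.

(** The generators of the free module represent a basis of [H^i(X)]. As [R^0 = k], its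
    component of degree [i] is their [k]-span and maps isomorphically onto
    [H^i(X)]; as [R^1 = 0], its component of degree [i + 1] vanishes, so that taking
    the cone removes [H^i] and creates nothing in degrees up to [i]. *)
Lemma kill_lowest X i : acyclic_below X i ->
  exists (I : choiceType) (f : dghom (free_mod R I i) X),
    acyclic_below (cone f) (i + 1) /\ (~ acyclic_at X i -> inhabited I).
Proof.
move=> Xi; have [S [Sc Sf] Sspan] := coh_basis X i.
pose I : choiceType := {x : X | `[< S x >]}.
have IS (b : I) : S (val b) by apply/asboolP; exact: (valP b).
have eB := free_hbasis R I i; pose e := free_gen R i : I -> free_mod R I i.
have fG : gmap 0 (extend eB 0 val).
  by apply: gmap_extend => b; rewrite addr0; have [] := Sc _ (IS b).
have [x|f fE] := dghom_of_gmap fG.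
  elim/(basis_ind eB): x => [|x y xE yE|j a b _].
  - by rewrite !(raddf0, morphD0 (gmap_add fG)).
  - by rewrite !(raddfD, gmap_add fG) /= xE yE.
  rewrite dgl_leibnizT free_gen_diff scaler0 addr0 !extendE !twist0 dgl_leibnizT.
  by have [_ ->] := Sc _ (IS b); rewrite scaler0 addr0.
have fe a b : f (a *: e b) = a *: val b by rewrite fE extendE twist0.
exists I, f; split; last first.
  move=> nX; apply: contrapT => nI; apply: nX => z zc.
  have [s [c [_ sS zs]]] := Sspan z zc.
  case: s sS zs => [_|x s sS _].
    by rewrite /kcomb big_nil subr0.
  case: nI; constructor; exists x; apply/asboolP; apply: sS; exact: mem_head.
have cD := cone_cone_data f.
have low j c : @cocycle (cone f) j c -> j < i ->
    @coboundary (free_mod R I i) (j + 1) (cone_out c) -> @coboundary (cone f) j c.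
  move=> cc ji /(cone_exact_C cD cc)[b bc cb]; apply: (coboundary_sub cb).
  by apply: (chain_map0_coboundary (cone_iota cD)); apply: Xi bc.
move=> j ji c cc; have oc := cone_pr_cocycle cD cc.
have [|ji'] := ltP j (i - 1).
  move=> ji'; apply: (low j c cc); first by lia.
  rewrite (free_low oc.1) ?coboundary0 //; first exact: coboundary0.
  by left; lia.
have [jE|jE] : j = i - 1 \/ j = i by lia.
  apply: (low j c cc); first by lia.
  have cj : homog (dgl_str (free_mod R I i)) i (cone_out c).
    by have [] := oc; rewrite jE subrK.
  suff -> : cone_out c = 0 by exact: coboundary0.
  pose x : {freeg I / R} := cone_out c; pose s := dom x.
  have cb : @coboundary X i (f (cone_out c)).
    by have := cone_f_pr cD cc; rewrite jE subrK.
  (* The coefficients of [cone_out c] are scalars, extended by 0 to all of X. *)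
  pose cf (z : X) : k := if insub z is Some b then sval (cid (free_scalar cj b)) else 0.
  have cfE b : coeff b x = (cf (val b))%:A.
    by rewrite /cf valK; case: cid.
  have sE : f (cone_out c) = kcomb cf [seq val b | b <- s].
    rewrite /kcomb big_map -{1}[cone_out c]/(x : free_mod R I i) -{1}(freeg_sumE x).
    rewrite raddf_sum; apply: eq_bigr => b _; rewrite -cfE -fe.
    by congr (f _); rewrite fgU_Z mulr1.
  rewrite sE in cb; apply: fg_ext => b; rewrite coeff0.
  have [bs|/coeff_outdom //] := boolP (b \in s).
  have us : uniq [seq val b | b <- s] by rewrite (map_inj_uniq val_inj) uniq_dom.
  have sS z : z \in [seq val b | b <- s] -> S z by move=> /mapP[a _ ->].
  by rewrite [LHS]cfE (Sf _ cf us sS cb) ?scale0r // map_f.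
have o0 : cone_out c = 0 by apply: (free_low oc.1); right; rewrite jE.
have [|b bc cb] := cone_exact_C cD cc; first by rewrite o0; exact: coboundary0.
apply: (coboundary_sub cb); rewrite jE in bc *.
have [s [cf [us sS bs]]] := Sspan b bc.
have [y yc yE] : exists2 y : free_mod R I i, @cocycle (free_mod R I i) i y &
    f y = kcomb cf s.
  exists (\sum_(z <- s) if insub z is Some b then (cf z)%:A *: e b else 0).
    elim/big_rec: _ => [|z y _ yc]; first exact: cocycle0.
    apply: cocycleD => //; case: insub => [a|]; last exact: cocycle0.
    split; first by apply: homogZk; exact: (hb_homog eB a).
    by apply: etrans (diffZk _ _) _; rewrite free_gen_diff scaler0.
  rewrite raddf_sum /kcomb; apply: eq_big_seq => z zs.
  have Sz : `[< S z >] by apply/asboolP/sS.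
  by rewrite (insubT (fun z => `[< S z >]) Sz); apply: fe.
rewrite -yE in bs; apply: (@coboundary_sub _ _ _ (cone_in f (f y))).
  rewrite -(morphDN (chain_add (cone_iota cD))) -(chain_add (cone_iota cD)).
  exact: (chain_map0_coboundary (cone_iota cD)).
exact: (cone_iota_f cD yc).
Qed.
End Killing.

(** * Amplitude of the tensor product with a semifree module *)

Section BoundedSupport.
Variables (k : fieldType) (A : dga k).
Implicit Types (F C : dglmod A) (P : dgrmod A).

(** The boundary of a basis element involves finitely many others, all of smaller rank, so
    finitely many basis elements lie in a finite set closed under this
    dependency. *)
Lemma bounded_closed_basis F (I : choiceType) (e : I -> F) (deg : I -> int)
    (rk : I -> nat) (s : seq I) :
  (forall i, spanned e (fun j => (rk j < rk i)%N) (diff (dgl_str F) (e i))) ->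
  exists (J : I -> Prop) (D : int), [/\ closed_basis e rk J,
    forall i, i \in s -> J i & forall i, J i -> deg i <= D].
Proof.
move=> ed.
have seqP (Q : I -> Prop) (r : seq I) : (forall i, i \in r -> Q i) ->
    (forall i, Q i -> exists (J : I -> Prop) (D : int), [/\ closed_basis e rk J,
      J i & forall j, J j -> deg j <= D]) ->
    exists (J : I -> Prop) (D : int), [/\ closed_basis e rk J,
      forall i, i \in r -> J i & forall i, J i -> deg i <= D].
  move=> + QJ; elim: r => [|i r IHr] rQ; first by exists (fun=> False), 0; split.
  have [J [D [Jc Ji JD]]] := QJ i (rQ i (mem_head i r)).
  have [j jr|J' [D' [Jc' Jr JD']]] := IHr _; first by apply: rQ; rewrite inE jr orbT.
  exists (fun j => J j \/ J' j), (Num.max D D'); split=> [j [Jj|Jj]|j|j [/JD|/JD']].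
  - by have [t tJ ->] := Jc j Jj; exists t => // u /tJ[]; split=> //; left.
  - by have [t tJ ->] := Jc' j Jj; exists t => // u /tJ[]; split=> //; right.
  - by rewrite inE => /orP[/eqP ->|/Jr]; [left | right].
  - by rewrite le_max => ->.
  by rewrite le_max => ->; rewrite orbT.
apply: (seqP (fun=> True)) => // i _.
move: {2}(rk i).+1 (ltnSn (rk i)) => n; elim: n i => // n IHn i i_n.
have [t tr tE] := ed i.
have [j /mapP[u /tr ui ->]|j ji|J [D [Jc Jt JD]]] :=
  seqP (fun j => (rk j < rk i)%N) [seq u.2 | u <- t].
- exact: ui.
- by apply: IHn; rewrite ltnS in i_n; apply: leq_trans ji i_n.
exists (fun j => j = i \/ J j), (Num.max (deg i) D); split=> [j [->|Jj]||j [->|/JD jD]].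
- exists t => // u ut; split; first exact: tr.
  by right; apply/Jt/map_f.
- by have [r rJ ->] := Jc j Jj; exists r => // u /rJ[]; split=> //; right.
- by left.
- by rewrite le_max lexx.
by rewrite le_max jD orbT.
Qed.

(** An element of [P (x) F] involves finitely many basis elements of [F], and these
    lie in a DG submodule generated in degrees at most some [D]; a map from [F]
    to a module without cohomology up to degree [D] is null-homotopic
    there. *)
Lemma tensor_null_bounded P F (t : tensor P F) : semifree F ->
  exists D : int, forall C (f : dghom F C), (forall j, j <= D -> acyclic_at C j) ->
    forall j, cocycle j t -> coboundary j (tmap 0 f t).
Proof.
move=> /semifreeP[I [e [deg [rk [eB ed]]]]].
have [s ->] : exists s : seq (P * I), t = \sum_(u <- s) tens u.1 (e u.2).
  elim/tens_ind: t => [|x y [s ->] [r ->]|x [s ->]|i j p x _ _].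
  - by exists [::]; rewrite big_nil.
  - by exists (s ++ r); rewrite big_cat.
  - exists [seq (- u.1, u.2) | u <- s]; rewrite big_map -sumrN.
    by apply: eq_bigr => u _; rewrite (morphDN (fun p q => tensDl p q (e u.2))).
  have [s ->] := hb_span eB x; exists [seq ((u.1 : A^c) *: p, u.2) | u <- s].
  by rewrite (morphD_sum (tensDr p)) big_map; apply: eq_bigr => u _; rewrite tensZ.
have [J [D [Jc Js JD]]] := bounded_closed_basis deg [seq u.2 | u <- s] ed.
exists D => C f CD j; set x := \sum_(u <- s) _ => xc.
have [i Ji|x0|h hG hE] := @null_homotopy _ _ _ _ _ _ eB rk J C f Jc _ (gmap_dghom f).
- exact/CD/JD.
- exact: dgh_diff.
have hhG := gmap_homotopy hG.
have -> : tmap 0 f x =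
    tmap 0 (fun y => diff (dgl_str C) (h y) + h (diff (dgl_str F) y)) x.
  rewrite /x (morphD_sum (tmapD (gmap_dghom f))) (morphD_sum (tmapD hhG)).
  apply: eq_big_seq => u us; rewrite (tmapE (gmap_dghom f)) (tmapE hhG) hE //.
  exact/Js/map_f.
rewrite (tmap_homotopy hG) xc.2 (morphD0 (tmapD hG)) addr0.
exists (tmap (- 1) h x) => //.
by rewrite /homog -(tmap_gpart hG) xc.1.
Qed.
End BoundedSupport.

Section Amplitude.
Variables (k : fieldType) (R : dga k) (hR : simply_connected R).
Implicit Types (F G : dglmod R) (P : dgrmod R).

(** The three clauses are the exact sequence of the triangle [P (x) E -> P (x) F ->
    P (x) G], in which [E] is free on generators of degree [i] and [P (x) E] therefore has
    the cohomology of copies of [P] shifted by [i]. The last one holds because [E] is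
    nonzero when [H^i(F)] is. *)
Lemma peel F i : semifree F -> acyclic_below F i ->
  exists G (f : dghom F G), [/\ semifree G, acyclic_below G (i + 1) &
  forall P j, [/\
    acyclic_at P (j - i) -> forall t, cocycle j t ->
      coboundary j (tmap (P := P) 0 f t) -> coboundary j t,
    acyclic_at P (j + 1 - i) -> acyclic_at (tensor P F) j -> acyclic_at (tensor P G) j &
    ~ acyclic_at F i -> acyclic_at (tensor P G) (j - 1) -> acyclic_at (tensor P F) j ->
      acyclic_at P (j - i)]].
Proof.
move=> Fs Fi; have [I [q [Gi Iinh]]] := kill_lowest hR Fi.
have inG := gmap_cone_in q; have [f fE] := dghom_of_gmap inG (fun x => esym (cone_in_diff q x)).
have eB := free_hbasis R I i; have ed := @free_gen_diff _ R I i.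
exists (cone q), f; split=> //; first exact: semifree_cone (semifree_free R I i) Fs.
move=> P j; have cD := tensor_cone_data q P; split.
- move=> Pj t tc; rewrite (eq_tmap (gmap_dghom f) inG erefl fE).
  move=> /(cone_exact_B cD tc)[a ac ta]; apply: (coboundary_sub ta).
  apply: (chain_map0_coboundary (cone_f cD)).
  exact: (tensor_free_acyclic eB ed Pj).
- move=> Pj Fj; apply: (cone_acyclic cD Fj).
  exact: (tensor_free_acyclic eB ed Pj).
move=> nF Gj Fj; apply: (tensor_free_inhabited eB ed (Iinh nF)).
by rewrite -(subrK 1 j) in Fj *; apply: (cone_acyclic_A cD).
Qed.

Lemma peel_iter n F i : semifree F -> acyclic_below F i ->
  exists G (f : dghom F G), [/\ semifree G, acyclic_below G (i + n%:Z) &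
  forall P j, (forall m, i <= m -> acyclic_at P (j - m)) -> forall t, cocycle j t ->
    coboundary j (tmap (P := P) 0 f t) -> coboundary j t].
Proof.
move=> Fs Fi; elim: n => [|n [G [f [Gs Gi fP]]]].
  have [f fE] := dghom_id F; exists F, f; split=> //; first by rewrite addr0.
  by move=> P j _ t _; rewrite (eq_tmap (gmap_dghom f) (gmap_id F) erefl fE) tmap_id.
have [H [g [Hs Hi gP]]] := peel Gs Gi; have [h hE] := dghom_comp g f.
exists H, h; split=> // [|P j Pj t tc].
  by have -> : i + n.+1%:Z = i + n%:Z + 1 by lia.
have fG := gmap_dghom f; have gG := gmap_dghom g.
rewrite (eq_tmap (gmap_dghom h) (gmap_comp gG fG) erefl hE) -(tmap_comp gG fG) => hb.
apply: (fP P j Pj t tc); have [gi _ _] := gP P j; apply: gi hb.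
  by apply: Pj; lia.
exact: (chain_map0_cocycle (tmap_dghom P f)).
Qed.

(** Killing the cohomology of [F] degree by degree loses no cohomology of
    [P (x) F] in degrees below [a + i], while every given cocycle eventually
    becomes a coboundary. *)
Lemma tensor_acyclic_below P F a i : semifree F -> acyclic_below P a ->
  acyclic_below F i -> acyclic_below (tensor P F) (a + i).
Proof.
move=> Fs Pa Fi j ja t tc; have [D tD] := tensor_null_bounded t Fs.
have [G [f [Gs Gi fP]]] := peel_iter (absz (D - i)).+1 Fs Fi.
apply: (fP P j _ t tc) => [m im|]; first by apply: Pa; lia.
by apply: tD => // l lD; apply: Gi; lia.
Qed.

(** By the vanishing for the peeled module, [H^a] of the copies of [P] in
    [P (x) E] injects into [H^(a + i)(P (x) F)]. *)
Lemma tensor_lowest P F a i : semifree F -> acyclic_below P a -> acyclic_below F i ->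
  ~ acyclic_at P a -> ~ acyclic_at F i -> ~ acyclic_at (tensor P F) (a + i).
Proof.
move=> Fs Pa Fi nP nF Ta; apply: nP.
have [G [f [Gs Gi fP]]] := peel Fs Fi; have [_ _] := fP P (a + i).
rewrite addrK; apply=> //; apply: (tensor_acyclic_below Gs Pa Gi); lia.
Qed.

Local Notation res := (residue hR).

Lemma residue_acyclic j : j != 0 -> acyclic_at res j.
Proof.
move=> j0 x [xj _]; have -> : x = 0; last exact: coboundary0.
by rewrite -xj /= /residue_gpart (negbTE j0).
Qed.

Lemma residue_nonacyclic : ~ acyclic_at res 0.
Proof.
move=> /(_ (1 : k)) [|y _ /esym/eqP]; first by [].
by apply/negP; exact: oner_neq0.
Qed.

Lemma residue_below : acyclic_below res 0.
Proof. by move=> j j0; apply: residue_acyclic; rewrite lt_eqF. Qed.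

(** Nakayama's lemma: [k (x) F] detects the lowest cohomology of [F]. *)
Lemma residue_tensor_lowest F i : semifree F -> acyclic_below F i ->
  acyclic_at (tensor res F) i -> acyclic_at F i.
Proof.
move=> Fs Fi Ti; apply: contrapT => nF.
have := tensor_lowest Fs residue_below Fi residue_nonacyclic nF.
by rewrite add0r; apply.
Qed.

Lemma residue_tensor_acyclic F i : semifree F -> acyclic_below F i ->
  (forall j, i <= j -> acyclic_at (tensor res F) j) -> forall j, acyclic_at F j.
Proof.
move=> Fs Fi Ti; apply: (acyclic_from_below Fi) => j Fj.
have [ij|ji] := leP i j; first by apply: residue_tensor_lowest => //; apply: Ti.
by apply: Fi.
Qed.

(** In the triangle for [P = k] the free part only lives in degree [i]. *)
Lemma peel_residue_above F G i p :
  (forall j, acyclic_at res (j + 1 - i) -> acyclic_at (tensor res F) j ->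
    acyclic_at (tensor res G) j) ->
  i <= p -> acyclic_above (tensor res F) p -> acyclic_above (tensor res G) p.
Proof.
move=> fP ip Fp j pj; apply: fP (Fp j pj).
by apply: residue_acyclic; lia.
Qed.

(** Induction on the number of degrees in which [k (x) F] may have cohomology: the module
    taken off in one step contributes to [P (x) F] only up to degree [s + i], and
    [i <= p]. If no degree is left, [F] is acyclic by Nakayama's lemma, hence
    contractible. *)
Lemma tensor_acyclic_above P F s p i : semifree F -> acyclic_below F i ->
  acyclic_above P s -> acyclic_above (tensor res F) p ->
  acyclic_above (tensor P F) (s + p).
Proof.
move=> + + Ps.
have : p < i + (absz (p - i)).+1%:Z by lia.
move: (absz (p - i)).+1 => m; elim: m F i => [|n IHn] F i pin Fs Fi Fp.
  have Fac : forall j, acyclic_at F j.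
    by apply: residue_tensor_acyclic Fi _ => // j ij; apply: Fp; lia.
  by move=> j _; apply: tensor_semifree_acyclic.
have [pi|ip] := ltP p i; first by apply: IHn Fs Fi Fp; lia.
have [G [f [Gs Gi fP]]] := peel Fs Fi.
have Gp : acyclic_above (tensor res G) p.
  by apply: (peel_residue_above _ ip Fp) => j; have [] := fP res j.
have PG : acyclic_above (tensor P G) (s + p) by apply: IHn Gs Gi Gp; lia.
move=> j sj t tc; have [fj _ _] := fP P j; apply: fj => //.
  by apply: Ps; lia.
by apply: PG => //; apply: (chain_map0_cocycle (tmap_dghom P f)).
Qed.

(** The top cohomology survives the peeling until [k (x) F] is concentrated in the single
    degree [p]; then [F] is free on generators of degree [p] up to homotopy. *)
Lemma tensor_highest P F s p i : semifree F -> acyclic_below F i ->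
  acyclic_above P s -> acyclic_above (tensor res F) p ->
  ~ acyclic_at P s -> ~ acyclic_at (tensor res F) p ->
  ~ acyclic_at (tensor P F) (s + p).
Proof.
move=> + + Ps + nP.
have : p < i + (absz (p - i)).+1%:Z by lia.
move: (absz (p - i)).+1 => m; elim: m F i => [|n IHn] F i pin Fs Fi Fp nF.
  case: nF; rewrite -[p]add0r in pin *.
  by apply: tensor_acyclic_below Fs residue_below Fi _ _; lia.
have [pi|ip] := ltP p i; first by apply: IHn Fs Fi Fp nF; lia.
have [G [f [Gs Gi fP]]] := peel Fs Fi.
have Gp : acyclic_above (tensor res G) p.
  by apply: (peel_residue_above _ ip Fp) => j; have [] := fP res j.
move=> Tp; have [pi|pi] := eqVneq p i.
  have Gac : forall j, acyclic_at G j.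
    by apply: residue_tensor_acyclic Gi _ => // j ij; apply: Gp; lia.
  have [_ _ lowest] := fP P (s + p); apply: nP.
  have -> : s = s + p - i by lia.
  apply: lowest Tp; last exact: tensor_semifree_acyclic.
  move=> Fac; apply: nF; rewrite -[p]add0r.
  apply: (tensor_acyclic_below (i := i + 1)) Fs residue_below _ _ _; last by lia.
  move=> j ji; have [|ij] := ltP j i; first exact: Fi.
  by have -> : j = i by lia.
apply: (IHn G (i + 1)) => //; first by lia.
  move=> GTp; apply: nF => t tc; have [fj _ _] := fP res p; apply: fj => //.
    by apply: residue_acyclic; lia.
  by apply: GTp; apply: (chain_map0_cocycle (tmap_dghom _ f)).
have [_ fT _] := fP P (s + p); apply: fT Tp.
by apply: Ps; lia.
Qed.

End Amplitude.

(** * Resolutions of compact modules *)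

Section FiveLemma.
Variables (A B C A' B' C' : complex) (f : A -> B) (f' : A' -> B').
Variables (iota : B -> C) (kappa : A -> C) (pr : C -> A) (rho : C -> B).
Variables (iota' : B' -> C') (kappa' : A' -> C') (pr' : C' -> A') (rho' : C' -> B').
Hypothesis cD : cone_data f iota kappa pr rho.
Hypothesis cD' : cone_data f' iota' kappa' pr' rho'.
Variables (a : A -> A') (b : B -> B') (c : C -> C').
Hypotheses (bC : chain_map 0 b) (cC : chain_map 0 c).
Hypothesis c_iota : forall y, c (iota y) = iota' (b y).
Hypothesis pr_c : forall z, pr' (c z) = a (pr z).
Hypothesis f_a : forall j x, cocycle j x -> coboundary j (f' (a x) - b (f x)).

(** The five lemma for the long exact sequences of the two cones. *)
Lemma cone_qis : qis a -> qis b -> qis c.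
Proof.
move=> aq bq j; have ioC := cone_iota cD; have ioC' := cone_iota cD'.
have fC := cone_f cD; have fC' := cone_f cD'; have prC' := cone_pr cD'; split.
  move=> z zc zb; have prz : coboundary (j + 1) (pr z).
    apply: (aq _).1; first exact: (cone_pr_cocycle cD zc).
    by rewrite -pr_c; apply: (chain_coboundary prC' zb).
  have [y yc zy] := cone_exact_C cD zc prz; apply: (coboundary_sub zy).
  have iby : coboundary j (iota' (b y)).
    have := coboundaryB zb (chain_map0_coboundary cC zy).
    rewrite (chain_add cC) (morphDN (chain_add cC)) c_iota opprB addrC.
    by rewrite -addrA addNr addr0.
  have byc := chain_map0_cocycle bC yc.
  have [x' xc' byx'] := cone_exact_B cD' byc iby.
  have [x xc x'x] := (aq _).2 _ xc'.
  have yfx : coboundary j (y - f x).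
    apply: (bq _).1; first exact: (cocycleB yc (chain_map0_cocycle fC xc)).
    rewrite (chain_add bC) (morphDN (chain_add bC)).
    rewrite -(subrK (f' x') (b y)) -addrA; apply: coboundaryD => //.
    rewrite -(subrK (f' (a x)) (f' x')) -addrA; apply: coboundaryD; last exact: f_a.
    rewrite -(morphDN (chain_add fC')) -(chain_add fC').
    exact: chain_map0_coboundary.
  apply: (@coboundary_sub _ _ _ (iota (f x))); last exact: (cone_iota_f cD xc).
  rewrite -(morphDN (chain_add ioC)) -(chain_add ioC).
  exact: chain_map0_coboundary.
move=> z zc; have [x xc zx] := (aq _).2 _ (cone_pr_cocycle cD' zc).
have fxb : coboundary (j + 1) (f x).
  apply: (bq _).1; first exact: (chain_map0_cocycle fC xc).
  have := coboundaryB (coboundaryB (cone_f_pr cD' zc)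
    (chain_map0_coboundary fC' zx)) (f_a xc).
  by rewrite (chain_add fC') (morphDN (chain_add fC')) !subKr.
have [w wc wx] := cone_exact_A cD xc fxb.
have cwc := chain_map0_cocycle cC wc.
have [|y' yc' zwy'] := cone_exact_C cD' (cocycleB zc cwc).
  by rewrite (chain_add prC') (morphDN (chain_add prC')) pr_c wx.
have [y yc y'y] := (bq _).2 _ yc'.
exists (w + iota y); first exact: (cocycleD wc (chain_map0_cocycle ioC yc)).
rewrite (chain_add cC) c_iota opprD addrA.
rewrite -(subrK (iota' y') (z - c w)) -addrA; apply: coboundaryD => //.
rewrite -(morphDN (chain_add ioC')) -(chain_add ioC').
exact: chain_map0_coboundary.
Qed.
End FiveLemma.

Section ConeResolution.
Variables (k : fieldType) (A : dga k).
Implicit Types X Y F G : dglmod A.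

(** The map of cones induced by a square that commutes up to the homotopy [h] has [- h] as
    the component from the suspension of [F] to [Y]. *)
Lemma cone_resolution X Y F G (f : dghom X Y) (p : dghom F X) (r : dghom G Y)
    (g : dghom F G) (h : F -> Y) : gmap (- 1) h ->
  (forall x, f (p x) - r (g x) = diff (dgl_str Y) (h x) + h (diff (dgl_str F) x)) ->
  quasi_iso p -> quasi_iso r -> exists t : dghom (cone g) (cone f), quasi_iso t.
Proof.
move=> hG hE pq rq; have pG := gmap_dghom p; have rG := gmap_dghom r.
have inG := gmap_cone_in f; have secG := gmap_cone_sec f.
have outG := gmap_cone_out g; have retG := gmap_cone_ret g.
have tG : gmap 0 (fun c => cone_in f (r (cone_ret c)) + cone_sec f (p (@cone_out _ _ _ _ g c))
    + - cone_in f (h (cone_out c))).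
  apply: gmap_addf (gmap_addf _ _) (gmap_oppf _).
  - exact: (gmap_comp inG (gmap_comp rG retG)).
  - exact: (gmap_comp secG (gmap_comp pG outG)).
  exact: (gmap_comp inG (gmap_comp hG outG)).
have [c|t tE] := dghom_of_gmap tG.
  cbv beta; rewrite !(diff_additive (dgl_str (cone f))).
  rewrite (morphDN (diff_additive (dgl_str (cone f)))) !cone_in_diff cone_sec_diff.
  rewrite -!dgh_diff cone_ret_diff cone_out_diff.
  have hx := hE (cone_out c); rewrite cone_out_diff (morphDN (gmap_add hG)) in hx.
  rewrite (raddfB r) (raddfN p) (morphDN (gmap_add secG)) opprK.
  have -> : diff (dgl_str Y) (h (cone_out c)) = f (p (cone_out c)) - r (g (cone_out c))
      + h (cone_out (diff (dgl_str (cone g)) c)) by rewrite hx subrK.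
  rewrite !(gmap_add inG) !(morphDN (gmap_add inG)) [in RHS]opprD [in RHS]opprB.
  rewrite [in RHS]addrA; congr (_ - _); rewrite [in RHS](addrACA (cone_in f _)).
  rewrite [X in _ = _ + X]addrC [RHS]addrACA addrK; congr (_ + _).
  by rewrite addrAC addNr add0r.
exists t; apply: (cone_qis (cone_cone_data g) (cone_cone_data f)
  (a := p) (chain_dghom r) (chain_dghom t)) => //.
- move=> y; rewrite tE; have -> : cone_out (cone_in g y) = 0 by [].
  rewrite (raddf0 p) (morphD0 (gmap_add hG)) (morphD0 (gmap_add secG)).
  by rewrite (morphD0 (gmap_add inG)) subr0 addr0.
- move=> y; rewrite tE.
  rewrite [LHS](_ : _ = 0 + p (cone_out y) - 0) //.
  by rewrite add0r subr0.
move=> j x xc; exact: (homotopic_coboundary hG hE xc).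
Qed.

End ConeResolution.

Section ResolutionClosure.
Variables (k : fieldType) (A : dga k).
Implicit Types X Y F G : dglmod A.

Lemma shift_resolution n X F (q : dghom F X) : quasi_iso q ->
  exists t : dghom (shift n F) (shift n X), quasi_iso t.
Proof.
move=> qq; have qG := gmap_dghom q.
have oC := chain_shift_out n F; have iC := chain_shift_in n F.
have oC' := chain_shift_out n X; have iC' := chain_shift_in n X.
have tG : gmap 0 (fun x => shift_in n (q (@shift_out _ _ n F x))).
  have := gmap_comp (gmap_shift_in n X) (gmap_comp qG (gmap_shift_out n F)).
  by rewrite addr0 subrr.
have [x|t tE] := dghom_of_gmap tG.
  rewrite /shift_in /shift_out /= /shift_diff (ksign_mor _ _ (raddfD q)).
  by rewrite -dgh_diff.
exists t => j; have [qi qs] := qq (j + n); split.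
  move=> x xc; rewrite tE => /(chain_coboundary oC').
  move=> /(qi _ (chain_cocycle oC xc))/(chain_coboundary iC).
  by rewrite addrK.
move=> y yc; have [x xc yx] := qs _ (chain_cocycle oC' yc).
exists (shift_in n x); first by have := chain_cocycle iC xc; rewrite addrK.
by rewrite tE; have := chain_coboundary iC' yx; rewrite addrK.
Qed.

Lemma dsum_resolution X Y F G (q : dghom F X) (r : dghom G Y) :
  quasi_iso q -> quasi_iso r ->
  exists t : dghom (dsum F G) (dsum X Y), quasi_iso t.
Proof.
move=> qq rq; have qG := gmap_dghom q; have rG := gmap_dghom r.
have tG : gmap 0 (fun u : dsum F G => dsum_inl Y (q (dsum_prl u)) +
    dsum_inr X (r (dsum_prr u))).
  apply: gmap_addf.
    exact: (gmap_comp (gmap_dsum_inl X Y) (gmap_comp qG (gmap_dsum_prl F G))).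
  exact: (gmap_comp (gmap_dsum_inr X Y) (gmap_comp rG (gmap_dsum_prr F G))).
have [x|t tE] := dghom_of_gmap tG.
  cbv beta; rewrite (diff_additive (dgl_str (dsum X Y))).
  by rewrite dsum_inl_diff dsum_inr_diff -!dgh_diff.
have lC := chain_dsum_inl F G; have rC := chain_dsum_inr F G.
have plC := chain_dsum_prl F G; have prC := chain_dsum_prr F G.
have plC' := chain_dsum_prl X Y; have prC' := chain_dsum_prr X Y.
have plt u : dsum_prl (t u) = q (dsum_prl u) by rewrite tE; apply: addr0.
have prt u : dsum_prr (t u) = r (dsum_prr u) by rewrite tE; apply: add0r.
exists t => j; split.
  move=> u uc ub; rewrite -(dsum_decomp u); apply: coboundaryD.
    apply: (chain_map0_coboundary lC); apply: (qq _).1.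
      exact: (chain_map0_cocycle plC).
    by rewrite -plt; apply: (chain_map0_coboundary plC').
  apply: (chain_map0_coboundary rC); apply: (rq _).1.
    exact: (chain_map0_cocycle prC).
  by rewrite -prt; apply: (chain_map0_coboundary prC').
move=> u uc; have [x xc ux] := (qq _).2 _ (chain_map0_cocycle plC' uc).
have [y yc uy] := (rq _).2 _ (chain_map0_cocycle prC' uc).
exists (dsum_inl G x + dsum_inr F y).
  by apply: cocycleD; [apply: (chain_map0_cocycle lC) | apply: (chain_map0_cocycle rC)].
rewrite -(dsum_decomp (u - _)); apply: coboundaryD.
  apply: (chain_map0_coboundary (chain_dsum_inl X Y)).
  rewrite (gmap_add (gmap_dsum_prl X Y)) (morphDN (gmap_add (gmap_dsum_prl X Y))) plt.
  by rewrite (gmap_add (gmap_dsum_prl F G)) [dsum_prl (dsum_inr _ _)]/= addr0.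
apply: (chain_map0_coboundary (chain_dsum_inr X Y)).
rewrite (gmap_add (gmap_dsum_prr X Y)) (morphDN (gmap_add (gmap_dsum_prr X Y))) prt.
by rewrite (gmap_add (gmap_dsum_prr F G)) [dsum_prr (dsum_inl _ _)]/= add0r.
Qed.
End ResolutionClosure.

Section Compact.
Variables (k : fieldType) (R : dga k) (hR : simply_connected R).
Implicit Types M X Y F : dglmod R.
Local Notation res := (residue hR).

Lemma derived_iso_acyclic X Y : derived_iso X Y ->
  forall j, acyclic_at X j <-> acyclic_at Y j.
Proof.
elim=> {X Y} [X Y f fq j|X Y _ IH j|X Y Z _ XY _ YZ j].
- exact: (qis_acyclic j (chain_dghom f) fq).
- by split=> /IH.
by split=> [/XY/YZ|/YZ/XY].
Qed.

Lemma compact_below M : compact_dg M -> exists i, acyclic_below M i.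
Proof.
elim=> {M} [|X Y XY _ [i Xi]|n X _ [i Xi]|X Y f _ [i Xi] _ [j Yj]
  |X Y _ [i Xi] _ [j Yj]|X Y _ [i Xi]].
- exists 0 => j j0 x [xj _]; rewrite (sc_neg hR j0 xj); exact: coboundary0.
- by exists i => j ji; apply/(derived_iso_acyclic XY)/Xi.
- by exists (i - n) => j ji; apply: shift_acyclic; apply: Xi; lia.
- exists (Num.min (i - 1) j) => l; rewrite lt_min => /andP[li lj].
  by apply: (cone_acyclic (cone_cone_data f)); [exact: Yj | apply: Xi; lia].
- exists (Num.min i j) => l; rewrite lt_min => /andP[li lj].
  by apply: dsum_acyclic; [exact: Xi | exact: Yj].
by exists i => j ji; apply: dsum_acyclic_l; apply: Xi.
Qed.

(** Stated with one resolution, so that it can be carried through the construction of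
    compact modules; [bounded_resolution] transfers it to all. *)
Definition has_bounded_resolution M := exists F (q : dghom F M) (p : int),
  [/\ semifree F, quasi_iso q & acyclic_above (tensor res F) p].

Lemma bounded_resolution M F (q : dghom F M) : has_bounded_resolution M ->
  semifree F -> quasi_iso q -> exists p, acyclic_above (tensor res F) p.
Proof.
move=> [G [r [p [Gs rq Gp]]]] Fs qq; exists p => j pj.
exact: tensor_resolution Gs Fs rq qq (Gp j pj).
Qed.

Lemma derived_iso_bounded X Y : derived_iso X Y ->
  has_bounded_resolution X <-> has_bounded_resolution Y.
Proof.
elim=> {X Y} [X Y f fq|X Y _ [XY YX]|X Y Z _ [XY YX] _ [YZ ZY]]; last 2 first.
- by split.
- by split=> [/XY/YZ|/ZY/YX].
split=> [] [F [q [p [Fs qq Fp]]]].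
  have [r rE] := dghom_comp f q; exists F, r, p; split=> //.
  exact: quasi_iso_comp rE qq fq.
have [g [h [hG hE]]] := semifree_lift q Fs fq; exists F, g, p; split=> //.
exact: homotopic_quasi_iso hG hE fq qq.
Qed.

(** A resolution is carried along: it is composed with or lifted along the quasi-isomorphisms
    of a zigzag, and the resolution of a cone is the cone of a lift. For a summand [X] of
    [dsum X Y], the sum of resolutions of [X] and [Y] is compared with the given
    resolution. *)
Lemma compact_bounded M : compact_dg M -> has_bounded_resolution M.
Proof.
elim=> {M} [|X Y XY _|n X _ [F [q [p [Fs qq Fp]]]]
  |X Y f _ [F [q [p [Fs qq Fp]]]] _ [G [r [s [Gs rq Gs']]]]
  |X Y _ [F [q [p [Fs qq Fp]]]] _ [G [r [s [Gs rq Gs']]]]|X Y _ XYb].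
- have [i iE] := dghom_id (regular R); exists (regular R), i, 0.
  split; first exact: semifree_regular.
    move=> j; split=> [x xc|x xc]; first by rewrite iE.
    by exists x; rewrite // iE subrr; apply: coboundary0.
  move=> j j0; apply: (tensor_free_acyclic (regular_hbasis R) (fun=> dga_diff1 R)).
  by apply: residue_acyclic; lia.
- by have [+ _] := derived_iso_bounded XY.
- have [t tq] := shift_resolution n qq; exists (shift n F), t, (p - n).
  split=> //; first exact: semifree_shift.
  by move=> j jp; apply: tensor_shift_acyclic; apply: Fp; lia.
- have [fq fqE] := dghom_comp f q; have [g [h [hG hE]]] := semifree_lift fq Fs rq.
  have [|t tq] := @cone_resolution _ _ _ _ _ _ f q r g h hG _ qq rq.
    by move=> x; rewrite -hE fqE.
  exists (cone g), t, (Num.max p s); split=> //; first exact: semifree_cone.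
  move=> j; rewrite gt_max => /andP[pj sj].
  by apply: (cone_acyclic (tensor_cone_data g res)); [exact: Gs' | apply: Fp; lia].
- have [t tq] := dsum_resolution qq rq; exists (dsum F G), t, (Num.max p s).
  split=> //; first exact: semifree_dsum.
  move=> j; rewrite gt_max => /andP[pj sj].
  by apply: tensor_dsum_acyclic; [exact: Fp | exact: Gs'].
have [F [Fs [q qq]]] := semifree_resolution X.
have [G [Gs [r rq]]] := semifree_resolution Y.
have [t tq] := dsum_resolution qq rq.
have [p FGp] := bounded_resolution XYb (semifree_dsum Fs Gs) tq.
exists F, q, p; split=> // j pj; exact: tensor_dsum_acyclic_l (FGp j pj).
Qed.
End Compact.

(** * The amplitude formula *)

Theorem theorem4p3 (k : fieldType) (R : dga k) (hR : simply_connected R)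
    (finR : dga_coh_fin R) (M : dglmod R) (P : dgrmod R) :
  compact_dg M -> locally_finite P -> (amp P < +oo)%E ->
  amp (dtensor P M) = (amp P + pcd hR M - coh_inf M)%E.
Proof.
move=> Mc _ Pamp; rewrite /pcd /dtensor.
have [Fs [q qq]] : semifree (resolution M) /\
    exists f : dghom (resolution M) M, quasi_iso f.
  exact: svalP (cid (semifree_resolution M)).
move: (resolution M) Fs q qq => F Fs q qq.
have FM j : acyclic_at F j <-> acyclic_at M j := qis_acyclic j (chain_dghom q) qq.
have [p0 Fp0] := bounded_resolution (compact_bounded hR Mc) Fs qq.
have [i0 Mi0] := compact_below hR Mc.
have Fi0 : acyclic_below F i0 by move=> j /Mi0/FM.
(* If M or P is acyclic, both sides are -oo, because -oo absorbs +oo in sums. *)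
have [Mac|nM] := pselect (forall j, acyclic_at M j).
  have Fac j : acyclic_at F j by apply/FM.
  rewrite /amp !(coh_sup_acyclic (tensor_semifree_acyclic Fs Fac)).
  by rewrite addeNy !addNye.
have [i [Mi nMi]] := lowest_degree Mi0 nM.
have Fi : acyclic_below F i by move=> j /Mi/FM.
have nFi : ~ acyclic_at F i by move/FM.
have nT : ~ (forall j, acyclic_at (tensor (residue hR) F) j).
  by move=> /(_ i)/(residue_tensor_lowest Fs Fi).
have [p [Fp nFp]] := highest_degree Fp0 nT.
have [Pac|nP] := pselect (forall j, acyclic_at P j).
  have Tac j : acyclic_at (tensor P F) j.
    have Pb : acyclic_below P (j - i + 1) by move=> l _; apply: Pac.
    by apply: (tensor_acyclic_below hR Fs Pb Fi); lia.
  by rewrite /amp (coh_sup_acyclic Tac) (coh_sup_acyclic Pac) !addNye.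
have [[a0 Pa0] [s0 Ps0]] := amp_lt_pinfty Pamp nP.
have [a [Pa nPa]] := lowest_degree Pa0 nP.
have [s [Ps nPs]] := highest_degree Ps0 nP.
have Tinf := coh_infE (tensor_acyclic_below hR Fs Pa Fi) (tensor_lowest hR Fs Pa Fi nPa nFi).
have Tsup := coh_supE (tensor_acyclic_above Fs Fi Ps Fp)
  (tensor_highest Fs Fi Ps Fp nPs nFp).
rewrite /amp Tinf Tsup (coh_infE Pa nPa) (coh_supE Ps nPs) (coh_supE Fp nFp).
rewrite (coh_infE Mi nMi); have sE : s + p - (a + i) = s - a + p - i by lia.
exact: (congr1 EFin sE).
Qed.
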